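(* Let $\Omega\subset\mathscr W_0^G$ be an affinoid in the pure weight space and $L$ a sufficiently large finite extension of $\mathbb Q_p$. For each classical $\lambda\in\Omega$ (i.e. $\lambda\in X_0^*(T)\cap\Omega$) and each $j\in\mathrm{Crit}(\lambda)$, the following diagram commutes: $$\begin{array}{ccccc}\mathcal D_\Omega^1&\xrightarrow{\ \mathrm{sp}_\lambda\ }&\mathcal D_\lambda^1(L)&\xrightarrow{\ r_\lambda\ }&V_\lambda^\vee(L)\\ {\scriptstyle\kappa_\Omega}\downarrow&&{\scriptstyle\kappa_\lambda}\downarrow&&\downarrow{\scriptstyle\kappa_{\lambda,j}}\\ \mathcal D(\mathbb Z_p^\times,\mathcal O_\Omega)&\xrightarrow{\ \mathrm{sp}_\lambda\ }&\mathcal D(\mathbb Z_p^\times,L)&\xrightarrow{\ \mu\mapsto\mu(z^j)\ }&L.\end{array}$$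
   Context: **Groups and weights.** $n\ge1$, $p$ prime, $G=\mathrm{GL}_{2n}$, $H=\mathrm{GL}_n\times\mathrm{GL}_n\subset G$ block-diagonally, $T$ diagonal torus, $N$ (resp. $\overline N$) upper (resp. lower) triangular unipotents, $\mathrm{Iw}_G\subset G(\mathbb Z_p)$ the upper-triangular Iwahori subgroup. $X_0^*(T)$: dominant $\lambda=(\lambda_1\ge\dots\ge\lambda_{2n})\in\mathbb Z^{2n}$ that are pure, i.e. $\lambda_i+\lambda_{2n+1-i}=\mathsf w$ for all $i$. $\mathrm{Crit}(\lambda)=\{j\in\mathbb Z:-\lambda_n\le j\le-\lambda_{n+1}\}$. $V_\lambda(L)$ is the space of algebraic $f:G(\mathbb Z_p)\to L$ with $f(\bar nsg)=\lambda(s)f(g)$ for $\bar n\in\overline N$, $s\in T$, with $G(\mathbb{Z}_p)$ acting by right translation. For $j\in\mathrm{Crit}(\lambda)$ the character $(h_1,h_2)\mapsto\det(h_1)^{-j}\det(h_2)^{\mathsf w+j}$ of $H(\mathbb Z_p)$ occurs in $V_\lambda|_{H(\mathbb Z_p)}$ with multiplicity one. $\mathscr W_0^G$ (pure weight space) is the Zariski closure of the pure dominant weights in the rigid space of continuous characters of $T(\mathbb Z_p)$ (trivial on the $p$-adic closure of $\mathbb{Q}^\times\cap K$ for the fixed level group $K=\mathrm{Iw}_G\prod_{\ell\ne p}G(\mathbb Z_\ell)$, $\mathbb{Q}^\times$ the scalars); $\Omega\subset\mathscr W_0^G$ carries the universal character $\chi_\Omega=(\chi_{\Omega,1},\dots,\chi_{\Omega,2n}):T(\mathbb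 Z_p)\to\mathcal O_\Omega^\times$. One allows $\Omega=\{\lambda\}$, with $\mathcal{O}_\Omega = L$. **Branching vectors.** Put $u=\begin{pmatrix}1_n&w_n\\0&1_n\end{pmatrix}$, $w_n$ the antidiagonal permutation matrix. Let $\alpha_i=(1^i,0^{2n-2i},(-1)^i)$ for $1\le i\le n-1$, $\alpha_n=(1^n,0^n)$, $\alpha_0=(1^{2n})$. Let $v_{(i)}\in V_{\alpha_i}(\mathbb Q_p)$ ($1\le i\le n-1$) be the $H(\mathbb Z_p)$-invariant vector, $v_{(n),1},v_{(n),2}\in V_{\alpha_n}(\mathbb Q_p)$ the vectors on which $(h_1,h_2)$ acts by $\det h_1$, resp. $\det h_2$, and $v_{(0)}=\det\in V_{\alpha_0}$; all are unique up to scalar and are normalised to take the value $1$ at $u$. For $\lambda\in X_0^*(T)$ and $j\in\mathrm{Crit}(\lambda)$ put $$v_{\lambda,j}=\Big(\prod_{i=1}^{n-1}v_{(i)}^{\lambda_i-\lambda_{i+1}}\Big)v_{(n),1}^{-\lambda_{n+1}-j}\,v_{(n),2}^{\lambda_n+j}\,v_{(0)}^{\lambda_{n+1}}\in V_\lambda(\mathbb Q_p),$$ and $\kappa_{\lambda,j}:V_\lambda^\vee(L)\to L$, $\mu\mapsto\mu(v_{\lambda,j})$. **Supports.** For $\beta\ge1$, $N^\beta(\mathbb Z_p)=\{x\in N(\mathbb Z_p):x\equiv u\bmod p^\beta\}$ and $\mathrm{Iw}_G^\beta=\overline N(p\mathbb Z_p)T(\mathbb Z_p)N^\beta(\mathbb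 Z_p)\subset\mathrm{Iw}_G$. All the functions $v_{(i)},v_{(n),i}$ map $N^\beta(\mathbb Z_p)$ into $1+p^\beta\mathbb Z_p$. **Distributions.** $\mathcal A_\Omega$: locally analytic $f:\mathrm{Iw}_G\to\mathcal O_\Omega$ with $f(\bar nsg)=\chi_\Omega(s)f(g)$ for $\bar n\in\overline N(p\mathbb Z_p)$, $s\in T(\mathbb Z_p)$ (so $f$ is determined by $f|_{N(\mathbb Z_p)}$). $\mathcal D_\Omega=\mathrm{Hom}_{\mathrm{cont}}(\mathcal A_\Omega,\mathcal O_\Omega)$. $\mathcal D_\Omega^\beta\subset\mathcal D_\Omega$ is the subspace of $\mu$ with $\mu(f)=\mu(f\cdot\mathbf 1_{\mathrm{Iw}_G^\beta})$ for all $f$. For $\lambda\in\Omega$, $\mathrm{sp}_\lambda$ denotes the reduction maps induced by evaluation $\mathcal O_\Omega\to L$ at $\lambda$. $r_\lambda:\mathcal D_\lambda^\beta(L)\to V_\lambda^\vee(L)$ is dual to the map $V_\lambda(L)\to\mathcal A_\lambda(L)$, $f\mapsto f|_{\mathrm{Iw}_G}\cdot\mathbf 1_{\mathrm{Iw}_G^\beta}$. $\mathcal A(\mathbb Z_p^\times,R)$ is the space of locally analytic functions $\mathbb{Z}_p^\times\to R$ and $\mathcal D(\mathbb Z_p^\times,R)$ its continuous $R$-dual. **The map $\kappa_\Omega$.** Define $w_{\chi_\Omega}:N^1(\mathbb Z_p)\to\mathcal O_\Omega^\times$ by $$w_{\chi_\Omega}(g)=\chi_{\Omega,n+1}(v_{(0)}(g))\prod_{i=1}^{n-1}\frac{\chi_{\Omega,i}}{\chi_{\Omega,i+1}}(v_{(i)}(g))\cdot\chi_{\Omega,n+1}(v_{(n),1}(g))^{-1}\cdot\chi_{\Omega,n}(v_{(n),2}(g)).$$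 For $f\in\mathcal A(\mathbb Z_p^\times,\mathcal O_\Omega)$ let $v_\Omega(f)\in\mathcal A_\Omega$ be the element with $v_\Omega(f)(g)=w_{\chi_\Omega}(g)f\big(v_{(n),2}(g)/v_{(n),1}(g)\big)$ for $g\in N^1(\mathbb Z_p)$ and $v_\Omega(f)(g)=0$ for $g\in N(\mathbb Z_p)\setminus N^1(\mathbb Z_p)$. Then $\kappa_\Omega:\mathcal D_\Omega\to\mathcal D(\mathbb Z_p^\times,\mathcal O_\Omega)$ is $\kappa_\Omega(\mu)(f)=\mu(v_\Omega(f))$; $\kappa_\lambda$ is the case $\Omega=\{\lambda\}$. *)

(* Defs.v *)
From HB Require Import structures.
From mathcomp Require Import all_boot all_order all_algebra all_field.
From mathcomp Require Import boolp classical_sets functions reals.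
From mathcomp Require mpoly.

Set Implicit Arguments.
Unset Strict Implicit.
Unset Printing Implicit Defensive.
Import Order.TTheory GRing.Theory Num.Theory.
Local Open Scope classical_set_scope.
Local Open Scope ring_scope.

(** Convention used throughout: a function on a subset [X] of an ambient type
    is encoded as a function on the ambient type which vanishes off [X].  Thus
    Leibniz equality is equality of functions on [X].  The same convention is
    used for functionals defined on a space [S] of functions. *)
Definition ext0 (T : Type) (V : nmodType) (X : set T) (f : T -> V) : T -> V :=
  patch (fun=> 0) X f.

Definition supported (T : Type) (V : nmodType) (X : set T) (f : T -> V) :=
  forall x, ~ X x -> f x = 0.

Section Norms.
Context {R : realType}.

Definition converges_to (V : zmodType) (nrm : V -> R) (u : nat -> V) (l : V) :=
  forall e : R, 0 < e -> exists N, forall i, (N <= i)%N -> nrm (u i - l) < e.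

Definition complete_for (V : zmodType) (nrm : V -> R) :=
  forall u : nat -> V,
    (forall e : R, 0 < e -> exists N, forall i j,
        (N <= i)%N -> (N <= j)%N -> nrm (u i - u j) < e) ->
    exists l, converges_to nrm u l.

Definition is_ultrametric_abs (F : fieldType) (a : F -> R) :=
  [/\ forall x, 0 <= a x,
      forall x, a x = 0 -> x = 0,
      a 0 = 0,
      forall x y, a (x * y) = a x * a y &
      forall x y, a (x + y) <= Num.max (a x) (a y)].

(** A family indexed by multi-indices tends to 0 along the cofinite filter. *)
Definition null_family (V : zmodType) (nrm : V -> R) (I : finType)
    (c : {ffun I -> nat} -> V) :=
  forall e : R, 0 < e -> exists N : nat, forall a : {ffun I -> nat},
    (exists i, (N <= a i)%N) -> nrm (c a) < e.

(** Sum of a family of multi-indices, as a limit over the boxes [0,N[^I; for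
    null families in an ultrametric space this is the unconditional sum. *)
Definition sums_to (V : zmodType) (nrm : V -> R) (I : finType)
    (c : {ffun I -> nat} -> V) (s : V) :=
  converges_to nrm
    (fun N => \sum_(a : {ffun I -> 'I_N}) c [ffun i => nat_of_ord (a i)]) s.

Definition monomial (A : comNzRingType) (I : finType) (x : I -> A)
    (a : {ffun I -> nat}) : A := \prod_i x i ^+ a i.

End Norms.

(** The field of p-adic numbers, i.e. the completion of the rationals for the
    p-adic absolute value normalised by |p| = 1/p. *)
Record padicField (R : realType) (p : nat) := PadicField {
  pf_sort :> fieldType;
  pabs : pf_sort -> R;
  pabs_abs : is_ultrametric_abs pabs;
  pabs_p : pabs p%:R = p%:R^-1;
  pabs_complete : complete_for pabs;
  pabs_dense : forall (x : pf_sort) (e : R), 0 < e ->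
    exists q : rat, pabs (x - ratr q) < e }.
Arguments pabs {R p _}.

(** A finite extension of Q_p with the absolute value extending that of Q_p. *)
Record padicExt (R : realType) (p : nat) (K : padicField R p) := PadicExt {
  pe_sort :> fieldExtType K;
  eabs : pe_sort -> R;
  eabs_abs : is_ultrametric_abs eabs;
  eabs_ext : forall x : K, eabs x%:A = pabs x }.
Arguments eabs {R p K _}.

Section Affinoid.
Context {R : realType} {p : nat} {K : padicField R p} (L : padicExt K).

Record normedAlg := NormedAlg {
  na_sort :> comUnitAlgType L;
  nrm : na_sort -> R }.
Arguments nrm {_}.

Definition base_alg : normedAlg := @NormedAlg (L^o : comUnitAlgType L) eabs.

Definition is_banach (A : normedAlg) :=
  [/\ forall a : A, 0 <= nrm a,
      forall a : A, nrm a = 0 -> a = 0,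
      forall (c : L) (a : A), nrm (c *: a) = eabs c * nrm a,
      forall a b : A, nrm (a + b) <= Num.max (nrm a) (nrm b) &
      forall a b : A, nrm (a * b) <= nrm a * nrm b]
  /\ complete_for (@nrm A).

(** [A] is an affinoid algebra over [L] and [nrm] is the residue norm of a
    surjection of L-algebras L<X_1,...,X_d> -> A, X_i |-> x_i.  An element of
    the Tate algebra is a null family [c] of coefficients, its Gauss norm is the
    supremum of the |c_a|, and its image is the sum of the c_a x^a.  That
    nrm a is at most every Gauss norm of a preimage of a follows from the
    ultrametric inequality. *)
Definition is_affinoid (A : normedAlg) :=
  is_banach A /\
  exists (d : nat) (x : 'I_d -> A),
    (forall i, nrm (x i) <= 1) /\
    (forall (a : A) (e : R), 0 < e ->
       exists c : {ffun 'I_d -> nat} -> L,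
         [/\ null_family eabs c,
             sums_to (@nrm A) (fun k => c k *: monomial x k) a &
             forall k, eabs (c k) <= nrm a + e]).

Definition is_reduced (A : normedAlg) :=
  forall (a : A) (k : nat), a ^+ k = 0 -> a = 0.

Definition emb (A : normedAlg) (x : K) : A := (x%:A : L)%:A.

(** [f] is given on the closed unit polydisc of K^I by a power series whose
    coefficients tend to zero and have norm at most [M], in the chart [phi]. *)
Definition analytic_chart (A : normedAlg) (I : finType) (X : Type)
    (phi : (I -> K) -> X) (f : X -> A) (M : R) :=
  exists c : {ffun I -> nat} -> A,
    [/\ null_family (@nrm A) c,
        forall k, nrm (c k) <= M &
        forall z : I -> K, (forall i, pabs (z i) <= 1) ->
          sums_to (@nrm A) (fun k => emb A (monomial z k) * c k) (f (phi z))].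

Definition linear_on (A : normedAlg) (X : Type) (S : set (X -> A))
    (mu : (X -> A) -> A) :=
  forall (a : A) (f g : X -> A), S f -> S g ->
    mu (fun x => a * f x + g x) = a * mu f + mu g.

(** Reduction at a point [ev] of the affinoid: a functional [mu] on [S] induces
    a functional on [S'], whose value at [f] is the image under [ev] of the
    value of [mu] at any [F] in [S] reducing to [f]. *)
Definition specialise (A B : normedAlg) (ev : A -> B) (X : Type)
    (S : set (X -> A)) (S' : set (X -> B)) (mu : (X -> A) -> A) :
    (X -> B) -> B :=
  ext0 S' (fun f => ev (mu (xget (fun=> 0) [set F | S F /\ ev \o F = f]))).

End Affinoid.
Arguments nrm {R p K L _}.

Section Groups.
Context {R : realType} {p : nat} (K : padicField R p).

Definition Zp_units : set K := [set t | pabs t = 1].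

Definition GL_Zp (d : nat) : set 'M[K]_d :=
  [set g : 'M[K]_d | (forall i j, pabs (g i j) <= 1) /\ pabs (\det g) = 1].

Definition Iw (d : nat) : set 'M[K]_d :=
  [set g : 'M[K]_d | GL_Zp g /\ forall i j : 'I_d, (j < i)%N -> pabs (g i j) <= p%:R^-1].

Definition torus_Zp (d : nat) : set 'rV[K]_d :=
  [set s : 'rV[K]_d | forall i, Zp_units (s 0 i)].

Definition upper_Zp (d : nat) : set 'M[K]_d :=
  [set x : 'M[K]_d | [/\ forall i, x i i = 1, forall i j : 'I_d, (j < i)%N -> x i j = 0 &
               forall i j, pabs (x i j) <= 1]].

(** Lower unipotent matrices with entries in p^b Z_p below the diagonal. *)
Definition lower_Zp (d b : nat) : set 'M[K]_d :=
  [set x : 'M[K]_d | [/\ forall i, x i i = 1, forall i j : 'I_d, (i < j)%N -> x i j = 0 &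
               forall i j : 'I_d, (j < i)%N -> pabs (x i j) <= p%:R ^- b]].

End Groups.

(** The group GL_(2n) for n = m + 1. *)
Section GL2n.
Context {R : realType} {p : nat} {K : padicField R p} (m : nat).
Local Notation n := m.+1.
Local Notation Mat := 'M[K]_(n + n).

Definition weight := 'I_(n + n) -> int.

Definition pure_dominant (lam : weight) :=
  (forall i k : 'I_(n + n), (i <= k)%N -> lam k <= lam i) /\
  (exists w : int, forall i, lam i + lam (rev_ord i) = w).

(** Indices are shifted by one: lambda_(k+1) and lambda_(k+2), for k < n - 1. *)
Definition idx (k : 'I_m) : 'I_(n + n) := lshift n (widen_ord (leqnSn m) k).
Definition idx_next (k : 'I_m) : 'I_(n + n) := lshift n (lift ord0 k).
(** The indices n and n + 1. *)
Definition idx_n : 'I_(n + n) := lshift n (ord_max : 'I_n).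
Definition idx_n1 : 'I_(n + n) := rshift n (ord0 : 'I_n).

Definition Crit (lam : weight) : set int :=
  [set j | - lam idx_n <= j <= - lam idx_n1].

(** The weight (1^i, 0^(2n-2i), (-1)^i); for i = n, see [alpha_n]. *)
Definition alpha (i : nat) : weight := fun r =>
  if (r < i)%N then 1 else if (n + n - i <= r)%N then -1 else 0.
Definition alpha_n : weight := fun r => if (r < n)%N then 1 else 0.

Definition u_mx : Mat :=
  block_mx 1%:M (\matrix_(i, j) (j == rev_ord i)%:R) 0 1%:M.

Definition N_beta (b : nat) : set Mat :=
  [set x : Mat | upper_Zp x /\ forall i j, pabs (x i j - u_mx i j) <= p%:R ^- b].

Definition Iw_beta (b : nat) : set Mat :=
  [set g : Mat | exists nb s x, [/\ lower_Zp 1 nb, torus_Zp s, N_beta b x &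
                              g = nb *m diag_mx s *m x]].

(** Restriction to GL_(2n)(Z_p) of a regular function of the algebraic group
    GL_(2n) over F. *)
Definition algebraic_fun (F : fieldType) (iota : K -> F) (f : Mat -> F) :=
  exists (P : mpoly.mpoly ((n + n) * (n + n)) F) (k : nat),
    forall g, GL_Zp g ->
      f g = mpoly.meval (fun i => iota (mxvec g 0 i)) P / iota (\det g) ^+ k.

(** V_lambda(F), for a field F containing Q_p via [iota]. *)
Definition V_ (F : fieldType) (iota : K -> F) (lam : weight) :
    set (Mat -> F) :=
  [set f : Mat -> F | [/\ supported (@GL_Zp _ _ K _) f, algebraic_fun iota f &
     forall nb s g, lower_Zp 0 nb -> torus_Zp s -> GL_Zp g ->
       f (nb *m diag_mx s *m g) = iota (\prod_i s 0 i ^ lam i) * f g]].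

(** [v] lies in V_al(Q_p), the block-diagonal subgroup H(Z_p) acts on it by the
    character [psi], and it is normalised by v(u) = 1. *)
Definition branching_vector (al : weight) (psi : 'M[K]_n -> 'M[K]_n -> K)
    (v : Mat -> K) :=
  [/\ V_ idfun al v,
      forall h1 h2 g, GL_Zp h1 -> GL_Zp h2 -> GL_Zp g ->
        v (g *m block_mx h1 0 0 h2) = psi h1 h2 * v g &
      v u_mx = 1].

(** The data v_(1), ..., v_(n-1), v_((n),1), v_((n),2). *)
Record branching_vectors := BranchingVectors {
  v_ : 'I_m -> Mat -> K;
  vn1 : Mat -> K;
  vn2 : Mat -> K;
  v_P : forall k : 'I_m, branching_vector (alpha k.+1) (fun _ _ => 1) (v_ k);
  vn1P : branching_vector alpha_n (fun h1 _ => \det h1) vn1;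
  vn2P : branching_vector alpha_n (fun _ h2 => \det h2) vn2 }.

Definition v_lam (bv : branching_vectors) (lam : weight) (j : int) : Mat -> K :=
  ext0 (@GL_Zp _ _ K _) (fun g =>
    (\prod_(k < m) v_ bv k g ^ (lam (idx k) - lam (idx_next k)))
    * vn1 bv g ^ (- lam idx_n1 - j) * vn2 bv g ^ (lam idx_n + j)
    * \det g ^ lam idx_n1).

Section WeightSpace.
Context {L : padicExt K}.

(** A character of T(Z_p) is the tuple of its components. *)
Definition char_tuple (A : Type) := 'I_(n + n) -> K -> A.

Definition algebraic_char (A : normedAlg L) (lam : weight) : char_tuple A :=
  fun i => ext0 (@Zp_units _ _ K) (fun t => emb A (t ^ lam i)).

(** The p-adic closure in T(Z_p) of the nonzero rational scalars lying in the
    level group, which is Iw_G at p and GL_(2n)(Z_l) at l <> p: these are the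
    rationals which are units at every prime. *)
Definition level_scalars : set 'rV[K]_(n + n) :=
  [set s : 'rV[K]_(n + n) | forall e : R, 0 < e -> exists q : rat,
     (forall l : nat, prime l ->
        ~~ (l %| `|numq q|)%N /\ ~~ (l %| `|denq q|)%N) /\
     forall i, pabs (s 0 i - ratr q) < e].

(** The A-points of the space of continuous characters of T(Z_p) trivial on
    [level_scalars]. *)
Definition weight_char (A : normedAlg L) (chi : char_tuple A) :=
  (forall i, [/\ supported (@Zp_units _ _ K) (chi i),
     chi i 1 = 1,
     forall s t, Zp_units s -> Zp_units t -> chi i (s * t) = chi i s * chi i t &
     forall t (e : R), Zp_units t -> 0 < e -> exists2 d : R, 0 < d &
       forall s, Zp_units s -> pabs (s - t) < d -> nrm (chi i s - chi i t) < e])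
  /\ (forall s, torus_Zp s -> level_scalars s -> \prod_i chi i (s 0 i) = 1).

(** The rigid space of weights is known through its functor of points: a
    morphism Sp B -> W is a B-point [weight_char].  A set of points of W (with
    values in the finite extensions of L) is a closed analytic subset iff its
    preimage in Sp B is the zero locus of an ideal of B, for every Sp B -> W. *)
Definition point_set := forall E : fieldExtType L, set (char_tuple E).

Definition pull (A B : Type) (f : A -> B) (chi : char_tuple A) : char_tuple B :=
  fun i t => f (chi i t).

Definition closed_analytic (Z : point_set) :=
  forall (B : normedAlg L) (chi : char_tuple B),
    is_affinoid B -> weight_char chi ->
    exists J : set B, forall (E : fieldExtType L) (x : {lrmorphism B -> E}),
      Z E (pull x chi) <-> forall b, J b -> x b = 0.

(** The pure weight space: the Zariski closure of the pure dominant weights. *)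
Definition pure_weight_space : point_set := fun E => [set chi |
  forall Z : point_set, closed_analytic Z ->
    (forall lam, pure_dominant lam -> weight_char (algebraic_char (base_alg L) lam) ->
       forall F : fieldExtType L,
         Z F (pull (in_alg F) (algebraic_char (base_alg L) lam))) ->
    Z E chi].

(** Omega = Sp O, with universal character [chi], is an affinoid contained in
    the pure weight space.  The last clause expresses the inclusion by the
    universal property of a reduced affinoid subspace: a morphism from a reduced
    affinoid Sp B to W whose image lies in that of Sp O factors uniquely through
    Sp O.  It holds for affinoid subdomains of the (reduced) pure weight space
    and for Omega = {lambda}, O = L. *)
Definition affinoid_in_pure_weights (O : normedAlg L) (chi : char_tuple O) :=
  [/\ is_affinoid O, is_reduced O, weight_char chi,
      forall (E : fieldExtType L) (x : {lrmorphism O -> E}),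
        pure_weight_space (pull x chi) &
      forall (B : normedAlg L) (chiB : char_tuple B),
        is_affinoid B -> is_reduced B -> weight_char chiB ->
        (forall (E : fieldExtType L) (y : {lrmorphism B -> E}),
           exists (F : fieldExtType L) (s : {lrmorphism E -> F})
                  (x : {lrmorphism O -> F}),
             pull s (pull y chiB) = pull x chi) ->
        (exists phi : {lrmorphism O -> B}, pull phi chi = chiB) /\
        (forall phi psi : {lrmorphism O -> B},
           pull phi chi = chiB -> pull psi chi = chiB -> phi =1 psi)].

End WeightSpace.

Section Distributions.
Context {L : padicExt K} (bv : branching_vectors).

Definition chart_Iw (a : Mat) (h : nat) (z : 'I_(n + n) * 'I_(n + n) -> K) :
    Mat := a + p%:R ^+ h *: \matrix_(i, j) z (i, j).

Definition chart_N (a : Mat) (h : nat) (z : 'I_(n + n) * 'I_(n + n) -> K) :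
    Mat := a + p%:R ^+ h *: \matrix_(i, j) (if (i < j)%N then z (i, j) else 0).

Definition chart_Z (a : K) (h : nat) (z : unit -> K) : K :=
  a + p%:R ^+ h * z tt.

(** The locally analytic induction of [chi]. *)
Definition A_ (A : normedAlg L) (chi : char_tuple A) : set (Mat -> A) :=
  [set f : Mat -> A | [/\ supported (@Iw _ _ K _) f,
     forall a, Iw a -> exists h M, analytic_chart (chart_Iw a h) f M &
     forall nb s g, lower_Zp 1 nb -> torus_Zp s -> Iw g ->
       f (nb *m diag_mx s *m g) = (\prod_i chi i (s 0 i)) * f g]].

(** The dual of the locally convex inductive limit, over h, of the Banach spaces
    of f which are analytic on every ball of radius p^-h of N(Z_p), normed by
    the supremum of the norms of the coefficients. *)
Definition D_ (A : normedAlg L) (chi : char_tuple A) : set ((Mat -> A) -> A) :=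
  [set mu | [/\ supported (A_ chi) mu, linear_on (A_ chi) mu &
     forall h, exists C : R, forall f M, A_ chi f ->
       (forall a, upper_Zp a -> analytic_chart (chart_N a h) f M) ->
       nrm (mu f) <= C * M]].

Definition D_beta (b : nat) (A : normedAlg L) (chi : char_tuple A) :
    set ((Mat -> A) -> A) :=
  [set mu | D_ chi mu /\ forall f, A_ chi f -> mu f = mu (ext0 (Iw_beta b) f)].

Definition A_Zp (A : normedAlg L) : set (K -> A) :=
  [set f : K -> A | supported (@Zp_units _ _ K) f /\
     forall a, Zp_units a -> exists h M, analytic_chart (chart_Z a h) f M].

Definition D_Zp (A : normedAlg L) : set ((K -> A) -> A) :=
  [set mu | [/\ supported (@A_Zp A) mu, linear_on (@A_Zp A) mu &
     forall h, exists C : R, forall f M, A_Zp f ->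
       (forall a, Zp_units a -> analytic_chart (chart_Z a h) f M) ->
       nrm (mu f) <= C * M]].

Definition V_dual (lam : weight) : set ((Mat -> L) -> L) :=
  [set mu | supported (V_ (in_alg L) lam) mu /\
            linear_on (A := base_alg L) (V_ (in_alg L) lam) mu].

Definition w_ (A : normedAlg L) (chi : char_tuple A) (g : Mat) : A :=
  chi idx_n1 (\det g)
  * (\prod_(k < m) (chi (idx k) (v_ bv k g) / chi (idx_next k) (v_ bv k g)))
  * (chi idx_n1 (vn1 bv g))^-1 * chi idx_n (vn2 bv g).

(** The element of [A_ chi] with the prescribed restriction to N(Z_p). *)
Definition v_chi (A : normedAlg L) (chi : char_tuple A) (f : K -> A) : Mat -> A :=
  xget (fun=> 0) [set F | [/\ A_ chi F,
    forall g, N_beta 1 g -> F g = w_ chi g * f (vn2 bv g / vn1 bv g) &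
    forall g, upper_Zp g -> ~ N_beta 1 g -> F g = 0]].

Definition kappa (A : normedAlg L) (chi : char_tuple A) (mu : (Mat -> A) -> A) :
    (K -> A) -> A :=
  ext0 (@A_Zp A) (fun f => mu (v_chi chi f)).

Definition r_ (lam : weight) (mu : (Mat -> base_alg L) -> base_alg L) :
    (Mat -> L) -> L :=
  ext0 (V_ (in_alg L) lam)
    (fun f => mu (ext0 (Iw_beta 1) (ext0 (@Iw _ _ K _) f))).

Definition kappa_lam (lam : weight) (j : int) (mu : (Mat -> L) -> L) : L :=
  mu (fun g => in_alg L (v_lam bv lam j g)).

Definition z_pow (j : int) : K -> base_alg L :=
  ext0 (@Zp_units _ _ K) (fun z => emb (base_alg L) (z ^ j)).

End Distributions.
End GL2n.

(* Main.v *)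
(** Restriction to [N(Z_p)] identifies [A_ chi] with the locally analytic functions
    on [N(Z_p)]: conversely such a function is extended by equivariance along the
    Iwahori decomposition, which is analytic, and continuous characters of [Z_p^*]
    are locally analytic.  So [v_chi chi f] exists for every weight [chi], and both
    squares become identities between functions on [N^1]; the values of the
    branching vectors there are units because [N^1] lies in the orbit of [u] under
    the lower Borel subgroup and [H(Z_p)].  In the first square one must also know
    that [sp] is well defined: a distribution sends a function with values in the
    kernel of the evaluation at [lambda] into this kernel.  By compactness such a
    function is given on finitely many balls by power series, whose coefficients
    can be taken in the kernel since the evaluation is split by the constants, and
    the distribution can be applied term by term. *)

Require Import Defs.
From HB Require Import structures.
From mathcomp Require Import all_boot all_order all_algebra all_field.
From mathcomp Require Import boolp classical_sets functions reals.
From mathcomp Require Import zify ring.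
From mathcomp Require mpoly.
Import (canonicals, coercions) mpoly.
Import Order.TTheory GRing.Theory Num.Theory.
Local Open Scope classical_set_scope.
Local Open Scope ring_scope.

Set Implicit Arguments.
Unset Strict Implicit.
Unset Printing Implicit Defensive.

(** * Complete rings over the p-adic numbers *)

(** A weight is given only as a continuous character with values in a Banach algebra in which the
    norm of 1 may differ from 1. Near 1 it is interpolated at the powers of q = 1 + p^k, with k so
    large that the coefficients, of size p^(-2i), beat the interpolation denominators, of size at
    least p^(-i).

    Analyticity of the Iwahori decomposition requires dividing by analytic functions. The proof
    therefore works with functions at Gauss distance at most d < 1 from an integral constant: this
    class is stable under sums, products and inversion of functions with unit values, always with
    the same d, so that successive Schur complements lose nothing.

    Continuity of [kappa] requires levels and bounds uniform over N(Z_p), whereas local analyticity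
    provides them point by point; compactness closes the gap, through nested balls and the
    completeness of K. Evaluation at lambda is a bare algebra morphism: its continuity comes from a
    geometric series, and the constants split it with bounded norm. *)

Section RealSequences.
Context {R : realType}.

Definition null_seq (M : nat -> R) :=
  forall e : R, 0 < e -> exists N, forall i, (N <= i)%N -> M i < e.

Lemma null_seqM (C : R) (M : nat -> R) :
  0 <= C -> null_seq M -> null_seq (fun i => C * M i).
Proof.
move=> C0 HM e e0.
have C1 : 0 < C + 1 by rewrite ltr_wpDl.
have [N HN] := HM (e / (C + 1)) (divr_gt0 e0 C1).
exists N => i /HN Mi.
(* [null_seq] bounds from above only, so [M i] may be negative. *)
have [Mneg|Mpos] := leP (M i) 0.
  by apply: le_lt_trans e0; rewrite mulr_ge0_le0.
apply: (@lt_le_trans _ _ ((C + 1) * M i)).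
  by rewrite ltr_pM2r // ltrDl.
by apply/ltW; rewrite mulrC -ltr_pdivlMr.
Qed.

Lemma bernoulli (x : R) (n : nat) : 0 <= x -> 1 + x *+ n <= (1 + x) ^+ n.
Proof.
move=> x0; elim: n => [|n IH]; first by rewrite mulr0n addr0 expr0.
rewrite exprS mulrDl mul1r mulrS addrCA addrC.
rewrite lerD // ler_peMr //.
by apply: exprn_ege1; rewrite lerDl.
Qed.

Lemma null_seq_geo (d : R) : 0 <= d -> d < 1 -> null_seq (fun i => d ^+ i).
Proof.
rewrite le_eqVlt => /orP[/eqP<- _|d0 d1] e e0.
  by exists 1%N => -[|i] // _; rewrite expr0n.
(* With d = 1 / (1 + x), Bernoulli's inequality gives d^i <= 1 / (x i). *)
pose x := d^-1 - 1.
have x0 : 0 < x by rewrite subr_gt0 invf_gt1.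
have [N HN] : exists N : nat, e^-1 / x < N%:R.
  exists (Num.bound (e^-1 / x)); apply: archi_boundP.
  by rewrite divr_ge0 ?invr_ge0 ?ltW.
exists N => i Ni.
have -> : d = (1 + x)^-1 by rewrite /x addrC subrK invrK.
have x1 : 0 < 1 + x by rewrite addr_gt0.
have xi : 0 < (1 + x) ^+ i by rewrite exprn_gt0.
rewrite exprVn -[ltRHS]invrK ltf_pV2 ?posrE ?invr_gt0 //.
apply: lt_le_trans (bernoulli i (ltW x0)).
apply: (@lt_le_trans _ _ (x *+ i)); last by rewrite lerDr.
rewrite -mulr_natr mulrC -ltr_pdivrMr //; apply: lt_le_trans HN _.
by rewrite ler_nat.
Qed.

End RealSequences.

(** The norm of 1 need not be 1. *)
Record banach (R : realType) (p : nat) (K : padicField R p) := Banach {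
  bsort :> comNzRingType;
  bnorm : bsort -> R;
  bemb : {rmorphism K -> bsort};
  bnorm_ge0 : forall a, 0 <= bnorm a;
  bnorm_eq0 : forall a, bnorm a = 0 -> a = 0;
  bnorm_emb : forall x a, bnorm (bemb x * a) = pabs x * bnorm a;
  bnormD : forall a b, bnorm (a + b) <= Num.max (bnorm a) (bnorm b);
  bnormM : forall a b, bnorm (a * b) <= bnorm a * bnorm b;
  bcomplete : complete_for bnorm }.
Arguments bnorm {R p K _}.
Arguments bemb {R p K} _.

Section Pabs.
Context {R : realType} {p : nat} {K : padicField R p}.
Implicit Types x y : K.

Lemma pabs_ge0 x : 0 <= pabs x. Proof. by have [] := pabs_abs K. Qed.
Lemma pabs0 : pabs (0 : K) = 0. Proof. by have [] := pabs_abs K. Qed.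
Lemma pabs_eq0 x : pabs x = 0 -> x = 0. Proof. by have [_ + _ _ _] := pabs_abs K; exact. Qed.
Lemma pabsM x y : pabs (x * y) = pabs x * pabs y. Proof. by have [] := pabs_abs K. Qed.
Lemma pabsD x y : pabs (x + y) <= Num.max (pabs x) (pabs y).
Proof. by have [] := pabs_abs K. Qed.

Lemma pabs_gt0 x : x != 0 -> 0 < pabs x.
Proof.
move=> x0; rewrite lt_neqAle pabs_ge0 andbT eq_sym.
by apply: contra_neq x0; exact: pabs_eq0.
Qed.

Lemma pabs1 : pabs (1 : K) = 1.
Proof.
have h : pabs (1 : K) != 0 by rewrite gt_eqF // pabs_gt0 ?oner_neq0.
by apply: (mulfI h); rewrite -pabsM !mulr1.
Qed.

Lemma pabsX x k : pabs (x ^+ k) = pabs x ^+ k.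
Proof. by elim: k => [|k IH]; rewrite ?expr0 ?pabs1 // !exprS pabsM IH. Qed.

Lemma pabsN1 : pabs (-1 : K) = 1.
Proof.
apply/eqP; rewrite -(@pexpr_eq1 _ _ 2) ?pabs_ge0 //.
by rewrite -pabsX sqrrN expr1n pabs1.
Qed.

Lemma pabsN x : pabs (- x) = pabs x.
Proof. by rewrite -mulN1r pabsM pabsN1 mul1r. Qed.

Lemma pabsV x : pabs x^-1 = (pabs x)^-1.
Proof.
have [->|x0] := eqVneq x 0; first by rewrite invr0 pabs0 invr0.
have h : pabs x != 0 by rewrite gt_eqF // pabs_gt0.
by apply: (mulfI h); rewrite -pabsM !mulfV // pabs1.
Qed.

Lemma pabs_prod (I : Type) (r : seq I) (P : pred I) (F : I -> K) :
  pabs (\prod_(i <- r | P i) F i) = \prod_(i <- r | P i) pabs (F i).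
Proof. exact: (big_morph _ pabsM pabs1). Qed.

Definition banach_base : banach K.
Proof.
apply: (@Banach R p K K (@pabs R p K) idfun pabs_ge0 pabs_eq0
  _ pabsD _ (@pabs_complete R p K)).
- by move=> x a; rewrite pabsM.
- by move=> x a; rewrite pabsM.
Defined.

End Pabs.

Section BanachTheory.
Context {R : realType} {p : nat} {K : padicField R p}.

Section One.
Context (A : banach K).
Implicit Types a b : A.

Lemma bnorm0 : bnorm (0 : A) = 0.
Proof. by rewrite -(mul0r 0) -[X in X * _](rmorph0 (bemb A)) bnorm_emb pabs0 mul0r. Qed.

Lemma bnormN a : bnorm (- a) = bnorm a.
Proof.
by rewrite -mulN1r -(rmorphN1 (bemb A)) bnorm_emb pabsN1 mul1r.
Qed.

Lemma bnormDC a b e : bnorm a <= e -> bnorm b <= e -> bnorm (a + b) <= e.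
Proof. by move=> ha hb; apply: le_trans (bnormD a b) _; rewrite ge_max ha. Qed.

Lemma bnormBC a b e : bnorm a <= e -> bnorm b <= e -> bnorm (a - b) <= e.
Proof. by move=> ha hb; apply: bnormDC; rewrite ?bnormN. Qed.

Lemma bnormDClt a b e : bnorm a < e -> bnorm b < e -> bnorm (a + b) < e.
Proof. by move=> ha hb; apply: le_lt_trans (bnormD a b) _; rewrite gt_max ha. Qed.

Lemma bnormBClt a b e : bnorm a < e -> bnorm b < e -> bnorm (a - b) < e.
Proof. by move=> ha hb; apply: bnormDClt; rewrite ?bnormN. Qed.

Lemma bnorm_distC a b : bnorm (a - b) = bnorm (b - a).
Proof. by rewrite -bnormN opprB. Qed.

Lemma bnorm_sum (I : Type) (r : seq I) (P : pred I) (F : I -> A) e :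
  0 <= e -> (forall i, P i -> bnorm (F i) <= e) ->
  bnorm (\sum_(i <- r | P i) F i) <= e.
Proof.
move=> e0 H; elim/big_rec: _ => [|i x Pi]; first by rewrite bnorm0.
exact: bnormDC (H _ Pi).
Qed.

Lemma bnorm_sumlt (I : Type) (r : seq I) (P : pred I) (F : I -> A) e :
  0 < e -> (forall i, P i -> bnorm (F i) < e) ->
  bnorm (\sum_(i <- r | P i) F i) < e.
Proof.
move=> e0 H; elim/big_rec: _ => [|i x Pi]; first by rewrite bnorm0.
exact: bnormDClt (H _ Pi).
Qed.

Lemma bnorm_embE x : bnorm (bemb A x) = pabs x * bnorm (1 : A).
Proof. by rewrite -[bemb A x]mulr1 bnorm_emb. Qed.

Lemma bnorm1_gt0 : 0 < bnorm (1 : A).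
Proof.
rewrite lt_neqAle bnorm_ge0 andbT eq_sym; apply/eqP => /bnorm_eq0 /eqP.
by rewrite oner_eq0.
Qed.

Lemma cvg_unique (u : nat -> A) l l' :
  converges_to bnorm u l -> converges_to bnorm u l' -> l = l'.
Proof.
move=> h h'; apply/eqP; rewrite -subr_eq0; apply/eqP/bnorm_eq0.
apply/eqP; rewrite eq_le bnorm_ge0 andbT leNgt; apply/negP => e0.
have [N HN] := h _ e0; have [N' HN'] := h' _ e0.
have := bnormBClt (HN' (maxn N N') (leq_maxr _ _)) (HN (maxn N N') (leq_maxl _ _)).
by rewrite opprB addrC addrA addrNK ltxx.
Qed.

Lemma cvg_eq (u v : nat -> A) l :
  (exists N, forall i, (N <= i)%N -> u i = v i) ->
  converges_to bnorm u l -> converges_to bnorm v l.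
Proof.
move=> [N HN] h e /h[N' HN']; exists (maxn N N') => i.
by rewrite geq_max => /andP[Ni N'i]; rewrite -HN //; exact: HN'.
Qed.

Lemma cvg_cst a : converges_to bnorm (fun=> a) a.
Proof. by move=> e e0; exists 0%N => i _; rewrite subrr bnorm0. Qed.

Lemma cvgD (u v : nat -> A) l l' :
  converges_to bnorm u l -> converges_to bnorm v l' ->
  converges_to bnorm (fun i => u i + v i) (l + l').
Proof.
move=> h h' e e0; have [N HN] := h _ e0; have [N' HN'] := h' _ e0.
exists (maxn N N') => i; rewrite geq_max => /andP[/HN h1 /HN' h2].
by rewrite opprD addrACA; exact: bnormDClt.
Qed.

Lemma cvg_le (u : nat -> A) l e : 0 <= e ->
  converges_to bnorm u l -> (exists N, forall i, (N <= i)%N -> bnorm (u i) <= e) ->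
  bnorm l <= e.
Proof.
move=> e0 h [N HN]; rewrite leNgt; apply/negP => el.
have [N' HN'] := h _ (le_lt_trans e0 el).
have h1 := HN' _ (leq_maxr N N').
have h2 := le_lt_trans (HN _ (leq_maxl N N')) el.
by have := bnormBClt h2 h1; rewrite opprB addrC subrK ltxx.
Qed.

(** By the ultrametric inequality it suffices that the general term tends to 0. *)
Lemma series_cvg (u : nat -> A) (M : nat -> R) :
  null_seq M -> (forall i, bnorm (u i) <= M i) ->
  exists l, converges_to bnorm (fun N => \sum_(i < N) u i) l.
Proof.
move=> HM Hu; apply: bcomplete => e e0; have [N HN] := HM e e0.
have key i j : (N <= i)%N -> (i <= j)%N ->
    bnorm (\sum_(k < j) u k - \sum_(k < i) u k) < e.
  move=> Ni ij; rewrite -!(big_mkord xpredT) (@big_cat_nat _ _ _ i 0 j) //=.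
  rewrite addrAC subrr add0r big_nat; apply: bnorm_sumlt => // k /andP[ik _].
  by apply: le_lt_trans (Hu k) (HN _ _); rewrite (leq_trans Ni).
exists N => i j Ni Nj; have [ij|/ltnW ji] := leqP i j; last exact: key.
by rewrite bnorm_distC; exact: key.
Qed.

Lemma series_tail (u : nat -> A) (e : R) l N : 0 <= e ->
  (forall i, (N <= i)%N -> bnorm (u i) <= e) ->
  converges_to bnorm (fun N => \sum_(i < N) u i) l ->
  bnorm (l - \sum_(i < N) u i) <= e.
Proof.
move=> e0 Hu h; apply: (@cvg_le (fun j => \sum_(i < j) u i - \sum_(i < N) u i)) => //.
  exact: cvgD h (cvg_cst _).
exists N => j Nj.
rewrite -!(big_mkord xpredT) (@big_cat_nat _ _ _ N 0 j) //=.
rewrite addrAC subrr add0r big_nat; apply: bnorm_sum => // k /andP[Nk _].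
exact: Hu.
Qed.

End One.

(** K-linearity is expressed through [bemb], since a [banach] carries no module structure.
    Multiplication by a fixed element, evaluation at a point and its splitting by constants are all
    of this kind. *)
Definition bounded_map (A B : banach K) (C : R) (f : A -> B) :=
  [/\ forall a b, f (a - b) = f a - f b,
      forall x a, f (bemb A x * a) = bemb B x * f a &
      forall a, bnorm (f a) <= C * bnorm a].

Section BMap.
Context (A B : banach K) (C : R) (f : A -> B) (Hf : bounded_map C f).

Lemma bmap0 : f 0 = 0.
Proof. by have [h _ _] := Hf; rewrite -(subrr 0) h subrr. Qed.
Lemma bmapD a b : f (a + b) = f a + f b.
Proof.
have [h _ _] := Hf; rewrite -{1}[b]opprK h; congr (_ + _).
by rewrite -sub0r h bmap0 opprB subr0.
Qed.
Lemma bmap_sum (I : Type) (r : seq I) (P : pred I) (F : I -> A) :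
  f (\sum_(i <- r | P i) F i) = \sum_(i <- r | P i) f (F i).
Proof. exact: (big_morph _ bmapD bmap0). Qed.

Lemma bmap_cvg (u : nat -> A) l : 0 <= C ->
  converges_to bnorm u l -> converges_to bnorm (fun i => f (u i)) (f l).
Proof.
move=> C0 h e e0; have [h1 _ h3] := Hf.
have hM : null_seq (fun i => bnorm (u i - l)) by move=> e' /h.
have [N HN] := null_seqM C0 hM e0; exists N => i /HN.
by rewrite -h1; apply: le_lt_trans.
Qed.
End BMap.

Lemma bounded_mull (A : banach K) (a : A) : bounded_map (bnorm a) ( *%R^~ a : A -> A).
Proof.
split=> [b c|x b|b] /=; first by rewrite mulrBl.
- by rewrite mulrA.
- by rewrite mulrC bnormM.
Qed.

Lemma bounded_embM (A : banach K) (a : A) :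
  bounded_map (bnorm a) (fun x : banach_base => bemb A x * a).
Proof.
split=> [b c|x b|b] /=; first by rewrite rmorphB mulrBl.
- by rewrite rmorphM mulrA.
- by rewrite bnorm_emb mulrC.
Qed.

End BanachTheory.

(** * Power series on polydiscs *)

Section Boxes.
Variable I : finType.
Implicit Types k : {ffun I -> nat}.

Definition in_box (N : nat) k := [forall i, k i < N]%N.

(** A list of multi-indices instead of functions into ['I_N], so that sums over boxes of different
    sizes range over one type and can be compared. *)
Definition box (N : nat) : seq {ffun I -> nat} :=
  [seq [ffun i => nat_of_ord (a i)] | a : {ffun I -> 'I_N}].

Lemma mem_box N k : (k \in box N) = in_box N k.
Proof.
apply/mapP/forallP => [[a _ ->] i|H]; first by rewrite ffunE.
exists [ffun i => Ordinal (H i)]; first by rewrite mem_enum.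
by apply/ffunP => i; rewrite !ffunE.
Qed.

Lemma box_uniq N : uniq (box N).
Proof.
rewrite map_inj_uniq ?enum_uniq // => a b /ffunP E.
by apply/ffunP => i; apply/val_inj; have := E i; rewrite !ffunE.
Qed.

Lemma in_box_le N N' k : (N <= N')%N -> in_box N k -> in_box N' k.
Proof. by move=> NN' /forallP H; apply/forallP => i; apply: leq_trans (H i) NN'. Qed.

Lemma notin_boxP N k : ~~ in_box N k -> exists i, (N <= k i)%N.
Proof. by rewrite negb_forall => /existsP[i]; rewrite -leqNgt; exists i. Qed.

Definition box_size k : nat := (\max_i k i).+1.

Lemma in_box_size N k : (box_size k <= N)%N -> in_box N k.
Proof.
move=> H; apply/forallP => i; apply: leq_trans H; rewrite ltnS.
exact: (leq_bigmax i).
Qed.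

Variable V : zmodType.
Implicit Types F : {ffun I -> nat} -> V.

Lemma box_sumE N F :
  \sum_(a : {ffun I -> 'I_N}) F [ffun i => nat_of_ord (a i)] = \sum_(k <- box N) F k.
Proof. by rewrite big_map big_enum. Qed.

Lemma box_sum_le N N' F : (N <= N')%N ->
  \sum_(k <- box N' | in_box N k) F k = \sum_(k <- box N) F k.
Proof.
move=> NN'; rewrite -big_filter; apply/perm_big/uniq_perm.
- exact/filter_uniq/box_uniq.
- exact: box_uniq.
- move=> k; rewrite mem_filter !mem_box.
  by case H : (in_box N k) => //=; rewrite (in_box_le NN').
Qed.

Lemma box_sumB N N' F : (N <= N')%N ->
  \sum_(k <- box N') F k - \sum_(k <- box N) F k =
  \sum_(k <- box N' | ~~ in_box N k) F k.
Proof.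
move=> NN'; rewrite (bigID (in_box N)) /= box_sum_le //.
by rewrite addrAC subrr add0r.
Qed.

Lemma box_sum1 N F k : in_box N k -> (forall k', k' != k -> F k' = 0) ->
  \sum_(k' <- box N) F k' = F k.
Proof.
move=> Hk H; rewrite (bigD1_seq k) ?box_uniq ?mem_box //=.
by rewrite big1 ?addr0.
Qed.

End Boxes.

Lemma monomialD (A : comNzRingType) (I : finType) (x : I -> A)
    (k k' : {ffun I -> nat}) :
  monomial x [ffun i => (k i + k' i)%N] = monomial x k * monomial x k'.
Proof.
by rewrite /monomial -big_split; apply: eq_bigr => i _; rewrite ffunE exprD.
Qed.

Section Analytic.
Context {R : realType} {p : nat} {K : padicField R p}.

Definition in_ball (I : Type) (z : I -> K) := forall i, pabs (z i) <= 1.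

Lemma pabs_monomial (I : finType) (z : I -> K) k :
  in_ball z -> pabs (monomial z k) <= 1.
Proof.
move=> Hz; rewrite /monomial pabs_prod; apply: prodr_ile1 => i _.
by rewrite pabs_ge0 pabsX exprn_ile1 ?pabs_ge0.
Qed.

(** [analytic_chart] in the identity chart, over an arbitrary [banach] ring. *)
Definition analytic (A : banach K) (I : finType) (f : (I -> K) -> A) (M : R) :=
  exists c : {ffun I -> nat} -> A,
    [/\ null_family bnorm c, forall k, bnorm (c k) <= M &
        forall z, in_ball z ->
          sums_to bnorm (fun k => bemb A (monomial z k) * c k) (f z)].

Lemma sums_toE (A : banach K) (I : finType) (c : {ffun I -> nat} -> A) s :
  sums_to bnorm c s <-> converges_to bnorm (fun N => \sum_(k <- box I N) c k) s.
Proof.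
rewrite /sums_to /converges_to; split=> H e /H[N HN]; exists N => i /HN;
by rewrite (box_sumE i c).
Qed.

Section OneRing.
Context (A : banach K) (I : finType).
Implicit Types (f g : (I -> K) -> A) (c : {ffun I -> nat} -> A) (k : {ffun I -> nat}) (z : I -> K).

Lemma bnorm_term (z : I -> K) k (a : A) : in_ball z ->
  bnorm (bemb A (monomial z k) * a) <= bnorm a.
Proof.
by move=> Hz; rewrite bnorm_emb ler_piMl ?bnorm_ge0 ?pabs_monomial.
Qed.

Lemma analytic_eq f g M :
  (forall z, in_ball z -> f z = g z) -> analytic f M -> analytic g M.
Proof. by move=> H [c [h1 h2 h3]]; exists c; split=> // z Hz; rewrite -H //; exact: h3. Qed.

Lemma analytic_le f M M' : M <= M' -> analytic f M -> analytic f M'.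
Proof. by move=> H [c [h1 h2 h3]]; exists c; split=> // k; apply: le_trans H. Qed.

Lemma analytic_ge0 f M : analytic f M -> 0 <= M.
Proof. by move=> [c [_ h _]]; apply: le_trans (bnorm_ge0 _) (h [ffun=> 0%N]). Qed.

Lemma analytic_bound f M z : analytic f M -> in_ball z -> bnorm (f z) <= M.
Proof.
move=> Hf Hz; have M0 := analytic_ge0 Hf; case: Hf => c [_ h2 /(_ z Hz) /sums_toE].
move=> /(cvg_le M0); apply; exists 0%N => N _.
by apply: bnorm_sum => // k _; apply: le_trans (bnorm_term _ _ _) _.
Qed.

Lemma null_familyD c c' : null_family bnorm c -> null_family bnorm c' ->
  null_family bnorm (fun k => c k + c' k).
Proof.
move=> h h' e e0; have [N HN] := h e e0; have [N' HN'] := h' e e0.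
exists (maxn N N') => k [i]; rewrite geq_max => /andP[h1 h2].
by apply: bnormDClt; [apply: HN | apply: HN']; exists i.
Qed.

Lemma analyticD f g M :
  analytic f M -> analytic g M -> analytic (fun z => f z + g z) M.
Proof.
move=> [c [h1 h2 h3]] [d [k1 k2 k3]]; exists (fun k => c k + d k); split.
- exact: null_familyD.
- by move=> k; apply: bnormDC.
- move=> z Hz; apply/sums_toE; have /sums_toE s1 := h3 z Hz.
  have /sums_toE s2 := k3 z Hz; apply: cvg_eq (cvgD s1 s2).
  exists 0%N => N _; rewrite -big_split /=.
  by apply: eq_bigr => k _; rewrite mulrDr.
Qed.

Lemma analytic_monomial k (a : A) M : bnorm a <= M ->
  analytic (fun z => bemb A (monomial z k) * a) M.
Proof.
move=> aM; exists (fun k' => if k' == k then a else 0); split.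
- move=> e e0; exists (box_size k) => k' [i Hi]; case: eqP => [Ek|_]; last by rewrite bnorm0.
  have /forallP/(_ i) := @in_box_size _ _ k (leqnn _).
  by move: Hi; rewrite Ek ltnNge => ->.
- by move=> k'; case: ifP => // _; rewrite bnorm0 (le_trans (bnorm_ge0 a)).
- move=> z Hz; apply/sums_toE; apply: cvg_eq (cvg_cst _).
  exists (box_size k) => N /in_box_size kN; rewrite (box_sum1 kN) ?eqxx //.
  by move=> k' /negbTE->; rewrite mulr0.
Qed.

Lemma analytic_cst (a : A) M : bnorm a <= M -> analytic (fun _ : I -> K => a) M.
Proof.
move=> /(analytic_monomial ([ffun=> 0%N] : {ffun I -> nat})); apply: analytic_eq => z _.
rewrite /monomial big1 ?rmorph1 ?mul1r // => i _; by rewrite ffunE expr0.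
Qed.

Lemma analytic0 M : 0 <= M -> analytic (fun _ : I -> K => (0 : A)) M.
Proof. by move=> M0; apply: analytic_cst; rewrite bnorm0. Qed.

Lemma analytic_sum (J : Type) (r : seq J) (P : pred J)
    (F : J -> (I -> K) -> A) M : 0 <= M ->
  (forall j, P j -> analytic (F j) M) ->
  analytic (fun z => \sum_(j <- r | P j) F j z) M.
Proof.
move=> M0 H; elim: r => [|j r IH].
  by apply: analytic_eq (analytic0 M0) => z _; rewrite big_nil.
have [Pj|Pj] := boolP (P j); last first.
  by apply: analytic_eq IH => z _; rewrite big_cons (negbTE Pj).
by apply: analytic_eq (analyticD (H j Pj) IH) => z _; rewrite big_cons Pj.
Qed.

(** The Gauss norms of the terms tend to 0, so that the coefficients may be
    summed. *)
Lemma analytic_series (g : nat -> (I -> K) -> A) f (Ms : nat -> R) M :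
  null_seq Ms -> (forall i, Ms i <= M) ->
  (forall i, analytic (g i) (Ms i)) ->
  (forall z, in_ball z ->
     converges_to bnorm (fun N => \sum_(i < N) g i z) (f z)) ->
  analytic f M.
Proof.
move=> HMs MsM Hg Hf.
have M0 : 0 <= M by apply: le_trans (MsM 0%N); exact: analytic_ge0 (Hg 0%N).
have {Hg} /choice[c Hc] : forall i, exists c : {ffun I -> nat} -> A,
    [/\ null_family bnorm c, forall k, bnorm (c k) <= Ms i &
        forall z, in_ball z ->
          sums_to bnorm (fun k => bemb A (monomial z k) * c k) (g i z)].
  by move=> i; exact: Hg i.
have /choice[d Hd] : forall k, exists l,
    converges_to bnorm (fun N => \sum_(i < N) c i k) l.
  by move=> k; apply: (@series_cvg _ _ _ A (fun i => c i k) Ms HMs) => i; have [_ + _] := Hc i; exact.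
(* One N serves all coefficients and all points, because [Ms] is uniform in both. *)
have tail (e : R) : 0 < e -> exists N,
    (forall k, bnorm (d k - \sum_(i < N) c i k) <= e) /\
    (forall z, in_ball z -> bnorm (f z - \sum_(i < N) g i z) <= e).
  move=> e0; have [N HN] := HMs e e0; exists N; split.
    move=> k; apply: (@series_tail _ _ _ A (fun i => c i k) e _ N _ _ (Hd k)); first exact: ltW.
    move=> i /HN/ltW; have [_ h _] := Hc i; exact: le_trans.
  move=> z Hz; apply: (@series_tail _ _ _ A (fun i => g i z) e _ N _ _ (Hf z Hz)); first exact: ltW.
  move=> i /HN/ltW; apply: le_trans; apply: analytic_bound Hz.
  by exists (c i).
(* [tail] yields non-strict bounds; at e / 2 they become strict bounds by e. *)
have half (e : R) : 0 < e -> 0 < e / 2%:R by move=> ?; rewrite divr_gt0.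
have halflt (e : R) : 0 < e -> e / 2%:R < e.
  by move=> ?; rewrite gtr_pMr // invf_lt1 // ltr1n.
have sumnull N : null_family bnorm (fun k => \sum_(i < N) c i k).
  elim: N => [|N IH]; first by move=> e e0; exists 0%N => k _; rewrite big_ord0 bnorm0.
  have [h _ _] := Hc N; move=> e e0; have [n Hn] := null_familyD IH h e0.
  by exists n => k /Hn; rewrite big_ord_recr.
exists d; split.
- move=> e e0; have [N [HN _]] := tail _ (half e e0).
  have [n Hn] := sumnull N _ e0; exists n => k /Hn h.
  rewrite -(subrK (\sum_(i < N) c i k) (d k)); apply: bnormDClt h.
  exact: le_lt_trans (HN k) (halflt e e0).
- move=> k; apply: cvg_le (Hd k) _ => //; exists 0%N => N _.
  by apply: bnorm_sum => // i _; have [_ h _] := Hc i; apply: le_trans (MsM i).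
- move=> z Hz; apply/sums_toE => e e0.
  have [N [HN1 HN2]] := tail _ (half e e0).
  have [n Hn] : exists n, forall i, (n <= i)%N ->
      bnorm (\sum_(k <- box I i) bemb A (monomial z k) * (\sum_(j < N) c j k)
             - \sum_(j < N) g j z) < e.
    have : converges_to bnorm (fun i => \sum_(j < N)
        \sum_(k <- box I i) bemb A (monomial z k) * c j k) (\sum_(j < N) g j z).
      elim: (N) => [|N' IH].
        apply: cvg_eq; last by rewrite big_ord0; exact: cvg_cst.
        by exists 0%N => i _; rewrite big_ord0.
      have [_ _ /(_ z Hz)/sums_toE h] := Hc N'.
      rewrite big_ord_recr /=; apply: cvg_eq (cvgD IH h).
      by exists 0%N => i _; rewrite big_ord_recr.
    move=> /(_ e e0)[n Hn]; exists n => i /Hn; rewrite exchange_big /=.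
    by under [in X in X -> _]eq_bigr do rewrite -mulr_sumr.
  exists n => i /Hn h.
  (* Three errors: the coefficients [d] against their N-th partial sums, the truncation of N power
     series to a box, and the tail of the series of values at z. *)
  have -> : \sum_(k <- box I i) bemb A (monomial z k) * d k - f z =
     (\sum_(k <- box I i) bemb A (monomial z k) * (d k - \sum_(j < N) c j k) +
      (\sum_(k <- box I i) bemb A (monomial z k) * (\sum_(j < N) c j k)
             - \sum_(j < N) g j z)) - (f z - \sum_(j < N) g j z).
    rewrite (_ : \sum_(k <- box I i) bemb A (monomial z k) * d k =
      \sum_(k <- box I i) bemb A (monomial z k) * (d k - \sum_(j < N) c j k) +
      \sum_(k <- box I i) bemb A (monomial z k) * (\sum_(j < N) c j k)); first by ring.
    by rewrite -big_split /=; apply: eq_bigr => k _; rewrite -mulrDr subrK.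
  apply: bnormBClt; last exact: le_lt_trans (HN2 z Hz) (halflt _ _).
  apply: bnormDClt h; apply: le_lt_trans (halflt e e0).
  apply: bnorm_sum => [|k _]; first exact/ltW/half.
  exact: le_trans (bnorm_term _ _ Hz) (HN1 k).
Qed.

(** The terms are the differences of the partial sums over boxes. *)
Lemma analytic_expand f M : analytic f M ->
  exists (Ms : nat -> R) (d : nat -> {ffun I -> nat} -> A),
    [/\ null_seq Ms, forall i, Ms i <= M, forall i k, bnorm (d i k) <= Ms i,
        forall i, 0 <= Ms i &
        forall z, in_ball z -> converges_to bnorm (fun N =>
          \sum_(i < N) \sum_(k <- box I i.+1) bemb A (monomial z k) * d i k) (f z)].
Proof.
move=> Hf; have M0 := analytic_ge0 Hf; case: Hf => c [h1 h2 h3].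
(* The element 0 keeps the set nonempty and its supremum nonnegative, even when no index lies
   outside the box. *)
pose S N := [set x : R | x = 0 \/ exists2 k, ~~ in_box N k & x = bnorm (c k)].
have SM N x : S N x -> x <= M by move=> [->//|[k _ ->]].
have ubS N : has_ubound (S N) by exists M => x /SM.
have S0 N : S N !=set0 by exists 0; left.
have sup0 i : 0 <= sup (S i) by apply: ub_le_sup => //; left.
have supM i : sup (S i) <= M by apply: ge_sup => // x /SM.
(* Term 0 keeps every coefficient and the sum over box 1 truncates it, hence the bound M. Term i > 0
   drops the indices in box i, so that its sum over box i + 1 is the difference of two partial
   sums. *)
exists (fun N => if N is 0 then M else sup (S N)).
exists (fun N k => if (0 < N)%N && in_box N k then 0 else c k).
split.
- move=> e e0; have [N HN] := h1 (e / 2%:R) (divr_gt0 e0 (ltr0n _ 2)).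
  exists N.+1 => -[//|i] Ni; apply: (@le_lt_trans _ _ (e / 2%:R)).
    apply: ge_sup => // x [->|[k /notin_boxP[j Hj] ->]]; first by rewrite divr_ge0 // ltW.
    by apply/ltW/HN; exists j; apply: leq_trans Hj; rewrite ltnW.
  by rewrite gtr_pMr // invf_lt1 // ltr1n.
- by case.
- move=> [|i] k //=; case: ifPn => h; first by rewrite bnorm0.
  by apply: ub_le_sup => //; right; exists k.
- by case.
- move=> z Hz; have /sums_toE h := h3 z Hz; apply: cvg_eq h.
  exists 1%N => -[//|N] _.
  elim: N => [|N IH]; first by rewrite big_ord1.
  rewrite big_ord_recr /= -IH -[LHS](subrK (\sum_(k <- box I N.+1)
    bemb A (monomial z k) * c k)) box_sumB // addrC; congr (_ + _).
  rewrite [LHS]big_mkcond; apply: eq_bigr => k _.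
  by case: (in_box N.+1 k); rewrite /= ?mulr0.
Qed.

End OneRing.
End Analytic.

Notation analyticK := (analytic (A := banach_base)).

(** * Products, composition and inversion of power series *)

Section AnalyticOps.
Context {R : realType} {p : nat} {K : padicField R p}.

Lemma bnorm_baseE (x : K) : bnorm (x : banach_base) = pabs x.
Proof. by []. Qed.

Lemma bounded_map_ge0 (A B : banach K) C (f : A -> B) : bounded_map C f -> 0 <= C.
Proof.
move=> [_ _ /(_ 1)] h; rewrite -(@pmulr_lge0 _ (bnorm (1 : A))) ?bnorm1_gt0 //.
exact: le_trans (bnorm_ge0 _) h.
Qed.

Lemma analytic_map (A B : banach K) (I : finType) C (t : A -> B)
    (f : (I -> K) -> A) M :
  bounded_map C t -> analytic f M -> analytic (fun z => t (f z)) (C * M).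
Proof.
move=> Ht [c [h1 h2 h3]]; have C0 := bounded_map_ge0 Ht.
have [t1 t2 t3] := Ht; exists (fun k => t (c k)); split.
- move=> e e0; have C1 : 0 < C + 1 by rewrite ltr_wpDl.
  have [N HN] := h1 _ (divr_gt0 e0 C1); exists N => k /HN.
  rewrite ltr_pdivlMr // mulrC => h; apply: le_lt_trans (t3 _) _.
  by apply: le_lt_trans h; rewrite mulrDl mul1r lerDl bnorm_ge0.
- by move=> k; apply: le_trans (t3 _) _; rewrite ler_wpM2l.
- move=> z Hz; apply/sums_toE; have /sums_toE h := h3 z Hz.
  apply: cvg_eq (bmap_cvg Ht C0 h); exists 0%N => N _.
  by rewrite (bmap_sum Ht); apply: eq_bigr => k _; rewrite t2.
Qed.

Lemma analyticN (A : banach K) (I : finType) (f : (I -> K) -> A) M :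
  analytic f M -> analytic (fun z => - f z) M.
Proof.
have t : bounded_map 1 (fun a : A => - a).
  split=> [a b|x a|a]; first by rewrite opprB opprK addrC.
  - by rewrite mulrN.
  - by rewrite bnormN mul1r.
by move=> /(analytic_map t); rewrite mul1r.
Qed.

Lemma analyticB (A : banach K) (I : finType) (f g : (I -> K) -> A) M :
  analytic f M -> analytic g M -> analytic (fun z => f z - g z) M.
Proof. by move=> hf /analyticN; exact: analyticD. Qed.

(** Cauchy products of coefficient families are avoided: f is expanded into finite sums of
    monomials, each monomial is shifted, and [analytic_series] adds up the results. The general
    product then expands the other factor in the same way. *)
Lemma analytic_monomialM (A : banach K) (I : finType) (f : (I -> K) -> A)
    (k : {ffun I -> nat}) a m M :
  bnorm a <= m -> analytic f M ->
  analytic (fun z => bemb A (monomial z k) * a * f z) (m * M).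
Proof.
move=> am Hf; have [Ms [d [h1 h2 h3 h4 h5]]] := analytic_expand Hf.
have m0 := le_trans (bnorm_ge0 _) am.
apply: (analytic_series (null_seqM m0 h1)
  (g := fun i z => \sum_(k' <- box I i.+1) bemb A (monomial z
      [ffun j => (k j + k' j)%N]) * (a * d i k'))).
- by move=> i; rewrite ler_wpM2l.
- move=> i; apply: analytic_sum => [|k' _]; first exact: mulr_ge0.
  apply: analytic_monomial; apply: le_trans (bnormM _ _) _.
  by apply: ler_pM; rewrite ?bnorm_ge0.
- move=> z Hz; rewrite mulrC.
  have := bmap_cvg (bounded_mull (bemb A (monomial z k) * a))
    (bnorm_ge0 _) (h5 z Hz).
  apply: cvg_eq; exists 0%N => N _; rewrite mulr_suml; apply: eq_bigr => i _.
  rewrite mulr_suml; apply: eq_bigr => k' _.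
  by rewrite monomialD rmorphM /=; ring.
Qed.

Lemma analyticM (A : banach K) (I : finType) (g f : (I -> K) -> A) M' M :
  analytic g M' -> analytic f M -> analytic (fun z => g z * f z) (M' * M).
Proof.
move=> Hg Hf; have [Ms [d [h1 h2 h3 h4 h5]]] := analytic_expand Hg.
have M0 := analytic_ge0 Hf.
apply: (analytic_series (Ms := fun i => M * Ms i)
  (g := fun i z => \sum_(k <- box I i.+1) bemb A (monomial z k) * d i k * f z)).
- exact: null_seqM.
- by move=> i; rewrite mulrC ler_wpM2r.
- move=> i; apply: analytic_sum => [|k _]; first exact: mulr_ge0.
  by rewrite mulrC; exact: analytic_monomialM.
- move=> z Hz; have := bmap_cvg (bounded_mull (f z)) (bnorm_ge0 _) (h5 z Hz).
  apply: cvg_eq; exists 0%N => N _; rewrite mulr_suml.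
  by apply: eq_bigr => i _; rewrite mulr_suml.
Qed.

Lemma analytic_emb (A : banach K) (I : finType) (g : (I -> K) -> K) M :
  analyticK g M -> analytic (fun z => bemb A (g z)) (bnorm (1 : A) * M).
Proof.
move=> Hg; have := analytic_map (bounded_embM (1 : A)) Hg.
by apply: analytic_eq => z _; rewrite mulr1.
Qed.

(** Positive exponents only: M^0 = 1 need not bound the norm of 1 in A. *)
Lemma analyticX1 (A : banach K) (I : finType) (g : (I -> K) -> A) (M : R) n :
  analytic g M -> analytic (fun z => g z ^+ n.+1) (M ^+ n.+1).
Proof.
move=> Hg; elim: n => [|n IH]; first by rewrite expr1; apply: analytic_eq Hg.
rewrite exprS; have := analyticM Hg IH.
by apply: analytic_eq => z _; rewrite -exprS.
Qed.

Section Base.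
Context (I : finType).
Implicit Types g : (I -> K) -> K.

Lemma analytic_base_cst (a : K) (M : R) : pabs a <= M ->
  analyticK (fun _ : I -> K => a) M.
Proof. exact: (@analytic_cst _ _ _ banach_base I a M). Qed.

Lemma analyticM1 g g' :
  analyticK g 1 -> analyticK g' 1 -> analyticK (fun z => g z * g' z) 1.
Proof. by move=> h h'; have := analyticM h h'; rewrite mulr1. Qed.

Lemma analyticX g (M : R) n : M <= 1 ->
  analyticK g M -> analyticK (fun z => g z ^+ n) (M ^+ n).
Proof.
case: n => [|n] M1 H; last exact: analyticX1.
by rewrite expr0; apply: analytic_base_cst; rewrite pabs1.
Qed.

Lemma analyticX_le1 g n : analyticK g 1 -> analyticK (fun z => g z ^+ n) 1.
Proof. by move=> /(analyticX n (lexx 1)); rewrite expr1n. Qed.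

Lemma analytic_prod (J : Type) (r : seq J) (P : pred J)
    (F : J -> (I -> K) -> K) :
  (forall j, P j -> analyticK (F j) 1) ->
  analyticK (fun z => \prod_(j <- r | P j) F j z) 1.
Proof.
move=> H; elim: r => [|j r IH].
  apply: (@analytic_eq _ _ _ banach_base I (fun=> 1)) => [z _|]; first by rewrite big_nil.
  by apply: analytic_base_cst; rewrite pabs1.
have [Pj|Pj] := boolP (P j); last first.
  by apply: analytic_eq IH => z _; rewrite big_cons (negbTE Pj).
by apply: analytic_eq (analyticM1 (H j Pj) IH) => z _; rewrite big_cons Pj.
Qed.

Lemma analytic_monomial_comp (J : finType) (F : J -> (I -> K) -> K) k :
  (forall j, analyticK (F j) 1) ->
  analyticK (fun z => (monomial (fun j => F j z) k : K)) 1.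
Proof. by move=> H; apply: analytic_prod => j _; apply: analyticX_le1. Qed.

Lemma analytic_coord i : analyticK (fun z : I -> K => z i) 1.
Proof.
have := @analytic_monomial R p K banach_base I [ffun j => nat_of_bool (j == i)] 1 1.
rewrite bnorm_baseE pabs1 lexx => /(_ isT); apply: analytic_eq => z _.
rewrite /monomial (bigD1 i) //= ffunE eqxx expr1 big1 ?mulr1 // => j /negbTE ji.
by rewrite ffunE ji.
Qed.

Lemma analytic_in_ball g z : analyticK g 1 -> in_ball z -> pabs (g z : K) <= 1.
Proof. exact: analytic_bound. Qed.

End Base.

(** Monomials in functions of Gauss norm at most 1 again have Gauss norm at most 1, so the bounds of
    [analytic_expand] survive the substitution. *)
Lemma analytic_comp (A : banach K) (I J : finType) (f : (I -> K) -> A)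
    (phi : I -> (J -> K) -> K) M :
  (forall i, analyticK (phi i) 1) -> analytic f M ->
  analytic (fun z => f (fun i => phi i z)) M.
Proof.
move=> Hphi /analytic_expand[Ms [d [h1 h2 h3 h4 h5]]].
apply: (analytic_series (g := fun i z => \sum_(k <- box I i.+1)
   bemb A (monomial (fun i => phi i z) k) * d i k) h1 h2).
- move=> i; apply: analytic_sum => // k _.
  have := analytic_monomial_comp k Hphi; move=> /(analytic_map (bounded_embM (d i k))); rewrite mulr1.
  exact: analytic_le.
- move=> z Hz; apply: h5 => i; exact: analytic_in_ball Hz.
Qed.

(** The constant subtracted is the constant coefficient; every other monomial gains at least one
    factor x. *)
Lemma analytic_shrink (A : banach K) (I : finType) (f : (I -> K) -> A) (M : R)
    (x : K) : pabs x <= 1 -> analytic f M ->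
  exists2 a, bnorm a <= M & analytic (fun z => f (fun i => x * z i) - a) (pabs x * M).
Proof.
move=> x1 Hf; have M0 := analytic_ge0 Hf; case: Hf => c [h1 h2 h3].
pose k0 : {ffun I -> nat} := [ffun=> 0%N].
exists (c k0) => //.
pose y (k : {ffun I -> nat}) := monomial (fun=> x) k.
have y1 k : pabs (y k) <= 1 by apply: pabs_monomial.
have yx k : k != k0 -> pabs (y k) <= pabs x.
  move=> kk; have [i ki] : exists i, k i != 0%N.
    apply/existsP; apply: contra_neqT kk => /existsPn H.
    by apply/ffunP => i; rewrite ffunE; apply/eqP/negbNE/H.
  rewrite /y /monomial (bigD1 i) //= pabsM -(prednK (n := k i)) ?lt0n // exprS pabsM.
  rewrite -mulrA ler_piMr ?pabs_ge0 //.
  rewrite -pabsM pabsM pabs_prod pabsX mulr_ile1 ?exprn_ge0 ?exprn_ile1 ?pabs_ge0 //.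
    by apply: prodr_ge0 => j _; rewrite pabs_ge0.
  by apply: prodr_ile1 => j _; rewrite pabs_ge0 pabsX exprn_ile1 ?pabs_ge0.
exists (fun k => if k == k0 then 0 else bemb A (y k) * c k); split.
- move=> e e0; have [N HN] := h1 e e0; exists N => k /HN h.
  case: eqP => _; first by rewrite bnorm0.
  apply: le_lt_trans h; rewrite bnorm_emb; exact: ler_piMl (bnorm_ge0 _) _.
- move=> k; case: eqP => [_|/eqP kk]; first by rewrite bnorm0 mulr_ge0 ?pabs_ge0.
  by rewrite bnorm_emb; apply: ler_pM; rewrite ?pabs_ge0 ?bnorm_ge0 // yx.
- move=> z Hz; apply/sums_toE.
  have Hz' : in_ball (fun i => x * z i).
    by move=> i; rewrite pabsM mulr_ile1 ?pabs_ge0.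
  have /sums_toE h := h3 _ Hz'; apply: cvg_eq (cvgD h (cvg_cst (- c k0))).
  exists (box_size k0) => N /in_box_size kN.
  rewrite -mem_box in kN.
  rewrite (bigD1_seq k0) ?box_uniq //= [RHS](bigD1_seq k0) ?box_uniq //= eqxx mulr0 add0r.
  rewrite {1}/monomial big1 => [|i _]; last by rewrite ffunE expr0.
  rewrite rmorph1 mul1r addrAC subrr add0r; apply: eq_bigr => k /negbTE->.
  rewrite mulrA -rmorphM; congr (bemb A _ * _).
  by rewrite /y /monomial -big_split; apply: eq_bigr => i _; rewrite exprMn mulrC.
Qed.

(** For d < 1 these functions form a ring, and those with a unit value are invertible in it, with
    the same d throughout. *)
Definition near_cst (I : finType) (d : R) (g : (I -> K) -> K) :=
  exists2 a, pabs a <= 1 & analyticK (fun z => (g z - a : K)) d.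

Section NearCst.
Context (I : finType) (d : R) (d1 : d < 1).
Implicit Types g : (I -> K) -> K.

Lemma near_cst_eq g g' : (forall z, in_ball z -> g z = g' z) ->
  near_cst d g -> near_cst d g'.
Proof.
move=> E [a a1 H]; exists a => //; apply: analytic_eq H => z Hz; by rewrite E.
Qed.

Lemma near_cst_analytic g : near_cst d g -> analyticK g 1.
Proof.
move=> [a a1 /(analytic_le (ltW d1)) H].
have := analyticD H (analytic_base_cst _ a1).
by apply: analytic_eq => z _; rewrite subrK.
Qed.

Lemma near_cst_cst a : 0 <= d -> pabs a <= 1 -> near_cst d (fun _ : I -> K => a).
Proof.
move=> d0 a1; exists a => //; apply: analytic_base_cst; by rewrite subrr pabs0.
Qed.

Lemma near_cstD g g' : near_cst d g -> near_cst d g' ->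
  near_cst d (fun z => g z + g' z).
Proof.
move=> [a a1 H] [b b1 H']; exists (a + b).
  by apply: le_trans (pabsD _ _) _; rewrite ge_max a1.
apply: analytic_eq (analyticD H H') => z _ /=; ring.
Qed.

Lemma near_cstM g g' : near_cst d g -> near_cst d g' ->
  near_cst d (fun z => g z * g' z).
Proof.
move=> hg [b b1 H']; have Hg := near_cst_analytic hg; case: hg => [a a1 H].
exists (a * b); first by rewrite pabsM mulr_ile1 ?pabs_ge0.
have h1 := analyticM Hg H'; rewrite mul1r in h1.
have h2 := analyticM H (analytic_base_cst I b1); rewrite mulr1 in h2.
apply: analytic_eq (analyticD h1 h2) => z _ /=; ring.
Qed.

Lemma near_cstN g : near_cst d g -> near_cst d (fun z => - g z).
Proof.
move=> [a a1 H]; exists (- a); first by rewrite pabsN.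
by apply: analytic_eq (analyticN H) => z _ /=; ring.
Qed.

Lemma near_cst_sum (J : Type) (r : seq J) (P : pred J) (F : J -> (I -> K) -> K) :
  0 <= d -> (forall j, P j -> near_cst d (F j)) ->
  near_cst d (fun z => \sum_(j <- r | P j) F j z).
Proof.
move=> d0 H; elim: r => [|j r IH].
  apply: (@near_cst_eq (fun=> 0)) => [z _|]; first by rewrite big_nil.
  by apply: near_cst_cst; rewrite ?pabs0.
have [Pj|Pj] := boolP (P j); last first.
  by apply: near_cst_eq IH => z _; rewrite big_cons (negbTE Pj).
by apply: near_cst_eq (near_cstD (H j Pj) IH) => z _; rewrite big_cons Pj.
Qed.

Lemma near_cst_unit g z0 : near_cst d g -> in_ball z0 -> pabs (g z0) = 1 ->
  exists2 a, pabs a = 1 & analyticK (fun z => (g z - a : K)) d.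
Proof.
move=> [a a1 H] Hz g1; exists a => //.
apply/eqP; rewrite eq_le a1 /= leNgt; apply/negP => alt.
have h := le_lt_trans (analytic_bound H Hz) d1.
have := bnormDClt (A := banach_base) h alt.
by rewrite subrK bnorm_baseE g1 ltxx.
Qed.

(** Geometric series. *)
Lemma near_cstV g z0 : in_ball z0 -> pabs (g z0) = 1 -> near_cst d g ->
  near_cst d (fun z => (g z)^-1).
Proof.
move=> Hz0 g0 hg; have [a a1 H] := near_cst_unit hg Hz0 g0.
have d0 := analytic_ge0 H.
have an0 : a != 0 by apply/eqP => a0; move: a1; rewrite a0 pabs0 => /eqP; rewrite eq_sym oner_eq0.
exists a^-1; first by rewrite pabsV a1 invr1.
(* Thus g = a (1 - y) with y of Gauss norm at most d. The series below starts at y^1 because a^-1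
   has been subtracted. *)
pose y z : K := - ((g z - a) / a).
have Hy : analyticK y d.
  have ai : pabs a^-1 <= 1 by rewrite pabsV a1 invr1.
  have := analyticN (analyticM H (analytic_base_cst I ai)); rewrite mulr1.
  by apply: analytic_eq.
have E z : g z = a * (1 - y z) by rewrite /y opprK mulrDr mulr1 mulrCA divff // mulr1 addrC subrK.
apply: (@analytic_series _ _ _ banach_base I (fun i z => (y z ^+ i.+1 / a))
  _ (fun i => d ^+ i.+1)).
- move=> e e0; have [N HN] := null_seq_geo d0 d1 e0; exists N => i Ni.
  by apply: HN; rewrite ltnW // ltnS.
- by move=> i; rewrite exprS ler_piMr // exprn_ile1 // ltW.
- move=> i; have ai : pabs a^-1 <= 1 by rewrite pabsV a1 invr1.
  have := analyticM (analyticX1 i Hy) (analytic_base_cst I ai); rewrite mulr1.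
  by apply: analytic_eq.
- move=> z Hz e e0.
  have yd : pabs (y z) <= d by exact: (analytic_bound Hy Hz).
  have y1 : pabs (y z) < 1 by exact: le_lt_trans d1.
  have yn : 1 - y z != 0.
    apply/eqP => /eqP; rewrite subr_eq0 => /eqP h.
    by move: y1; rewrite -h pabs1 ltxx.
  have [N HN] := null_seq_geo d0 d1 e0; exists N => n Nn.
  have -> : \sum_(i < n) y z ^+ i.+1 / a - ((g z)^-1 - a^-1) =
     - (y z ^+ n.+1 / (a * (1 - y z))).
    rewrite E; elim: {Nn} n => [|n IH].
      by rewrite big_ord0 expr1; field; rewrite an0 yn.
    rewrite big_ord_recr /= addrAC IH !exprS; field; by rewrite an0 yn.
  rewrite bnorm_baseE pabsN pabsM pabsV pabsM a1 mul1r.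
  have -> : pabs (1 - y z) = 1.
    have := congr1 pabs (E z); rewrite pabsM a1 mul1r => <-.
    have hh := bnormDClt (A := banach_base); apply/eqP; rewrite eq_le.
    rewrite (analytic_in_ball (near_cst_analytic hg) Hz) /= leNgt; apply/negP => glt.
    have h := le_lt_trans (analytic_bound H Hz) d1; rewrite bnorm_distC in h.
    by have := hh _ _ _ _ _ _ h glt; rewrite subrK bnorm_baseE a1 ltxx.
  rewrite invr1 mulr1 pabsX; apply: (@le_lt_trans _ _ (d ^+ n)); last exact: HN.
  apply: (@le_trans _ _ (d ^+ n.+1)); first by rewrite lerXn2r ?nnegrE ?pabs_ge0.
  by rewrite exprS ler_piMl ?exprn_ge0 // ltW.
Qed.

End NearCst.

End AnalyticOps.

(** * Integers in the p-adic field *)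

Section PadicIntegers.
Context {R : realType} {p : nat} {K : padicField R p}.
Hypothesis p_pr : prime p.
Implicit Types (x y t : K).

Local Notation "'rad' h" := ((p%:R : R) ^- h) (at level 10).

Lemma p_gt0 : 0 < (p%:R : R). Proof. by rewrite ltr0n prime_gt0. Qed.
Lemma p_ge1 : 1 <= (p%:R : R). Proof. by rewrite ler1n prime_gt0. Qed.

Lemma rad_gt0 h : 0 < rad h.
Proof. by rewrite invr_gt0 exprn_gt0 // p_gt0. Qed.
Lemma rad_ge0 h : 0 <= rad h. Proof. exact/ltW/rad_gt0. Qed.

Lemma radD h k : rad (h + k) = rad h * rad k.
Proof. by rewrite exprD invfM. Qed.

Lemma rad0 : rad 0 = 1. Proof. by rewrite expr0 invr1. Qed.

Lemma rad_le h k : (h <= k)%N -> rad k <= rad h.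
Proof.
move=> /subnKC<-; rewrite radD ler_piMr ?rad_ge0 //.
by rewrite invf_le1 ?exprn_gt0 ?p_gt0 // exprn_ege1 // p_ge1.
Qed.

Lemma rad_le1 h : rad h <= 1. Proof. by have := rad_le (leq0n h); rewrite rad0. Qed.

Lemma rad1_half : rad 1 <= 2%:R^-1.
Proof. by rewrite expr1 lef_pV2 ?posrE ?p_gt0 // ler_nat prime_gt1. Qed.

Lemma rad1_lt1 : rad 1 < 1.
Proof. by apply: le_lt_trans rad1_half _; rewrite invf_lt1 // ltr1n. Qed.

Lemma rad_lt1 h : (0 < h)%N -> rad h < 1.
Proof. by move=> h0; apply: le_lt_trans rad1_lt1; rewrite rad_le. Qed.

Lemma rad_null : null_seq (fun h => rad h).
Proof.
have h := null_seq_geo (rad_ge0 1) rad1_lt1.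
by move=> e /h[N HN]; exists N => i /HN; rewrite expr1 exprVn.
Qed.

Lemma rad_small (C e : R) : 0 < e -> exists h, C * rad h <= e.
Proof.
move=> e0; have [C0|C0] := leP C 0.
  by exists 0%N; apply: le_trans (ltW e0); rewrite mulr_le0_ge0 // rad_ge0.
have [N HN] := null_seqM (ltW C0) rad_null e0.
by exists N; apply/ltW/HN.
Qed.

Lemma pabs_pX h : pabs (p%:R ^+ h : K) = rad h.
Proof. by rewrite pabsX pabs_p exprVn. Qed.

Lemma pX_neq0 h : p%:R ^+ h != 0 :> K.
Proof.
apply/eqP => E; have := pabs_pX h; rewrite E pabs0 => /eqP.
by rewrite eq_sym gt_eqF // rad_gt0.
Qed.

Lemma pabs_nat n : pabs (n%:R : K) <= 1.
Proof.
elim: n => [|n IH]; first by rewrite pabs0.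
by rewrite -natr1 (le_trans (pabsD _ _)) // ge_max IH pabs1 /=.
Qed.

Lemma pabs_intr (z : int) : pabs (z%:~R : K) = pabs (`|z|%N%:R : K).
Proof. by case: z => n //; rewrite NegzE rmorphN pabsN abszN. Qed.

Lemma pabs_int (z : int) : pabs (z%:~R : K) <= 1.
Proof.
by rewrite pabs_intr pabs_nat.
Qed.

(** Bezout writes 1 = c p - a n; if n had absolute value less than 1, then so would 1. *)
Lemma pabs_coprime n : coprime p n -> pabs (n%:R : K) = 1.
Proof.
move=> cop; apply/eqP; rewrite eq_le pabs_nat leNgt; apply/negP => n1.
have [a _ /dvdnP[c]] := Bezoutl n (prime_gt0 p_pr).
rewrite (eqP cop) add1n => E.
have : pabs ((a * n).+1%:R : K) < 1.
  rewrite E natrM pabsM; apply: le_lt_trans (ler_piMl (pabs_ge0 _) (pabs_nat _)) _.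
  by rewrite pabs_p -[_^-1]/(p%:R^-1) -[p%:R]expr1 rad1_lt1.
rewrite -natr1 natrM => h.
have h2 : pabs (a%:R * n%:R : K) < 1.
  by rewrite pabsM; apply: le_lt_trans (ler_piMl (pabs_ge0 _) (pabs_nat _)) n1.
have := bnormBClt (A := banach_base) h h2.
by rewrite addrAC subrr add0r bnorm_baseE pabs1 ltxx.
Qed.

Lemma pabs_logn n : (0 < n)%N -> pabs (n%:R : K) = rad (logn p n).
Proof.
move=> n0; have [m cop {1}->] := pfactor_coprime p_pr n0.
by rewrite natrM pabsM pabs_coprime // mul1r natrX pabs_pX.
Qed.

Lemma rad_inj_le h k : rad h <= rad k -> (k <= h)%N.
Proof.
rewrite leNgt => H; rewrite leqNgt; apply: contra H => hk.
rewrite ltf_pV2 ?posrE ?exprn_gt0 ?p_gt0 // ltr_eXn2l //.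
by rewrite ltr1n prime_gt1.
Qed.

Lemma pabs_dvd n h : pabs (n%:R : K) <= rad h -> (p ^ h %| n)%N.
Proof.
have [->//|] := posnP n.
by move=> n0; rewrite pabs_logn // => /rad_inj_le; rewrite pfactor_dvdn.
Qed.

(** In Legendre's formula the first quotient is n / p, and by induction the remaining ones add up to
    at most n / p; as p >= 2, the total is at most n. *)
Lemma logn_fact_le n : (logn p n`! <= n)%N.
Proof.
rewrite logn_fact //.
have key k : forall n, (\sum_(1 <= i < k.+1) n %/ p ^ i <= n)%N.
  elim: k => [|k IH] m; first by rewrite big_geq.
  rewrite big_nat_recl // expn1.
  under eq_bigr do rewrite expnS divnMA.
  apply: (@leq_trans (m %/ p + m %/ p)); first by rewrite leq_add2l IH.
  rewrite addnn -muln2; apply: leq_trans (leq_trunc_div m p).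
  by rewrite leq_mul2l prime_gt1 // orbT.
exact: key.
Qed.

Lemma pabs_fact n : rad n <= pabs (n`!%:R : K).
Proof. by rewrite pabs_logn ?fact_gt0 // rad_le // logn_fact_le. Qed.

(** The field is given with a dense copy of the rationals only. A rational close to x is p-integral,
    so its reduced denominator is prime to p and can be inverted modulo p^h. *)
Lemma residue x h : pabs x <= 1 ->
  exists2 n, (n < p ^ h)%N & pabs (x - n%:R) <= rad h.
Proof.
move=> x1; have [q Hq] := pabs_dense x (rad_gt0 h).
have q1 : pabs (ratr q : K) <= 1.
  rewrite -[ratr q](subKr x); apply: (bnormBC (A := banach_base)) => //.
  exact/ltW/(lt_le_trans Hq)/rad_le1.
pose b := `|denq q|%N; pose a := numq q.
have bE : (denq q)%:~R = b%:R :> K by rewrite /b -[in LHS](gez0_abs (ltW (denq_gt0 q))).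
have b0 : (0 < b)%N by rewrite absz_gt0 denq_neq0.
have cop : coprime p b.
  rewrite prime_coprime //; apply/negP => pb.
  have copa : coprime p `|a|.
    rewrite coprime_sym; apply: (coprime_dvdr pb); exact: coprime_num_den.
  have a1 : pabs (a%:~R : K) = 1.
    by rewrite pabs_intr pabs_coprime.
  move: q1; rewrite /ratr pabsM pabsV a1 mul1r bE pabs_logn //.
  rewrite invrK leNgt => /negP; apply.
  by rewrite exprn_egt1 ?ltr1n ?prime_gt1 // -lt0n logn_gt0 mem_primes p_pr b0.
have ph0 : (0 < p ^ h)%N by rewrite expn_gt0 prime_gt0.
have [c _ /dvdnP[d]] := Bezoutl b ph0.
have /eqP-> : coprime (p ^ h) b by rewrite coprimeXl.
rewrite add1n => Ed.
have b1 := pabs_coprime cop.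
have bn0 : b%:R != 0 :> K by apply/eqP => E; move: b1; rewrite E pabs0 => /eqP; rewrite eq_sym oner_eq0.
(* [Ed] says 1 + c b = d p^h, so -c inverts the denominator b modulo p^h. *)
pose N := ((a * - c%:Z) %% (p ^ h)%:Z)%Z.
have phz : 0 < (p ^ h)%:Z by rewrite ltz_nat.
have N0 : 0 <= N by rewrite modz_ge0 // gt_eqF.
have NE : N = `|N|%N :> int by rewrite gez0_abs.
have ph1 (z : int) : pabs ((z * (p ^ h)%:Z)%:~R : K) <= rad h.
  rewrite intrM pabsM -pmulrn natrX pabs_pX ler_piMl ?rad_ge0 //; exact: pabs_int.
exists `|N|%N; first by rewrite -ltz_nat -NE ltz_pmod.
have -> : x - `|N|%N%:R = (x - ratr q) + (ratr q - (a * - c%:Z)%:~R) + ((a * - c%:Z) - N)%:~R.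
  have -> : `|N|%N%:R = N%:~R :> K by rewrite [in RHS]NE.
  have sub (y z : int) (u : K) : x - z%:~R = x - u + (u - y%:~R) + (y - z)%:~R.
    by rewrite rmorphB /=; ring.
  exact: sub.
apply: (bnormDC (A := banach_base)).
  apply: (bnormDC (A := banach_base)); first exact: ltW.
  have -> : ratr q - (a * - c%:Z)%:~R = a%:~R * (c * b).+1%:R / b%:R :> K.
    rewrite /ratr bE intrM -/a mulrNz -pmulrn -natr1 natrM; field; exact: bn0.
  rewrite bnorm_baseE !pabsM pabsV b1 invr1 mulr1 Ed natrM pabsM natrX pabs_pX.
  by rewrite mulrA ler_piMl ?rad_ge0 // mulr_ile1 ?pabs_ge0 ?pabs_int ?pabs_nat.
by rewrite {1}(divz_eq (a * - c%:Z) (p ^ h)%:Z) addrK; exact: ph1.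
Qed.

Lemma residue_unique m n h : (m < p ^ h)%N -> (n < p ^ h)%N ->
  pabs (m%:R - n%:R : K) <= rad h -> m = n.
Proof.
wlog le : m n / (n <= m)%N.
  move=> H hm hn hmn; have [?|/ltnW ?] := leqP n m; first exact: H.
  by apply/esym/H => //; rewrite -pabsN opprB.
move=> hm hn; rewrite -natrB // => /pabs_dvd d.
apply/eqP; rewrite eqn_leq le andbT -subn_eq0.
move: d; case: (posnP (m - n)) => [->//|] /dvdn_leq H /H.
by rewrite leqNgt (leq_ltn_trans (leq_subr _ _) hm).
Qed.

Lemma pabs_unit_near x y : pabs y = 1 -> pabs (x - y) < 1 -> pabs x = 1.
Proof.
move=> y1 xy; apply/eqP; rewrite eq_le; apply/andP; split.
  rewrite -(subrK y x); apply: (bnormDC (A := banach_base)); rewrite ?bnorm_baseE ?y1 //.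
  exact: ltW.
rewrite leNgt; apply/negP => x1.
have := bnormBClt (A := banach_base) x1 xy.
by rewrite opprB addrC subrK bnorm_baseE y1 ltxx.
Qed.

Lemma pow_linear (d : K) n : pabs d <= 1 ->
  pabs ((1 + d) ^+ n - 1 - n%:R * d) <= pabs d ^+ 2.
Proof.
move=> d1; elim: n => [|n IH]; first by rewrite expr0 subrr mul0r subr0 pabs0 exprn_ge0 ?pabs_ge0.
have -> : (1 + d) ^+ n.+1 - 1 - n.+1%:R * d =
    ((1 + d) ^+ n - 1 - n%:R * d) * (1 + d) + n%:R * d ^+ 2.
  rewrite exprS -natr1; ring.
apply: (bnormDC (A := banach_base)); rewrite bnorm_baseE pabsM; last first.
  by rewrite pabsX ler_piMl ?exprn_ge0 ?pabs_ge0 ?pabs_nat.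
rewrite -[leRHS]mulr1; apply: ler_pM; rewrite ?pabs_ge0 //.
by apply: (bnormDC (A := banach_base)); rewrite ?bnorm_baseE ?pabs1.
Qed.

(** If |n| >= 1/p, the linear term n d dominates the error d^2, since |d| <= p^-2. Otherwise a
    factor p is split off n and d is replaced by (1 + d)^p - 1. Radius 1/p would not suffice: for p
    = 2 and d = -2 the square of 1 + d is 1. *)
Lemma pow_abs (n : nat) (d : K) : (0 < n)%N -> pabs d <= rad 2 ->
  pabs ((1 + d) ^+ n - 1) = pabs d * pabs (n%:R : K).
Proof.
have cong (d' : K) m : pabs d' <= rad 2 -> (0 < m)%N -> rad 1 <= pabs (m%:R : K) ->
    pabs ((1 + d') ^+ m - 1) = pabs d' * pabs (m%:R : K).
  move=> Hd m0 Hm; have [->|dn0] := eqVneq d' 0; first by rewrite addr0 expr1n subrr pabs0 mul0r.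
  have dp := pabs_gt0 dn0.
  have d1 : pabs d' <= 1 by apply: le_trans Hd (rad_le1 _).
  have lt : pabs d' ^+ 2 < pabs (m%:R * d').
    rewrite pabsM expr2 ltr_pM2r //; apply: le_lt_trans Hd (lt_le_trans _ Hm).
    by rewrite (radD 1 1) gtr_pMr ?rad_gt0 // rad1_lt1.
  have h := le_lt_trans (pow_linear m d1) lt.
  rewrite [RHS]mulrC -pabsM; apply/eqP; rewrite eq_le; apply/andP; split.
    rewrite -(subrK (m%:R * d') (_ - 1)).
    by apply: (bnormDC (A := banach_base)) => //; exact: ltW h.
  rewrite leNgt; apply/negP => h'.
  have := bnormBClt (A := banach_base) h' h.
  by rewrite opprB addrC subrK bnorm_baseE ltxx.
elim/ltn_ind: n d => n IH d n0 Hd.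
have [/dvdnP[m E]|ndvd] := boolP (p %| n)%N; last first.
  apply: cong => //; rewrite pabs_coprime ?rad_le1 //.
  by rewrite prime_coprime.
have m0 : (0 < m)%N by move: n0; rewrite E muln_gt0 => /andP[].
have dp : pabs ((1 + d) ^+ p - 1) = pabs d * rad 1.
  rewrite cong ?prime_gt0 ?pabs_p ?expr1 //.
rewrite E mulnC exprM -(subrK 1 ((1 + d) ^+ p)) [X in X ^+ m]addrC IH //.
- by rewrite dp natrM pabsM pabs_p expr1 mulrA.
- by rewrite E ltn_Pmulr // prime_gt1.
- by rewrite dp; apply: le_trans Hd; rewrite ler_piMr ?pabs_ge0 ?rad_le1.
Qed.

(** * Powers of q = 1 + p^k and interpolation at them *)

Section Generator.
Variables (k : nat) (k2 : (1 < k)%N).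
Let q : K := 1 + p%:R ^+ k.

Fact q_pow_abs l : pabs (q ^+ l) = 1.
Proof.
rewrite pabsX; have -> : pabs q = 1; last by rewrite expr1n.
apply: (@pabs_unit_near _ 1); rewrite ?pabs1 // /q addrAC subrr add0r pabs_pX.
by rewrite rad_lt1 // ltnW.
Qed.

Fact q_pow_neq0 i : q ^+ i != 0.
Proof. by apply/eqP => E; have := q_pow_abs i; rewrite E pabs0 => /eqP; rewrite eq_sym oner_eq0. Qed.

(** Taking a p-th power multiplies the leading term p^(k+r) by p; the quadratic error p^(2(k+r))
    stays below the required precision because k >= 2. *)
Lemma gen_powp r : pabs (q ^+ (p ^ r) - 1 - p%:R ^+ (k + r)) <= rad (k + r).+1.
Proof.
elim: r => [|r IH].
  by rewrite expn0 expr1 addn0 /q (_ : _ - _ = 0) ?pabs0 ?rad_ge0 //; ring.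
set d := q ^+ (p ^ r) - 1 in IH.
have Hd : pabs d <= rad (k + r).
  rewrite -(subrK (p%:R ^+ (k + r)) d).
  apply: (bnormDC (A := banach_base)); rewrite bnorm_baseE ?pabs_pX //.
  exact: le_trans IH (rad_le (leqnSn _)).
have E : q ^+ (p ^ r.+1) = (1 + d) ^+ p.
  by rewrite expnSr exprM /d addrC subrK.
rewrite E.
have -> : (1 + d) ^+ p - 1 - p%:R ^+ (k + r.+1) =
  ((1 + d) ^+ p - 1 - p%:R * d) + p%:R * (d - p%:R ^+ (k + r)).
  rewrite addnS exprS; ring.
apply: (bnormDC (A := banach_base)); rewrite bnorm_baseE.
  apply: le_trans (pow_linear _ (le_trans Hd (rad_le1 _))) _.
  apply: (@le_trans _ _ (rad (k + r) ^+ 2)); first by rewrite lerXn2r ?nnegrE ?pabs_ge0 ?rad_ge0.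
  rewrite expr2 -radD; apply: rad_le.
  by rewrite addnS -addn2 leq_add2l (leq_trans k2) // leq_addr.
by rewrite pabsM pabs_p addnS -[(k + r).+2]add1n radD expr1 ler_wpM2l // invr_ge0 ltW // p_gt0.
Qed.

(** The exponent is corrected digit by digit: multiplication by q^(p^r j) changes 1 by about j
    p^(k+r), and j is the residue modulo p of the normalised defect u. *)
Lemma gen_dense t r : pabs (t - 1) <= rad k ->
  exists s, pabs (q ^+ s - t) <= rad (k + r).
Proof.
move=> Ht; elim: r => [|r [s Hs]].
  by exists 0%N; rewrite expr0 addn0 -pabsN opprB.
have qu := q_pow_abs; have qn0 := q_pow_neq0.
have pn0 := pX_neq0 (k + r).
pose u := (t / q ^+ s - 1) / p%:R ^+ (k + r).
have Hu : pabs u <= 1.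
  rewrite /u pabsM pabsV pabs_pX ler_pdivrMr ?rad_gt0 // mul1r.
  have -> : t / q ^+ s - 1 = - ((q ^+ s - t) / q ^+ s) by field; exact: qn0.
  by rewrite pabsN pabsM pabsV qu invr1 mulr1.
have [j _ Hj] := residue 1 Hu.
exists (s + p ^ r * j)%N.
set d := q ^+ (p ^ r) - 1.
have Hd0 := gen_powp r; rewrite -/d in Hd0.
have Hd : pabs d <= rad (k + r).
  rewrite -(subrK (p%:R ^+ (k + r)) d).
  apply: (bnormDC (A := banach_base)); rewrite bnorm_baseE ?pabs_pX //.
  exact: le_trans Hd0 (rad_le (leqnSn _)).
have -> : q ^+ (s + p ^ r * j) - t = q ^+ s *
   (((1 + d) ^+ j - 1 - j%:R * d) + j%:R * (d - p%:R ^+ (k + r)) - p%:R ^+ (k + r) * (u - j%:R)).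
  rewrite exprD exprM /d (addrC 1) subrK /u; field; by rewrite pn0 qn0.
rewrite addnS pabsM qu mul1r; apply: (bnormBC (A := banach_base)).
  apply: (bnormDC (A := banach_base)); rewrite bnorm_baseE.
    apply: le_trans (pow_linear _ (le_trans Hd (rad_le1 _))) _.
    apply: (@le_trans _ _ (rad (k + r) ^+ 2)); first by rewrite lerXn2r ?nnegrE ?pabs_ge0 ?rad_ge0.
    rewrite expr2 -radD; apply: rad_le.
    by rewrite -addn1 leq_add2l (leq_trans (ltnW k2)) // leq_addr.
  by rewrite pabsM; apply: le_trans (ler_piMl (pabs_ge0 _) (pabs_nat _)) Hd0.
by rewrite bnorm_baseE pabsM pabs_pX -addn1 (radD (k + r) 1) ler_wpM2l ?rad_ge0 ?expr1.
Qed.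

(** Newton's interpolation polynomials at the nodes [1, q, q^2, ...]. *)
Fixpoint newton (i : nat) (t : K) : K :=
  if i is l.+1 then newton l t * ((t - q ^+ l) / ((q ^+ l.+1 - 1) * q ^+ l)) else 1.

Fact q_pow_neq1 l : q ^+ l.+1 - 1 != 0.
Proof.
apply/eqP => E; have := @pow_abs l.+1 (p%:R ^+ k) isT.
rewrite pabs_pX rad_le // -/q E pabs0 => /(_ isT) /esym /eqP.
rewrite mulf_eq0 gt_eqF ?rad_gt0 //= pabs_logn // gt_eqF //; exact: rad_gt0.
Qed.

Lemma newtonMq i t :
  newton i.+1 (q * t) = newton i t * ((q * t - 1) / (q ^+ i.+1 - 1)).
Proof.
elim: i => [|i IH].
  by rewrite /= expr0 mulr1 !mul1r.
rewrite [LHS]/= -/(newton i.+1 (q * t)) IH [in RHS]/=.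
rewrite [q ^+ i.+2]exprS.
have h1 := q_pow_neq1 i; have h2 := q_pow_neq1 i.+1; have h3 := q_pow_neq0 i.
have h4 := q_pow_neq0 1.
rewrite expr1 in h4; rewrite [q ^+ i.+2]exprS [q ^+ i.+1]exprS in h1 h2 *.
by field; rewrite h1 h2 h3 h4.
Qed.

(** The q-Pascal rule: at t = q^s, [newton i] is the Gaussian binomial coefficient of s over i. *)
Lemma newton_recl i t :
  newton i.+1 (q * t) = newton i t + q ^+ i.+1 * newton i.+1 t.
Proof.
rewrite newtonMq /=; have h1 := q_pow_neq1 i; have h3 := q_pow_neq0 i.
by rewrite exprS in h1 *; field; rewrite h1 h3.
Qed.

Lemma newton_vanish i s : (s < i)%N -> newton i (q ^+ s) = 0.
Proof.
elim: i => [//|i IH]; rewrite ltnS leq_eqVlt => /orP[/eqP->|/IH E] /=.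
  by rewrite subrr mul0r mulr0.
by rewrite E mul0r.
Qed.

Section Values.
Variables (A : banach K) (b : A).

Fixpoint qprod (i : nat) : A :=
  if i is l.+1 then qprod l * (b - bemb A (q ^+ l)) else 1.

(** The q-binomial theorem in Newton form, by induction on s with the q-Pascal rule. Any n > s will
    do, because the interpolation polynomials of index greater than s vanish at q^s. *)
Lemma newton_sum s n : (s < n)%N ->
  \sum_(i < n) bemb A (newton i (q ^+ s)) * qprod i = b ^+ s.
Proof.
elim: s n => [|s IH] [//|n].
  move=> _; rewrite big_ord_recl big1 => [|i _]; last by rewrite newton_vanish // rmorph0 mul0r.
  by rewrite addr0 /= rmorph1 mulr1 expr0.
rewrite ltnS => sn; rewrite [b ^+ _]exprS -(IH n) // big_ord_recl [newton ord0 _]/= [qprod ord0]/= rmorph1 mul1r.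
have E (i : nat) : bemb A (newton i.+1 (q ^+ s.+1)) * qprod i.+1 =
    bemb A (newton i (q ^+ s)) * qprod i * b
    - bemb A (newton i (q ^+ s)) * qprod i * bemb A (q ^+ i)
    + bemb A (newton i.+1 (q ^+ s)) * qprod i.+1 * bemb A (q ^+ i.+1).
  by rewrite [q ^+ s.+1]exprS newton_recl [qprod i.+1]/= rmorphD rmorphM; ring.
under eq_bigr => i _ do rewrite lift0 E.
(* The last two terms of [E] telescope in F. Since s < n, F n vanishes, and F 0 = 1 cancels the term
   of index 0. *)
pose F i := bemb A (newton i (q ^+ s)) * qprod i * bemb A (q ^+ i).
have -> : \sum_(i < n) (bemb A (newton i (q ^+ s)) * qprod i * b
    - bemb A (newton i (q ^+ s)) * qprod i * bemb A (q ^+ i)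
    + bemb A (newton i.+1 (q ^+ s)) * qprod i.+1 * bemb A (q ^+ i.+1)) =
    b * (\sum_(i < n) bemb A (newton i (q ^+ s)) * qprod i) + (F n - F 0%N).
  elim: (n) => [|n' IH']; first by rewrite !big_ord0 mulr0 subrr addr0.
  by rewrite !big_ord_recr /= IH' /F /=; ring.
by rewrite /F newton_vanish // ?[newton 0 _]/= ?[qprod 0]/= !(expr0, rmorph0, rmorph1, mul0r); ring.
Qed.

End Values.
End Generator.
End PadicIntegers.

(** * Continuous characters are locally analytic *)

Section Characters.
Context {R : realType} {p : nat} {K : padicField R p}.
Hypothesis p_pr : prime p.
Variable A : banach K.
Local Notation "'rad' h" := ((p%:R : R) ^- h) (at level 10).

Definition continuous_char (th : K -> A) :=
  [/\ th 1 = 1,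
      forall s t, Zp_units s -> Zp_units t -> th (s * t) = th s * th t &
      forall t e, Zp_units t -> 0 < e -> exists2 d : R, 0 < d &
        forall s, Zp_units s -> pabs (s - t) < d -> bnorm (th s - th t) < e].

Lemma newtonS k i (t : K) : newton k i.+1 t = newton k i t *
  ((t - (1 + p%:R ^+ k) ^+ i) / (((1 + p%:R ^+ k) ^+ i.+1 - 1) * (1 + p%:R ^+ k) ^+ i)).
Proof. by []. Qed.

(** Serves to pass from the dense set of powers of q to arbitrary t in finitely many terms of the
    expansion. *)
Lemma newton_lipschitz k i : (1 < k)%N -> exists2 C : R, 0 <= C &
  forall t t' : K, pabs t <= 1 -> pabs t' <= 1 ->
    pabs (newton k i t) <= C /\
    pabs (newton k i t - newton k i t') <= C * pabs (t - t').
Proof.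
move=> k2; elim: i => [|i [C C0 IH]].
  by exists 1 => //= t t' _ _; rewrite pabs1 subrr pabs0 mul1r pabs_ge0.
set q : K := 1 + p%:R ^+ k; set c := ((q ^+ i.+1 - 1) * q ^+ i)^-1.
exists (C * pabs c); first by rewrite mulr_ge0 ?pabs_ge0.
move=> t t' Ht Ht'; have [h1 h2] := IH _ _ Ht Ht'.
have bd (s : K) : pabs s <= 1 -> pabs (s - q ^+ i) <= 1.
  move=> Hs; apply: (bnormBC (A := banach_base)) => //.
  by rewrite bnorm_baseE q_pow_abs.
rewrite !newtonS -/q -/c; split.
  rewrite mulrA pabsM ler_wpM2r ?pabs_ge0 // pabsM -[leRHS]mulr1.
  by apply: ler_pM; rewrite ?pabs_ge0 ?bd.
have -> : newton k i t * ((t - q ^+ i) * c) - newton k i t' * ((t' - q ^+ i) * c)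
  = (newton k i t * (t - t') + (newton k i t - newton k i t') * (t' - q ^+ i)) * c.
  by ring.
rewrite pabsM mulrAC ler_wpM2r ?pabs_ge0 //; apply: (bnormDC (A := banach_base)).
  by rewrite bnorm_baseE pabsM ler_wpM2r ?pabs_ge0.
by rewrite bnorm_baseE pabsM -[leRHS]mulr1; apply: ler_pM; rewrite ?pabs_ge0 ?bd.
Qed.

Section OneChar.
Variables (th : K -> A) (Hth : continuous_char th).

Lemma char_exp s t : Zp_units t -> th (t ^+ s) = th t ^+ s.
Proof.
have [h1 h2 _] := Hth; move=> Ht; elim: s => [|s IH]; first by rewrite !expr0.
by rewrite !exprS h2 // ?IH // /Zp_units /= pabsX Ht expr1n.
Qed.

(** The bound p^-2 makes the i-th product [qprod] of order p^(-2i), against interpolation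
    polynomials of size at most p^i. The second condition makes the images of q^i - 1 in A as small,
    whatever the norm of 1. *)
Lemma char_near_one : exists k, [/\ (1 < k)%N, bnorm (1 : A) * rad k <= rad 2 &
  bnorm (th (1 + p%:R ^+ k) - 1) <= rad 2].
Proof.
have [h1 _ h3] := Hth.
have u1 : Zp_units (1 : K) by rewrite /Zp_units /= pabs1.
have [d d0 Hd] := h3 1 _ u1 (rad_gt0 p_pr 2).
have [k1 Hk1] := rad_small p_pr (bnorm (1 : A)) (rad_gt0 p_pr 2).
have [k2 Hk2] := rad_null p_pr d0.
pose k := maxn 2 (maxn k1 k2).
have kk1 : (k1 <= k)%N by rewrite /k !leq_max leqnn !orbT.
have kk2 : (k2 <= k)%N by rewrite /k !leq_max leqnn !orbT.
exists k; split; first by rewrite leq_maxl.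
  by apply: le_trans Hk1; rewrite ler_wpM2l ?bnorm_ge0 ?rad_le.
have E : 1 + p%:R ^+ k - 1 = p%:R ^+ k :> K by rewrite addrAC subrr add0r.
rewrite -h1; apply/ltW/Hd; last by rewrite E pabs_pX Hk2.
apply: (@pabs_unit_near _ _ _ _ 1); rewrite ?pabs1 // E pabs_pX.
by rewrite rad_lt1 // (leq_trans _ (leq_maxl _ _)).
Qed.

(** Newton interpolation: with [q = 1 + p^k] and [b = th q], the q-binomial
    theorem expands [th (q^s) = b^s] in the polynomials [newton k i] at [q^s],
    and the powers of [q] are dense in [1 + p^k Z_p]. *)
Lemma char_analytic : exists2 k, (1 < k)%N & forall (J : finType) (phi : (J -> K) -> K),
  analyticK phi 1 -> analytic (fun z => th (1 + p%:R ^+ k * phi z)) (bnorm (1 : A)).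
Proof.
have [k [k2 kA kth]] := char_near_one; have [h1 h2 h3] := Hth.
exists k => // J phi Hphi.
pose q : K := 1 + p%:R ^+ k; pose b := th q.
have qu l : pabs (q ^+ l) = 1 by exact: q_pow_abs.
have qd l : pabs (q ^+ l - 1) <= rad k.
  have [->|l0] := posnP l; first by rewrite expr0 subrr pabs0 rad_ge0.
  rewrite /q pow_abs ?pabs_pX ?rad_le //.
  by rewrite ler_piMr ?rad_ge0 ?pabs_nat.
have qE l : pabs (q ^+ l.+1 - 1) = rad k * pabs (l.+1%:R : K).
  by rewrite /q pow_abs ?pabs_pX ?rad_le.
have Hq i : bnorm (qprod k b i) <= bnorm (1 : A) * rad 2 ^+ i.
  elim: i => [|i IH]; first by rewrite expr0 mulr1.
  rewrite exprSr mulrA /=; apply: le_trans (bnormM _ _) _.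
  apply: ler_pM; rewrite ?bnorm_ge0 // -/q.
  have -> : b - bemb A (q ^+ i) = (b - 1) - bemb A (q ^+ i - 1).
    by rewrite rmorphB rmorph1; ring.
  apply: bnormBC => //; apply: le_trans kA; rewrite bnorm_embE mulrC.
  by rewrite ler_wpM2l ?bnorm_ge0.
(* Each new factor of [newton] has numerator at most p^-k and denominator of absolute value p^-k |i
   + 1|. *)
have small i (t : K) : pabs (t - 1) <= rad k ->
    pabs (newton k i t) * pabs (i`!%:R : K) <= 1.
  move=> Ht; elim: i => [|i IH]; first by rewrite /= ?pabs1 mul1r ?pabs1.
  rewrite newtonS -/q factS natrM (pabsM (newton k i t)) (pabsM i.+1%:R).
  rewrite (mulrC (pabs i.+1%:R)) mulrACA -[leRHS]mulr1.
  apply: ler_pM => //; rewrite ?mulr_ge0 ?pabs_ge0 //.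
  rewrite pabsM pabsV pabsM qu mulr1 qE.
  rewrite mulrAC ler_pdivrMr; last by rewrite mulr_gt0 ?rad_gt0 ?pabs_logn ?rad_gt0.
  rewrite mul1r ler_wpM2r ?pabs_ge0 //.
  have -> : t - q ^+ i = (t - 1) - (q ^+ i - 1) by ring.
  by apply: (bnormBC (A := banach_base)); [exact: Ht | exact: qd].
have factn0 i : 0 < pabs (i`!%:R : K) by apply: lt_le_trans (rad_gt0 p_pr i) (pabs_fact p_pr i).
have Ms_null : null_seq (fun i => bnorm (1 : A) * rad i).
  exact: null_seqM (bnorm_ge0 _) (rad_null p_pr).
have radX i : rad 2 ^+ i * (rad i)^-1 = rad i.
  have -> : rad 2 ^+ i = rad (i + i) by rewrite -exprVn -exprM mul2n -addnn exprVn.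
  by rewrite radD mulfK // gt_eqF // rad_gt0.
have term_bd i (t : K) : pabs (t - 1) <= rad k ->
    bnorm (bemb A (newton k i t) * qprod k b i) <= bnorm (1 : A) * rad i.
  move=> Ht; rewrite bnorm_emb -[in leRHS](radX i) mulrA mulrC.
  apply: ler_pM; rewrite ?bnorm_ge0 ?pabs_ge0 //.
  apply: (@le_trans _ _ (pabs (i`!%:R : K))^-1).
    by rewrite -[leRHS]mul1r ler_pdivlMr // small.
  by rewrite lef_pV2 ?posrE ?rad_gt0 ?factn0 // pabs_fact.
have ptw (t : K) : pabs (t - 1) <= rad k ->
    converges_to bnorm (fun N => \sum_(i < N) bemb A (newton k i t) * qprod k b i) (th t).
  move=> Ht e e0; have [N HN] := Ms_null e e0; exists N => n Nn.
  (* C depends on the truncation n; this is harmless because the power q^s approximating t is chosen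
     after n. *)
  have [C C0 HC] : exists2 C : R, 0 <= C & forall t t' : K, pabs t <= 1 -> pabs t' <= 1 ->
      bnorm (\sum_(i < n) bemb A (newton k i t) * qprod k b i -
             \sum_(i < n) bemb A (newton k i t') * qprod k b i) <= C * pabs (t - t').
    elim: (n) => [|n' [C C0 IH]].
      by exists 0 => // s s' _ _; rewrite !big_ord0 subrr bnorm0 mul0r.
    have [C' C'0 H'] := newton_lipschitz n' k2.
    pose C'' := C' * bnorm (qprod k b n').
    exists (Num.max C C''); first by rewrite le_max C0.
    move=> s s' Hs Hs'; rewrite !big_ord_recr /= opprD addrACA.
    apply: bnormDC.
      by apply: le_trans (IH _ _ Hs Hs') _; rewrite ler_wpM2r ?pabs_ge0 // le_max lexx.
    rewrite -mulrBl -rmorphB bnorm_emb.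
    apply: (@le_trans _ _ (C'' * pabs (s - s'))).
      by rewrite /C'' mulrAC ler_wpM2r ?bnorm_ge0 //; have [] := H' _ _ Hs Hs'.
    by rewrite ler_wpM2r ?pabs_ge0 // le_max lexx orbT.
  have tu : Zp_units t.
    by apply: (@pabs_unit_near _ _ _ _ 1); rewrite ?pabs1 // (le_lt_trans Ht) // rad_lt1 // ltnW.
  have [d d0 Hd] := h3 t e tu e0.
  have [r1 Hr1] := null_seqM C0 (rad_null p_pr) e0.
  have [r2 Hr2] := rad_null p_pr d0.
  have [s Hs] := gen_dense p_pr k2 (maxn r1 r2) Ht.
  have kr1 : (r1 <= k + maxn r1 r2)%N by exact: leq_trans (leq_maxl _ _) (leq_addl _ _).
  have kr2 : (r2 <= k + maxn r1 r2)%N by exact: leq_trans (leq_maxr _ _) (leq_addl _ _).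
  have E1 := newton_sum p_pr k2 b (leq_maxl s.+1 n : (s < maxn s.+1 n)%N).
  have b1 : th (q ^+ s) = b ^+ s.
    by rewrite char_exp //; have := qu 1%N; rewrite expr1.
  set S := \sum_(i < n) bemb A (newton k i (q ^+ s)) * qprod k b i.
  (* The first difference is small by the Lipschitz bound, the second is a tail of the finite
     expansion of b^s, the third is small by continuity of the character. *)
  have -> : \sum_(i < n) bemb A (newton k i t) * qprod k b i - th t =
      (\sum_(i < n) bemb A (newton k i t) * qprod k b i - S) - (b ^+ s - S)
      + (th (q ^+ s) - th t) by rewrite b1; ring.
  apply: bnormDClt; last by apply: Hd; [exact: qu | apply: le_lt_trans Hs (Hr2 _ kr2)].
  apply: bnormBClt.
    apply: le_lt_trans (HC _ _ _ _) _; rewrite ?qu //.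
      by rewrite tu.
    apply: le_lt_trans (Hr1 _ kr1); rewrite ler_wpM2l //.
    by rewrite -pabsN opprB.
  rewrite -E1 /S -!(big_mkord xpredT (fun i => bemb A (newton k i (q ^+ s)) * qprod k b i)).
  rewrite (@big_cat_nat _ _ _ n 0 (maxn s.+1 n)) ?leq_maxr //=.
  rewrite addrAC subrr add0r big_nat.
  apply: bnorm_sumlt => // i /andP[ni _]; apply: le_lt_trans (term_bd _ _ _) _ => //.
  by apply: HN; rewrite (leq_trans Nn).
have inb z : in_ball z -> pabs ((1 + p%:R ^+ k * phi z) - 1) <= rad k.
  move=> Hz; rewrite addrAC subrr add0r pabsM pabs_pX ler_piMr ?rad_ge0 //.
  exact: analytic_in_ball Hz.
apply: (analytic_series (g := fun i z =>
   bemb A (newton k i (1 + p%:R ^+ k * phi z)) * qprod k b i) Ms_null).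
- by move=> i; rewrite ler_piMr ?bnorm_ge0 ?rad_le1.
- move=> i; have : analyticK (fun z => newton k i (1 + p%:R ^+ k * phi z)) (rad i)^-1.
    apply: (analytic_le (M := (pabs (i`!%:R : K))^-1)).
      by rewrite lef_pV2 ?posrE ?rad_gt0 ?factn0 // pabs_fact.
    elim: i => [|i IH].
      by apply: analytic_base_cst; rewrite ?pabs1 ?invr1.
    (* The numerator of the next factor is p^k (phi + y) with y integral, and the p^k cancels
       against q^(i+1) - 1, leaving 1 / |i + 1|. *)
    pose y : K := (1 - q ^+ i) / p%:R ^+ k.
    have y1 : pabs y <= 1.
      by rewrite /y pabsM pabsV pabs_pX ler_pdivrMr ?rad_gt0 // mul1r -pabsN opprB.
    pose c : K := p%:R ^+ k / ((q ^+ i.+1 - 1) * q ^+ i).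
    have cE : pabs c = (pabs (i.+1%:R : K))^-1.
      rewrite /c pabsM pabsV pabsM qu mulr1 qE pabs_pX.
      by rewrite invfM mulrA divff ?mul1r // gt_eqF // rad_gt0.
    have hc : analyticK (fun z => (phi z + y) * c) (pabs c).
      have := analyticM (analyticD Hphi (analytic_base_cst J y1))
        (analytic_base_cst J (lexx (pabs c))).
      by rewrite mul1r.
    rewrite factS natrM pabsM invfM mulrC -cE.
    apply: analytic_eq (analyticM IH hc) => z Hz.
    rewrite newtonS -/q; congr (_ * _); rewrite /c /y.
    have := @pX_neq0 _ _ K p_pr k; have := @q_pow_neq1 _ _ K p_pr k k2 i.
    have := @q_pow_neq0 _ _ K p_pr k k2 i.
    by rewrite -/q => n1 n2 n3; field; rewrite n1 n2 n3.
  move=> /(analytic_map (bounded_embM (qprod k b i))); apply: analytic_le.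
  apply: (@le_trans _ _ (bnorm (1 : A) * rad 2 ^+ i * (rad i)^-1)).
    by rewrite ler_wpM2r // invr_ge0 rad_ge0.
  by rewrite -mulrA radX.
- by move=> z Hz; apply: ptw; exact: inb.
Qed.

(** Multiplicativity carries the expansion at 1 to any unit a, so that d depends on the character
    and not on a. *)
Lemma char_near_cst : exists2 d : R, 0 < d < 1 &
  forall (J : finType) (g : (J -> K) -> K) (a : K), Zp_units a ->
    analyticK (fun z => g z - a) d ->
    analytic (fun z => th (g z)) (bnorm (th a) * bnorm (1 : A)).
Proof.
have [k k2 H] := char_analytic; have [h1 h2 h3] := Hth.
exists (rad k); first by rewrite rad_gt0 // rad_lt1 // ltnW.
move=> J g a au Hg.
have an0 : a != 0 by apply/eqP => a0; move: au; rewrite /Zp_units /= a0 pabs0 => /eqP; rewrite eq_sym oner_eq0.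
have pn0 := @pX_neq0 _ _ K p_pr k.
pose c := (a * p%:R ^+ k)^-1.
have cE : pabs c <= (rad k)^-1 by rewrite /c pabsV pabsM au mul1r pabs_pX.
have Hphi : analyticK (fun z => (g z - a) * c) 1.
  have := analyticM Hg (analytic_base_cst J cE).
  by rewrite mulfV // gt_eqF // rad_gt0.
have := analytic_map (bounded_mull (th a)) (H J _ Hphi).
apply: analytic_eq => z Hz; rewrite mulrC -h2 //.
- by congr th; rewrite /c; field; rewrite an0 pn0.
- apply: (@pabs_unit_near _ _ _ _ 1); rewrite ?pabs1 // addrAC subrr add0r pabsM pabs_pX.
  apply: le_lt_trans (rad_lt1 p_pr (ltnW k2)); rewrite ler_piMr ?rad_ge0 //.
  exact: (analytic_in_ball Hphi).
Qed.

End OneChar.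
End Characters.

(** * Coefficient algebras *)

Section Extension.
Context {R : realType} {p : nat} {K : padicField R p} (L : padicExt K).
Implicit Types (x y : L).

Lemma eabs_ge0 x : 0 <= eabs x. Proof. by have [] := eabs_abs L. Qed.
Lemma eabs_eq0 x : eabs x = 0 -> x = 0.
Proof. by have [_ + _ _ _] := eabs_abs L; exact. Qed.
Lemma eabsM x y : eabs (x * y) = eabs x * eabs y.
Proof. by have [] := eabs_abs L. Qed.
Lemma eabsD x y : eabs (x + y) <= Num.max (eabs x) (eabs y).
Proof. by have [] := eabs_abs L. Qed.
Lemma eabsZ (k : K) x : eabs (k *: x) = pabs k * eabs x.
Proof. by rewrite -mulr_algl eabsM eabs_ext. Qed.
Lemma eabs0 : eabs (0 : L) = 0.
Proof. by rewrite -[0](scale0r 1) eabsZ pabs0 mul0r. Qed.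
Lemma eabsN x : eabs (- x) = eabs x.
Proof. by rewrite -scaleN1r eabsZ pabsN1 mul1r. Qed.
Lemma eabs1 : eabs (1 : L) = 1.
Proof. by rewrite -[1](scale1r 1) eabs_ext pabs1. Qed.

Lemma eabsDlt x y e : eabs x < e -> eabs y < e -> eabs (x + y) < e.
Proof. by move=> hx hy; apply: le_lt_trans (eabsD _ _) _; rewrite gt_max hx. Qed.
Lemma eabsBlt x y e : eabs x < e -> eabs y < e -> eabs (x - y) < e.
Proof. by move=> hx hy; apply: eabsDlt; rewrite ?eabsN. Qed.

Definition cauchy_for (V : zmodType) (N : V -> R) (u : nat -> V) :=
  forall e : R, 0 < e -> exists n, forall i j, (n <= i)%N -> (n <= j)%N -> N (u i - u j) < e.

(** A finite extension comes without completeness. Induction on a spanning list: by completeness of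
    the smaller span, a vector v outside it has positive distance to it, which bounds the coordinate
    along v by the norm. *)
Lemma complete_span (X : seq L) (u : nat -> L) :
  (forall i, u i \in <<X>>%VS) -> cauchy_for eabs u ->
  exists2 l, l \in <<X>>%VS & converges_to eabs u l.
Proof.
elim: X u => [|v X IH] u Hu Cu.
  exists 0; first exact: mem0v.
  move=> e e0; exists 0%N => i _; have := Hu i; rewrite span_nil memv0 => /eqP->.
  by rewrite subrr -[0](scale0r 1) eabsZ pabs0 mul0r.
have [vX|vX] := boolP (v \in <<X>>%VS).
  have E : <<v :: X>>%VS = <<X>>%VS.
    by apply/eqP; rewrite span_cons eqEsubv addvSr subv_add -memvE vX subvv.
  by rewrite E; apply: IH => // i; rewrite -E.
(* Otherwise some sequence in the span converges to -v, and its limit lies in the span. *)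
have [d d0 Hd] : exists2 d : R, 0 < d & forall w, w \in <<X>>%VS -> d <= eabs (w + v).
  apply: contrapT => H.
  have /choice[w Hw] : forall i : nat, exists w, w \in <<X>>%VS /\ eabs (w + v) < i.+1%:R^-1.
    move=> i; apply: contrapT => H'; apply: H; exists i.+1%:R^-1.
      by rewrite invr_gt0 ltr0n.
    by move=> w wX; rewrite leNgt; apply/negP => h; apply: H'; exists w.
  have small (e : R) : 0 < e -> exists n, forall i, (n <= i)%N -> eabs (w i + v) < e.
    move=> e0; have := archi_boundP (ltW (divr_gt0 ltr01 e0)).
    rewrite mul1r; set n := Num.bound _ => Hn; exists n => i ni.
    have [_ h] := Hw i; apply: lt_trans h _; rewrite -[e]invrK ltf_pV2 ?posrE ?invr_gt0 ?ltr0n //.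
    by apply: lt_le_trans Hn _; rewrite ler_nat; apply: leq_trans ni (leqnSn _).
  have Cw : cauchy_for eabs w.
    move=> e /small[n Hn]; exists n => i j /Hn hi /Hn hj.
    have -> : w i - w j = (w i + v) - (w j + v) by ring.
    exact: eabsBlt.
  have [l lX Hl] := IH w (fun i => (Hw i).1) Cw.
  have lv : eabs (l + v) = 0.
    apply/eqP; rewrite eq_le eabs_ge0 andbT leNgt; apply/negP => e0.
    have [n Hn] := small _ e0; have [n' Hn'] := Hl _ e0.
    have := eabsBlt (Hn _ (leq_maxl n n')) (Hn' _ (leq_maxr n n')).
    by rewrite (_ : _ - _ = l + v) ?ltxx //; ring.
  move/eabs_eq0/eqP: lv; rewrite addr_eq0 => /eqP lv.
  by move: vX; rewrite -memvN -lv lX.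
have /choice[wt Hwt] : forall i, exists wt : L * K, wt.1 \in <<X>>%VS /\ u i = wt.1 + wt.2 *: v.
  move=> i; have := Hu i; rewrite span_cons => /memv_addP[a /vlineP[k ->] [b bX ->]].
  by exists (b, k); rewrite addrC.
pose w i := (wt i).1; pose t i := (wt i).2.
have wX i : w i \in <<X>>%VS by have [] := Hwt i.
have uE i : u i = w i + t i *: v by have [] := Hwt i.
have key (a : L) (k : K) : a \in <<X>>%VS -> pabs k * d <= eabs (a + k *: v).
  move=> aX; have [->|k0] := eqVneq k 0; first by rewrite pabs0 mul0r eabs_ge0.
  have -> : a + k *: v = k *: (k^-1 *: a + v) by rewrite scalerDr scalerA mulfV // scale1r.
  by rewrite eabsZ ler_wpM2l ?pabs_ge0 // Hd // memvZ.
have Ct : cauchy_for pabs t.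
  move=> e e0; have [n Hn] := Cu _ (mulr_gt0 e0 d0); exists n => i j ni nj.
  have := Hn i j ni nj; rewrite !uE.
  have -> : w i + t i *: v - (w j + t j *: v) = (w i - w j) + (t i - t j) *: v.
    by rewrite scalerBl; ring.
  move=> /(le_lt_trans (key _ _ (memvB (wX i) (wX j)))); by rewrite ltr_pM2r.
have [tl Htl] := pabs_complete Ct.
have Htv : converges_to eabs (fun i => t i *: v) (tl *: v).
  move=> e e0; have v0 : 0 < eabs v + 1 by rewrite ltr_wpDl ?eabs_ge0.
  have [n Hn] := Htl _ (divr_gt0 e0 v0); exists n => i /Hn.
  rewrite -scalerBl eabsZ ltr_pdivlMr //; apply: le_lt_trans.
  by rewrite ler_wpM2l ?pabs_ge0 // lerDl.
have Cw : cauchy_for eabs w.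
  move=> e e0; have [n Hn] := Cu _ e0; have [n' Hn'] := Htv _ e0.
  exists (maxn n n') => i j; rewrite !geq_max => /andP[ni n'i] /andP[nj n'j].
  have -> : w i - w j = (u i - u j) - ((t i *: v - tl *: v) - (t j *: v - tl *: v)).
    by rewrite !uE; ring.
  by apply: eabsBlt; [exact: Hn | apply: eabsBlt; exact: Hn'].
have [l lX Hl] := IH w wX Cw.
exists (l + tl *: v).
  rewrite span_cons; apply/memv_addP; exists (tl *: v); first by rewrite memvZ ?memv_line.
  by exists l => //; rewrite addrC.
move=> e e0; have [n Hn] := Hl _ e0; have [n' Hn'] := Htv _ e0.
exists (maxn n n') => i; rewrite geq_max => /andP[ni n'i].
rewrite uE (_ : _ - _ = (w i - l) + (t i *: v - tl *: v)); last by ring.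
by apply: eabsDlt; [exact: Hn | exact: Hn'].
Qed.

Lemma eabs_complete : complete_for (@eabs R p K L).
Proof.
move=> u Cu; have [|l _ Hl] := complete_span (X := vbasis {:L}) _ Cu.
  by move=> i; rewrite (span_basis (vbasisP _)) memvf.
by exists l.
Qed.

Lemma base_alg_banach : is_banach (base_alg L).
Proof.
split; last exact: eabs_complete.
split; [exact: eabs_ge0 | exact: eabs_eq0 | | exact: eabsD | ].
- by move=> c a; rewrite -eabsM.
- by move=> a b; rewrite -[leLHS]/(eabs _) eabsM.
Qed.

Section OfNormedAlg.
Context {A : normedAlg L} (HA : is_banach A).

Definition emb_rmorphism : {rmorphism K -> A} := in_alg A \o in_alg L.

(** Kept transparent, so that [analytic_chart] and [analytic] are convertible. *)
Definition banach_of : banach K.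
Proof.
apply: (@Banach R p K A (@nrm _ _ _ _ A) emb_rmorphism).
- by have [[]] := HA.
- by have [[_ h _ _ _]] := HA.
- by have [[_ _ h _ _] _] := HA => x a; rewrite /= mulr_algl h eabs_ext.
- by have [[_ _ _ h _]] := HA.
- by have [[_ _ _ _ h]] := HA.
- by have [] := HA.
Defined.

Lemma analytic_chartE (I : finType) (X : Type) (phi : (I -> K) -> X) (f : X -> A) (M : R) :
  analytic_chart phi f M = analytic (A := banach_of) (f \o phi) M.
Proof. by []. Qed.
End OfNormedAlg.

End Extension.

Section Points.
Context {R : realType} {p : nat} {K : padicField R p} (L : padicExt K).
Context (O : normedAlg L) (HO : is_banach O) (ev : {lrmorphism O -> base_alg L}).

Let B := banach_of HO.

(** Otherwise [1 - a / ev a], the inverse of a convergent geometric series, would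
    be a unit in the kernel of [ev]. *)
Lemma point_norm (a : O) : eabs (ev a : L) <= nrm a.
Proof.
rewrite leNgt; apply/negP => lt.
have e0 : 0 < eabs (ev a : L) by apply: le_lt_trans lt; exact: (@bnorm_ge0 _ _ _ B).
pose l : L := ev a.
have l0 : l != 0 by apply/eqP => E; move: e0; rewrite -[ev a]/l E eabs0 ltxx.
pose x : B := l^-1 *: a.
have lV : eabs l^-1 = (eabs l)^-1.
  have el0 : eabs l != 0 by rewrite gt_eqF.
  apply: (mulfI el0); by rewrite -eabsM !mulfV ?eabs1 // gt_eqF.
have [[_ _ nZ _ _] _] := HO.
have x1 : bnorm x < 1.
  by rewrite -[bnorm x]/(nrm (l^-1 *: a)) nZ lV mulrC ltr_pdivrMr // mul1r.
have x0 := bnorm_ge0 x.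
have pw i : bnorm (x ^+ i) <= bnorm (1 : B) * bnorm x ^+ i.
  elim: i => [|i IH]; first by rewrite !expr0 mulr1.
  rewrite exprS [_ ^+ i.+1]exprS mulrCA; apply: le_trans (bnormM _ _) _.
  by rewrite ler_wpM2l.
have Mnull := null_seqM (bnorm_ge0 (1 : B)) (null_seq_geo x0 x1).
have [s Hs] := series_cvg Mnull pw.
have E : s * (1 - x) = 1.
  have h1 := bmap_cvg (bounded_mull (1 - x)) (bnorm_ge0 _) Hs.
  apply: (cvg_unique h1) => e ep; have [N HN] := Mnull e ep; exists N => n /HN.
  have -> : (\sum_(i < n) x ^+ i) * (1 - x) = 1 - x ^+ n.
    elim: n => [|n IH]; first by rewrite big_ord0 mul0r expr0 subrr.
    by rewrite big_ord_recr /= mulrDl IH exprSr; ring.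
  rewrite addrAC subrr add0r bnormN; exact: le_lt_trans (pw n).
have evx : ev (x : O) = 1.
  rewrite /x linearZ /= -/l -[LHS]/(l^-1 * l : L) mulVf //.
have E' : (s : O) * (1 - (x : O)) = 1 :> O := E.
have := congr1 ev E'; rewrite rmorphM rmorphB /= rmorph1 evx subrr mulr0.
by move/eqP; rewrite eq_sym oner_eq0.
Qed.
End Points.

(** * Functionals on locally analytic functions *)

(** A compact space with polydisc charts, abstracting [Z_p^*] and [N(Z_p)]:
    [ch a h] parametrises the ball of radius [p^-h] around [a]; the coordinates
    outside of [mask] are dummies; [co a h] recovers the others; [cl h] is the
    finite set of balls of radius [p^-h]. *)
Record chart_space (R : realType) (p : nat) (K : padicField R p) := ChartSpace {
  pt :> Type;
  crd : finType;
  dom : set pt;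
  lvl : nat;
  ch : pt -> nat -> (crd -> K) -> pt;
  co : pt -> nat -> pt -> crd -> K;
  mask : crd -> bool;
  cls : nat -> finType;
  cl : forall h, pt -> cls h;
  ch0 : forall a h, ch a h (fun=> 0) = a;
  ch_dom : forall a h z, dom a -> (lvl <= h)%N -> in_ball z -> dom (ch a h z);
  ch_ch : forall a h k z w,
    ch (ch a h z) (h + k) w = ch a h (fun i => z i + p%:R ^+ k * w i);
  clP : forall a b h, dom a -> dom b -> (lvl <= h)%N ->
    (cl h a = cl h b <-> exists2 z, in_ball z & b = ch a h z);
  coE : forall a h z i, co a h (ch a h z) i = if mask i then z i else 0;
  ch_mask : forall a h z, ch a h (fun i => if mask i then z i else 0) = ch a h z;
  ch_lim : forall u : nat -> pt,
    (forall h, (lvl <= h)%N -> dom (u h) /\ cl h (u h) = cl h (u h.+1)) ->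
    exists2 a, dom a & forall h, (lvl <= h)%N -> cl h (u h) = cl h a }.
Arguments dom {R p K}.
Arguments lvl {R p K}.
Arguments ch {R p K _}.
Arguments co {R p K _}.
Arguments mask {R p K _}.
Arguments cl {R p K _}.

Section LocAnalytic.
Context {R : realType} {p : nat} {K : padicField R p} (X : chart_space K).
Hypothesis p_pr : prime p.

Definition unif_analytic (A : banach K) (f : X -> A) (h : nat) (M : R) :=
  forall a, dom X a -> analytic (fun z => f (ch a h z)) M.

Definition loc_analytic (A : banach K) (f : X -> A) :=
  supported (dom X) f /\
  forall a, dom X a -> exists h M, analytic (fun z => f (ch a h z)) M.

Lemma in_ball_affine (I : finType) (z0 : I -> K) (c : K) : in_ball z0 -> pabs c <= 1 ->
  forall i, analyticK (fun z : I -> K => z0 i + c * z i) 1.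
Proof.
move=> Hz0 Hc i; apply: analyticD; first exact: analytic_base_cst.
by apply: analyticM1; [exact: analytic_base_cst | exact: analytic_coord].
Qed.

Section OneRing.
Context {A : banach K}.
Implicit Types f g : X -> A.

Lemma chart_refine f a h M z0 h' : in_ball z0 -> (h <= h')%N ->
  analytic (fun z => f (ch a h z)) M ->
  analytic (fun z => f (ch (ch a h z0) h' z)) M.
Proof.
move=> Hz /subnKC<- H.
have c1 : pabs (p%:R ^+ (h' - h) : K) <= 1 by rewrite pabs_pX rad_le1.
have := analytic_comp (in_ball_affine Hz c1) H.
by apply: analytic_eq => z _; rewrite ch_ch.
Qed.

Lemma chart_refine0 f a h M h' : (h <= h')%N ->
  analytic (fun z => f (ch a h z)) M -> analytic (fun z => f (ch a h' z)) M.
Proof.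
move=> hh /(@chart_refine f a h M (fun=> 0) h').
by rewrite ch0; apply => // i; rewrite pabs0.
Qed.

(** Compactness: otherwise there are nested balls without a common radius, which
    shrink to a point. *)
Lemma loc_analytic_unif f : loc_analytic f ->
  exists h M, (lvl X <= h)%N /\ unif_analytic f h M.
Proof.
move=> [_ loc].
pose good (P : set X) := exists h M, (lvl X <= h)%N /\
  forall b, dom X b -> P b -> analytic (fun z => f (ch b h z)) M.
(* There are finitely many balls of level h, so the largest level and the sum of the absolute values
   of the bounds serve all of them; empty balls receive default values. *)
have finite_good (P : set X) h : (forall a, dom X a -> P a ->
    good (fun b => P b /\ cl h b = cl h a)) -> good P.
  move=> H.
  have /choice[hM HhM] : forall t : cls X h, exists hM : nat * R, (lvl X <= hM.1)%N /\
      forall b, dom X b -> P b -> cl h b = t -> analytic (fun z => f (ch b hM.1 z)) hM.2.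
    move=> t; have [[a [aS aP at_]]|no] := pselect (exists a, [/\ dom X a, P a & cl h a = t]).
      have [h' [M [lh' Hg]]] := H a aS aP; exists (h', M); split=> // b bS bP bt.
      by apply: Hg => //; rewrite bt at_.
    exists (lvl X, 0); split=> // b bS bP bt; case: no; by exists b.
  exists (maxn (lvl X) (\max_t (hM t).1)), (\sum_t `|(hM t).2|); split; first exact: leq_maxl.
  move=> b bS bP; have [_ Hb] := HhM (cl h b).
  apply: chart_refine0; last first.
    apply: analytic_le (Hb b bS bP erefl).
    rewrite (bigD1 (cl h b)) //=; apply: le_trans (ler_norm _) _.
    by rewrite lerDl sumr_ge0.
  rewrite leq_max; apply/orP; right; exact: (leq_bigmax (cl h b)).
have [[h [M [lh Hg]]]|bad] := pselect (good [set: X]).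
  by exists h, M; split=> // a aS; apply: Hg.
(* The ball of level [lvl X + i] around a admits no common level and bound. By [finite_good] it
   contains a bad ball of the next level. *)
pose Bad i a := dom X a /\ ~ good (fun b => cl (lvl X + i) b = cl (lvl X + i) a).
have [a0 Ba0] : exists a, Bad 0%N a.
  apply: contrapT => H; apply: bad; apply: (finite_good _ (lvl X + 0)%N) => a aS _.
  apply: contrapT => H'; apply: H; exists a; split=> // -[h [M [lh Hg]]]; apply: H'.
  by exists h, M; split=> // b bS [_ bE]; apply: Hg.
have step i a : exists b, Bad i a -> Bad i.+1 b /\ cl (lvl X + i) a = cl (lvl X + i) b.
  have [Ba|] := pselect (Bad i a); last by exists a.
  have [aS aB] := Ba; apply: contrapT => H; apply: aB.
  apply: (finite_good _ (lvl X + i.+1)%N) => b bS bE.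
  apply: contrapT => H'; apply: H; exists b => _; split; last by rewrite bE.
  split=> // -[h [M [lh Hg]]]; apply: H'; exists h, M; split=> // c cS [_ cE]; exact: Hg.
have /choice[nxt Hnxt] : forall ia : nat * X, exists b, Bad ia.1 ia.2 ->
    Bad ia.1.+1 b /\ cl (lvl X + ia.1) ia.2 = cl (lvl X + ia.1) b.
  by move=> [i a]; exact: step.
pose u := fix u i := if i is j.+1 then nxt (j, u j) else a0.
have Bu i : Bad i (u i) by elim: i => [//|i IH] /=; have [] := Hnxt (i, u i) IH.
have [|a aS Ha] := @ch_lim _ _ _ X (fun h => u (h - lvl X)%N).
  move=> h lh; have [uS _] := Bu (h - lvl X)%N; split=> //.
  have [_] := Hnxt _ (Bu (h - lvl X)%N : Bad (_, _).1 (_, _).2).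
  by rewrite /= subnKC // subSn.
(* At level h' the bad ball contains the limit a, hence lies in a ball where f is a single power
   series: a contradiction. *)
have [h [M HM]] := loc a aS; pose h' := maxn (lvl X) h.
have lh' : (lvl X <= h')%N by exact: leq_maxl.
have [uS []] := Bu (h' - lvl X)%N; exists h', M; split=> // b bS.
rewrite subnKC // Ha // => bE.
have [z Hz ->] := (clP aS bS lh').1 (esym bE).
by apply: chart_refine => //; apply: chart_refine0 HM; exact: leq_maxr.
Qed.

Lemma loc_analytic0 : loc_analytic (fun=> 0 : A).
Proof. by split=> // a aS; exists 0%N, 0; exact: analytic0. Qed.

Lemma analytic_lin (I : finType) (a : A) (f g : (I -> K) -> A) M M' :
  analytic f M -> analytic g M' ->
  analytic (fun z => a * f z + g z) (Num.max (bnorm a * M) M').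
Proof.
move=> Hf Hg; apply: analyticD.
  have := analytic_map (bounded_mull a) Hf.
  move=> /(analytic_le (M' := Num.max (bnorm a * M) M')); rewrite le_max lexx => /(_ isT).
  by apply: analytic_eq => z _; rewrite mulrC.
by apply: analytic_le Hg; rewrite le_max lexx orbT.
Qed.

Lemma loc_analytic_lin (a : A) f g : loc_analytic f -> loc_analytic g ->
  loc_analytic (fun x => a * f x + g x).
Proof.
move=> [sf lf] [sg lg]; split=> [x xS|x xS]; first by rewrite sf // sg // mulr0 addr0.
have [h [M H]] := lf x xS; have [h' [M' H']] := lg x xS.
exists (maxn h h'), (Num.max (bnorm a * M) M').
by apply: analytic_lin; [apply: chart_refine0 H; exact: leq_maxl
  | apply: chart_refine0 H'; exact: leq_maxr].
Qed.

End OneRing.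

Definition la_linear (A : banach K) (mu : (X -> A) -> A) :=
  forall (a : A) (f g : X -> A), loc_analytic f -> loc_analytic g ->
    mu (fun x => a * f x + g x) = a * mu f + mu g.

Definition la_bounded (A : banach K) (mu : (X -> A) -> A) :=
  forall h, exists C : R, forall f M, loc_analytic f -> unif_analytic f h M ->
    bnorm (mu f) <= C * M.

Section Linear.
Context {A : banach K} (mu : (X -> A) -> A) (mu_lin : la_linear mu).

Lemma la_linear0 : mu (fun=> 0) = 0.
Proof.
have := mu_lin 1 (loc_analytic0 (A := A)) (loc_analytic0 (A := A)).
rewrite [X in mu X = _](_ : _ = fun=> 0); last first.
  by apply/funext => x; rewrite mulr0 addr0.
by rewrite mul1r => /(congr1 (fun a => a - mu (fun=> 0))); rewrite addrK subrr => <-.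
Qed.

Lemma la_linear_sum (J : Type) (r : seq J) (a : J -> A) (g : J -> X -> A) :
  (forall j, loc_analytic (g j)) ->
  loc_analytic (fun x => \sum_(j <- r) a j * g j x) /\
  mu (fun x => \sum_(j <- r) a j * g j x) = \sum_(j <- r) a j * mu (g j).
Proof.
move=> Hg; elim: r => [|j r [IH1 IH2]].
  rewrite big_nil (_ : (fun x : X => _) = fun=> 0).
    by split; [exact: loc_analytic0 | exact: la_linear0].
  by apply/funext => x; rewrite big_nil.
rewrite (_ : (fun x : X => \sum_(j <- j :: r) a j * g j x) =
  fun x => a j * g j x + \sum_(j <- r) a j * g j x); last first.
  by apply/funext => x; rewrite big_cons.
by split; [exact: loc_analytic_lin | rewrite mu_lin // IH2 big_cons].
Qed.

End Linear.

Lemma analytic_tail (A : banach K) (I : finType) (c : {ffun I -> nat} -> A)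
    (f : (I -> K) -> A) (e : R) : 0 < e -> null_family bnorm c ->
  (forall z, in_ball z -> sums_to bnorm (fun k => bemb A (monomial z k) * c k) (f z)) ->
  exists N0, forall N, (N0 <= N)%N ->
    analytic (fun z => f z - \sum_(k <- box I N) bemb A (monomial z k) * c k) e.
Proof.
move=> e0 Hc Hf; have [N0 HN0] := Hc e e0; exists N0 => N NN.
exists (fun k => if in_box N k then 0 else c k); split.
- move=> e' e'0; have [n Hn] := Hc e' e'0; exists n => k /Hn.
  by case: ifP => //; rewrite bnorm0.
- move=> k; case: ifPn => [_|/notin_boxP[i Hi]]; first by rewrite bnorm0 ltW.
  by apply/ltW/HN0; exists i; exact: leq_trans Hi.
- move=> z Hz; apply/sums_toE; have /sums_toE h := Hf z Hz.
  apply: cvg_eq (cvgD h (cvg_cst _)); exists N => n Nn.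
  rewrite box_sumB // [LHS]big_mkcond; apply: eq_bigr => k _.
  by case: (in_box N k); rewrite /= ?mulr0.
Qed.

Section Specialisation.
Context (A B : banach K) (C1 C2 : R) (ev : A -> B) (iota : B -> A).
Hypothesis ev_bd : bounded_map C1 ev.
Hypothesis iota_bd : bounded_map C2 iota.
Hypothesis evM : forall a b, ev (a * b) = ev a * ev b.
Hypothesis ev_iota : cancel iota ev.

(** The coefficients can be taken in the kernel of [ev]: replace [c] by
    [c - iota (ev c)]. *)
Lemma kernel_coeff (I : finType) (f : (I -> K) -> A) M : analytic f M ->
  (forall z, in_ball z -> ev (f z) = 0) ->
  exists c : {ffun I -> nat} -> A, [/\ null_family bnorm c, forall k, ev (c k) = 0 &
    forall z, in_ball z -> sums_to bnorm (fun k => bemb A (monomial z k) * c k) (f z)].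
Proof.
move=> [c [h1 _ h3]] H0; have [e1 e2 e3] := ev_bd; have [i1 i2 i3] := iota_bd.
have C10 := bounded_map_ge0 ev_bd; have C20 := bounded_map_ge0 iota_bd.
pose t a := a - iota (ev a).
have tb : bounded_map (Num.max 1 (C2 * C1)) t.
  split=> [a b|x a|a]; first by rewrite /t e1 i1; ring.
    by rewrite /t e2 i2; ring.
  apply: bnormBC; first by rewrite ler_peMl ?bnorm_ge0 // le_max lexx.
  apply: le_trans (i3 _) _; apply: le_trans (ler_wpM2l C20 (e3 a)) _.
  by rewrite mulrA ler_wpM2r ?bnorm_ge0 // le_max lexx orbT.
have [d [k1 k2 k3]] : exists d : {ffun I -> nat} -> A, [/\ null_family bnorm d,
    forall k, d k = t (c k) &
    forall z, in_ball z -> sums_to bnorm (fun k => bemb A (monomial z k) * d k) (t (f z))].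
  have C0 := bounded_map_ge0 tb; have [t1 t2 t3] := tb.
  exists (t \o c); split=> //.
    move=> e ep; have Cp : 0 < Num.max 1 (C2 * C1) by rewrite lt_max ltr01.
    have [N HN] := h1 _ (divr_gt0 ep Cp); exists N => k /HN.
    by rewrite ltr_pdivlMr // mulrC; apply: le_lt_trans; exact: t3.
  move=> z Hz; apply/sums_toE; have /sums_toE h := h3 z Hz.
  apply: cvg_eq (bmap_cvg tb C0 h); exists 0%N => N _.
  by rewrite (bmap_sum tb); apply: eq_bigr => k _; rewrite t2.
exists d; split=> // [k|z Hz]; first by rewrite k2 /t e1 ev_iota subrr.
by have := k3 z Hz; rewrite /t H0 // (bmap0 iota_bd) subr0.
Qed.

(** On a finite cover by balls, [F] is a convergent sum of monomials with
    coefficients in the kernel of [ev]. *)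
Lemma kernel_functional (mu : (X -> A) -> A) (F : X -> A) :
  la_linear mu -> la_bounded mu -> loc_analytic F ->
  (forall x, ev (F x) = 0) -> ev (mu F) = 0.
Proof.
move=> mu_lin mu_bd HF ev0.
have [[x0 x0S]|empty] := pselect (exists x, dom X x); last first.
  rewrite (_ : F = fun=> 0) ?la_linear0 ?(bmap0 ev_bd) //; apply/funext => x.
  by have [-> //] := HF; move=> xS; apply: empty; exists x.
have [h [M [lh HU]]] := loc_analytic_unif HF.
(* A centre and coefficients in the kernel for each ball of level h; classes without points receive
   [x0] and the zero family. *)
have /choice[rc Hrc] : forall t : cls X h, exists rc : X * ({ffun crd X -> nat} -> A),
    [/\ null_family bnorm rc.2, forall k, ev (rc.2 k) = 0 &
      forall b, dom X b -> cl h b = t -> [/\ dom X rc.1, cl h rc.1 = t &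
        forall z, in_ball z -> sums_to bnorm (fun k => bemb A (monomial z k) * rc.2 k)
          (F (ch rc.1 h z))]].
  move=> t; have [[r rS rt]|no] := pselect (exists2 r, dom X r & cl h r = t).
    have [c [c1 c2 c3]] := kernel_coeff (HU r rS) (fun z _ => ev0 _).
    exists (r, c); split; [exact: c1 | exact: c2 | move=> b _ _; split; [exact: rS | exact: rt | exact: c3]].
  exists (x0, fun=> 0); split=> /=.
  - by move=> e e0; exists 0%N => k _; rewrite bnorm0.
  - by move=> k; rewrite (bmap0 ev_bd).
  - by move=> b bS bt; case: no; exists b.
pose r t := (rc t).1; pose c t := (rc t).2.
(* A single monomial in the coordinates of one ball, extended by 0 to the other balls. *)
pose G (tk : cls X h * {ffun crd X -> nat}) (x : X) : A :=
  if `[< dom X x /\ cl h x = tk.1 >] then bemb A (monomial (co (r tk.1) h x) tk.2) else 0.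
(* Around any a the chart is a translate by z0 of the chart at the chosen centre. The factor 1 is
   p^0 from [ch_ch], and masking matches what [co] recovers. *)
have chart_at a : dom X a -> exists2 z0, in_ball z0 &
    forall z, in_ball z -> [/\ dom X (ch a h z), cl h (ch a h z) = cl h a &
      ch a h z = ch (r (cl h a)) h (fun i => if mask i then z0 i + 1 * z i else 0)].
  move=> aS; have [_ _ /(_ a aS erefl)[rS rt _]] := Hrc (cl h a).
  have [z0 Hz0 aE] := (clP rS aS lh).1 rt; exists z0 => // z Hz.
  have chS : dom X (ch a h z) by exact: ch_dom.
  split=> //; first by apply/esym/(clP aS chS lh); exists z.
  rewrite ch_mask {1}aE; have := ch_ch (r (cl h a)) h 0 z0 z.
  by rewrite addn0 expr0.
have mask_an (z0 : crd X -> K) i : in_ball z0 ->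
    analyticK (fun z : crd X -> K => if mask i then z0 i + 1 * z i else 0) 1.
  move=> Hz0; case: (mask i); last by apply: analytic_base_cst; rewrite pabs0.
  by apply: in_ball_affine; rewrite ?pabs1.
have G_at tk a z0 : dom X a ->
    (forall z, in_ball z -> [/\ dom X (ch a h z), cl h (ch a h z) = cl h a &
      ch a h z = ch (r (cl h a)) h (fun i => if mask i then z0 i + 1 * z i else 0)]) ->
    forall z, in_ball z -> G tk (ch a h z) = if cl h a == tk.1 then
     bemb A (monomial (fun i => if mask i then z0 i + 1 * z i else 0) tk.2) else 0.
  move=> aS H z Hz; have [h1 h2 h3] := H z Hz; rewrite /G.
  case: eqP => [E|E]; last first.
    by rewrite asboolF // => -[_]; rewrite h2.
  rewrite asboolT; last by rewrite h2.
  congr (bemb A (monomial _ _)); apply/funext => i; rewrite h3 -E coE.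
  by case: (mask i).
have HG tk : loc_analytic (G tk).
  split=> [x xS|a aS]; first by rewrite /G asboolF // => -[].
  have [z0 Hz0 Hz] := chart_at a aS; have GE := G_at tk a z0 aS Hz.
  exists h, (bnorm (1 : A) * 1).
  apply: (@analytic_eq _ _ _ _ _ (fun z => if cl h a == tk.1 then
     bemb A (monomial (fun i => if mask i then z0 i + 1 * z i else 0) tk.2) else 0)).
    by move=> z /GE.
  case: eqP => _; last by apply: analytic0; rewrite mulr1 bnorm_ge0.
  by apply: analytic_emb; apply: analytic_monomial_comp => i; exact: mask_an.
pose FN N x := \sum_t \sum_(k <- box (crd X) N) c t k * G (t, k) x.
have FN_lin N : loc_analytic (FN N) /\ ev (mu (FN N)) = 0.
  have inner t := la_linear_sum mu_lin (box (crd X) N) (c t) (fun k => HG (t, k)).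
  have [o1 o2] := la_linear_sum mu_lin (index_enum (cls X h)) (fun=> 1) (fun t => (inner t).1).
  have FE : FN N = fun x => \sum_t 1 * \sum_(k <- box (crd X) N) c t k * G (t, k) x.
    by apply/funext => x; apply: eq_bigr => t _; rewrite mul1r.
  rewrite FE o2; split=> //; rewrite (bmap_sum ev_bd) big1 // => t _.
  rewrite mul1r (inner t).2 (bmap_sum ev_bd) big1 // => k _.
  by rewrite evM; have [_ -> _] := Hrc t; rewrite mul0r.
have [C HC] := mu_bd h.
have approx (e : R) : 0 < e -> exists N, unif_analytic (fun x => F x - FN N x) h e.
  move=> e0.
  have /choice[n Hn] : forall t : cls X h, exists N0, forall b, dom X b -> cl h b = t ->
     forall N, (N0 <= N)%N -> analytic (fun z => F (ch (r t) h z) -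
       \sum_(k <- box (crd X) N) bemb A (monomial z k) * c t k) e.
    move=> t; have [[b bS bt]|no] := pselect (exists2 b, dom X b & cl h b = t).
      have [k1 _ /(_ b bS bt)[_ _ k3]] := Hrc t.
      have [N0 HN0] := analytic_tail e0 k1 k3; exists N0 => _ _ _; exact: HN0.
    by exists 0%N => b bS bt; case: no; exists b.
  exists (\max_t n t)%N => a aS; have [z0 Hz0 Hz] := chart_at a aS.
  set N := (\max_t n t)%N.
  have tail := Hn (cl h a) a aS erefl N (leq_bigmax (cl h a)).
  have := analytic_comp (fun i => mask_an z0 i Hz0) tail.
  apply: analytic_eq => z Hbz; have [_ _ E] := Hz z Hbz.
  rewrite -E; congr (_ - _); rewrite /FN (bigD1 (cl h a)) //= [X in _ + X]big1 ?addr0.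
    apply: eq_bigr => k _; rewrite (G_at _ a z0 aS Hz) //= eqxx mulrC.
    by [].
  move=> t tn; rewrite big1 // => k _; rewrite (G_at _ a z0 aS Hz) //=.
  by rewrite eq_sym (negbTE tn) mulr0.
have C10 := bounded_map_ge0 ev_bd.
apply: bnorm_eq0; apply/eqP; rewrite eq_le bnorm_ge0 andbT leNgt; apply/negP => e0.
(* Since D exceeds C1 C, approximating F to within |ev (mu F)| / D gives |ev (mu F)| < |ev (mu F)|.
   The maximum is there because C may be negative. *)
pose D := C1 * Num.max C 0 + 1.
have D0 : 0 < D by rewrite ltr_wpDl // mulr_ge0 // le_max lexx orbT.
have [N HN] := approx _ (divr_gt0 e0 D0).
have [l1 l2] := FN_lin N.
have muB : mu (fun x => F x - FN N x) = mu F - mu (FN N).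
  have FE : F = fun x => 1 * FN N x + (F x - FN N x).
    by apply/funext => x; rewrite mul1r; ring.
  have lB : loc_analytic (fun x => F x - FN N x).
    have := loc_analytic_lin (-1) l1 HF; congr loc_analytic.
    by apply/funext => x; ring.
  by rewrite {2}FE mu_lin //; ring.
have lB : loc_analytic (fun x => F x - FN N x).
  have := loc_analytic_lin (-1) l1 HF; congr loc_analytic.
  by apply/funext => x; ring.
have := HC _ _ lB HN; rewrite muB => h1.
have [e1 _ e3] := ev_bd; have h2 := e3 (mu F - mu (FN N)).
rewrite e1 l2 subr0 in h2.
have : bnorm (ev (mu F)) <= C1 * (Num.max C 0 * (bnorm (ev (mu F)) / D)).
  apply: le_trans h2 _; apply: ler_wpM2l => //; apply: le_trans h1 _.
  by apply: ler_wpM2r; rewrite ?le_max ?lexx // divr_ge0 ?bnorm_ge0 // ltW.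
rewrite !mulrA ler_pdivlMr // mulrC ler_pM2r //.
by rewrite /D gerDl ler10.
Qed.

End Specialisation.
End LocAnalytic.

(** * The Iwahori decomposition *)

Section Iwahori.
Context {R : realType} {p : nat} {K : padicField R p}.
Hypothesis p_pr : prime p.
Local Notation "'rad' h" := ((p%:R : R) ^- h) (at level 10).

Definition integral_mx (c d : nat) (A : 'M[K]_(c, d)) := forall i j, pabs (A i j) <= 1.

Lemma pabsDC (x y : K) e : pabs x <= e -> pabs y <= e -> pabs (x + y) <= e.
Proof. exact: (@bnormDC _ _ _ banach_base). Qed.

Lemma pabs_sum (I : Type) (r : seq I) (P : pred I) (F : I -> K) e : 0 <= e ->
  (forall i, P i -> pabs (F i) <= e) -> pabs (\sum_(i <- r | P i) F i) <= e.
Proof. exact: (@bnorm_sum _ _ _ banach_base). Qed.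

Lemma pabsM_le1 (x y : K) e : pabs x <= 1 -> pabs y <= e -> pabs (x * y) <= e.
Proof.
move=> hx hy; rewrite pabsM; apply: le_trans hy; exact: ler_piMl (pabs_ge0 _) hx.
Qed.

Lemma pabs_le1M (x y : K) e : pabs x <= e -> pabs y <= 1 -> pabs (x * y) <= e.
Proof. by move=> hx hy; rewrite mulrC; exact: pabsM_le1. Qed.

Lemma integral_mulmx a b c (A : 'M[K]_(a, b)) (B : 'M[K]_(b, c)) :
  integral_mx A -> integral_mx B -> integral_mx (A *m B).
Proof.
by move=> HA HB i j; rewrite mxE; apply: pabs_sum => // l _; exact: pabsM_le1.
Qed.

Lemma integral_det d (A : 'M[K]_d) : integral_mx A -> pabs (\det A) <= 1.
Proof.
move=> HA; apply: pabs_sum => // s _; rewrite pabsM pabsX pabsN1 expr1n mul1r.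
by rewrite pabs_prod; apply: prodr_ile1 => i _; rewrite pabs_ge0 HA.
Qed.

Lemma pabs1_neq0 (x : K) : pabs x = 1 -> x != 0.
Proof. by move=> x1; apply/eqP => E; move: x1; rewrite E pabs0 => /eqP; rewrite eq_sym oner_eq0. Qed.

Lemma GL_Zp_mul d (g g' : 'M[K]_d) : GL_Zp g -> GL_Zp g' -> GL_Zp (g *m g').
Proof.
move=> [g1 g2] [h1 h2]; split; first exact: integral_mulmx.
by rewrite det_mulmx pabsM g2 h2 mulr1.
Qed.

Lemma lower_integral d b (A : 'M[K]_d) : lower_Zp b A -> integral_mx A.
Proof.
move=> [h1 h2 h3] i j; case: (ltngtP i j) => ij.
- by rewrite h2 // pabs0.
- by apply: le_trans (h3 _ _ ij) (rad_le1 p_pr _).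
- by rewrite (val_inj ij) h1 pabs1.
Qed.

Lemma lower_det d b (A : 'M[K]_d) : lower_Zp b A -> \det A = 1.
Proof.
move=> [h1 h2 h3]; have T : is_trig_mx A by apply/is_trig_mxP => i j; exact: h2.
by rewrite (det_trig T) big1.
Qed.

Lemma lower_GL d b (A : 'M[K]_d) : lower_Zp b A -> GL_Zp A.
Proof.
by move=> HA; split; [exact: lower_integral HA | rewrite (lower_det HA) pabs1].
Qed.

Lemma upper_det d (A : 'M[K]_d) : upper_Zp A -> \det A = 1.
Proof.
move=> [h1 h2 h3]; have T : is_trig_mx A^T.
  by apply/is_trig_mxP => i j; rewrite mxE; exact: h2.
by rewrite -det_tr (det_trig T) big1 // => i _; rewrite mxE h1.
Qed.

Lemma upper_Iw d (A : 'M[K]_d) : upper_Zp A -> Iw A.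
Proof.
move=> HA; have [h1 h2 h3] := HA; split; first by split=> //; rewrite (upper_det HA) pabs1.
by move=> i j ij; rewrite h2 // pabs0 invr_ge0 ler0n.
Qed.

Lemma torus_Iw d (s : 'rV[K]_d) : torus_Zp s -> Iw (diag_mx s).
Proof.
move=> Hs; split; last first.
  by move=> i j ij; rewrite mxE -val_eqE /= gtn_eqF // mulr0n pabs0 invr_ge0 ler0n.
split; last by rewrite det_diag pabs_prod big1 // => i _; exact: Hs.
move=> i j; rewrite mxE; case: eqP => _; rewrite ?mulr0n ?pabs0 ?mulr1n //.
by rewrite Hs.
Qed.

Lemma lower_Iw d (A : 'M[K]_d) : lower_Zp 1 A -> Iw A.
Proof.
move=> HA; split; first exact: lower_GL HA.
by move=> i j ij; have [_ _ /(_ i j ij)] := HA; rewrite expr1.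
Qed.

Lemma Iw_mul d (g g' : 'M[K]_d) : Iw g -> Iw g' -> Iw (g *m g').
Proof.
move=> [g1 g2] [h1 h2]; split; first exact: GL_Zp_mul.
move=> i j ij; rewrite mxE; apply: pabs_sum => [|l _]; first by rewrite invr_ge0 ler0n.
have [li|il] := ltnP l i; first by apply: pabs_le1M; [exact: g2 | exact: h1.1].
by apply: pabsM_le1; [exact: g1.1 | apply: h2; exact: leq_trans il].
Qed.

Lemma Iw_decomposed d (nb : 'M[K]_d) s x :
  lower_Zp 1 nb -> torus_Zp s -> upper_Zp x -> Iw (nb *m diag_mx s *m x).
Proof.
move=> /lower_Iw h1 /torus_Iw h2 /upper_Iw h3; apply: Iw_mul => //; exact: Iw_mul.
Qed.

Lemma lower_mul d b (A B : 'M[K]_d) : lower_Zp b A -> lower_Zp b B -> lower_Zp b (A *m B).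
Proof.
move=> HA HB; have iB := lower_integral HB; have [a1 a2 a3] := HA; have [b1 b2 b3] := HB.
split=> [i|i j ij|i j ji]; rewrite mxE.
- rewrite (bigD1 i) //= a1 b1 mulr1 big1 ?addr0 // => l.
  rewrite -val_eqE /= neq_ltn => /orP[li|il]; first by rewrite b2 // mulr0.
  by rewrite a2 // mul0r.
- rewrite big1 // => l _; have [il|li] := ltnP i l; first by rewrite a2 // mul0r.
  by rewrite b2 ?mulr0 //; exact: leq_ltn_trans ij.
- apply: pabs_sum => [|l _]; first exact: rad_ge0.
  case: (ltngtP l i) => li.
  + by apply: pabs_le1M; [exact: a3 | exact: iB].
  + by rewrite a2 // mul0r pabs0 rad_ge0.
  + by rewrite (val_inj li) a1 mul1r b3.
Qed.

Lemma lower_conj d b (A : 'M[K]_d) (s : 'rV[K]_d) : lower_Zp b A -> torus_Zp s ->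
  exists2 A', lower_Zp b A' & diag_mx s *m A = A' *m diag_mx s.
Proof.
move=> [h1 h2 h3] Hs; have sn0 i : s 0 i != 0 by apply/pabs1_neq0/Hs.
exists (\matrix_(i, j) (s 0 i * A i j / s 0 j)); last first.
  by rewrite mul_diag_mx mul_mx_diag; apply/matrixP => i j; rewrite !mxE mulfVK.
split=> [i|i j ij|i j ij]; rewrite mxE.
- by rewrite h1 mulr1 divff.
- by rewrite h2 // mulr0 mul0r.
- by rewrite !pabsM pabsV (Hs i : pabs _ = 1) (Hs j : pabs _ = 1) invr1 mulr1 mul1r h3.
Qed.

Lemma lower_block d b (A : 'M[K]_(1 + d)) : lower_Zp b A ->
  A = block_mx 1%:M 0 (dlsubmx A) (drsubmx A) /\ lower_Zp b (drsubmx A).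
Proof.
move=> [h1 h2 h3]; split.
  rewrite -[LHS]submxK; congr block_mx; apply/matrixP => i j; rewrite !mxE.
    by rewrite !ord1 h1.
  by rewrite h2 // ord1.
split=> [i|i j ij|i j ij]; rewrite !mxE.
- exact: h1.
- by rewrite h2 //= ltn_add2l.
- by apply: h3; rewrite /= ltn_add2l.
Qed.

Lemma upper_block d (A : 'M[K]_(1 + d)) : upper_Zp A ->
  A = block_mx 1%:M (ursubmx A) 0 (drsubmx A) /\ upper_Zp (drsubmx A).
Proof.
move=> [h1 h2 h3]; split.
  rewrite -[LHS]submxK; congr block_mx; apply/matrixP => i j; rewrite !mxE.
    by rewrite !ord1 h1.
  by rewrite h2 //= ord1.
split=> [i|i j ij|i j]; rewrite !mxE.
- exact: h1.
- by rewrite h2 //= ltn_add2l.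
- exact: h3.
Qed.

Lemma diag_mx_block d (s : 'rV[K]_(1 + d)) :
  diag_mx s = block_mx (s 0 0)%:M 0 0 (diag_mx (rsubmx s)).
Proof.
rewrite -{1}[s]hsubmxK diag_mx_row; congr block_mx; apply/matrixP => i j.
by rewrite !ord1 !mxE eqxx; congr (s _ _ *+ _); apply/val_inj.
Qed.

Lemma decomposition_block d (c : 'cV[K]_d) (n : 'M[K]_d) (a : K) (s : 'rV[K]_d)
    (b : 'rV[K]_d) (x : 'M[K]_d) :
  block_mx 1%:M 0 c n *m block_mx a%:M 0 0 (diag_mx s) *m block_mx 1%:M b 0 x =
  block_mx a%:M (a *: b) (a *: c) (a *: (c *m b) + n *m diag_mx s *m x).
Proof.
rewrite !mulmx_block !(mul1mx, mul0mx, mulmx0, mulmx1, addr0, add0r).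
by rewrite mul_scalar_mx mul_mx_scalar scalemxAl.
Qed.

(** Induction on the size: the nonzero corner fixes the first torus entry, then the first row and
    column are fixed, and cancelling their product leaves the same equation for the lower right
    blocks. *)
Lemma decomposition_unique d (nb nb' : 'M[K]_d) s s' x x' :
  lower_Zp 0 nb -> lower_Zp 0 nb' -> torus_Zp s -> torus_Zp s' ->
  upper_Zp x -> upper_Zp x' ->
  nb *m diag_mx s *m x = nb' *m diag_mx s' *m x' -> [/\ nb = nb', s = s' & x = x'].
Proof.
elim: d nb nb' s s' x x' => [|d IH] nb nb' s s' x x'.
  by move=> *; split; rewrite [LHS]thinmx0 [RHS]thinmx0.
move=> /(@lower_block d)[nE nl] /(@lower_block d)[nE' nl'] Hs Hs'.
move=> /(@upper_block d)[xE xu] /(@upper_block d)[xE' xu'].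
have sb (t : 'rV[K]_(1 + d)) : torus_Zp t -> torus_Zp (rsubmx t).
  by move=> Ht i; rewrite !mxE; exact: Ht.
rewrite nE xE nE' xE' (@diag_mx_block d s) (@diag_mx_block d s') !decomposition_block.
move=> E0; have [/matrixP/(_ 0 0) aE bE cE] := @eq_block_mx _ 1 d 1 d _ _ _ _ _ _ _ _ E0.
clear E0.
move: aE bE cE; rewrite !mxE eqxx !mulr1n => aE.
have a0 : (s 0 0 : K) != 0 by apply/pabs1_neq0/Hs.
rewrite -aE => /(scalerI a0) bE /(scalerI a0) cE; rewrite bE cE.
move=> /addrI E; have [] := IH _ _ _ _ _ _ nl nl' (sb s Hs) (sb s' Hs') xu xu' E.
move=> -> sE ->; split=> //.
have lE : @lsubmx _ 1 1 d s = @lsubmx _ 1 1 d s'.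
  apply/matrixP => i j; rewrite !ord1 !mxE (_ : lshift d 0 = 0) //; exact/val_inj.
by have := @hsubmxK _ 1 1 d s; rewrite sE lE hsubmxK.
Qed.

(** The first column is divisible by p below the corner; were the corner divisible by p too,
    expansion along this column would make the determinant a nonunit. *)
Lemma Iw_corner d (g : 'M[K]_d.+1) : Iw g -> pabs (g 0 0) = 1.
Proof.
move=> [[g1 g2] g3]; apply/eqP; rewrite eq_le g1 leNgt; apply/negP => lt.
suff : pabs (\det g) < 1 by rewrite g2 ltxx.
have cof i : pabs (cofactor g i 0) <= 1.
  rewrite /cofactor pabsM pabsX pabsN1 expr1n mul1r integral_det // => k l.
  by rewrite !mxE.
rewrite (expand_det_col g 0).
apply: (@bnorm_sumlt _ _ _ banach_base) => // i _; rewrite bnorm_baseE pabsM.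
apply: (@le_lt_trans _ _ (pabs (g i 0))); first exact: ler_piMr (pabs_ge0 _) (cof i).
have [i0|i0] := posnP i; first by rewrite (_ : i = 0) //; apply/val_inj.
apply: le_lt_trans (g3 i 0 i0) _; rewrite -[p%:R]expr1; exact: rad1_lt1.
Qed.

Definition schur d (g : 'M[K]_(1 + d)) : 'M[K]_d :=
  drsubmx g - (g 0 0)^-1 *: (dlsubmx g *m ursubmx g).

Lemma schur_block d (g : 'M[K]_(1 + d)) : g 0 0 != 0 ->
  g = block_mx (g 0 0)%:M (g 0 0 *: ((g 0 0)^-1 *: ursubmx g))
    (g 0 0 *: ((g 0 0)^-1 *: dlsubmx g))
    (g 0 0 *: (((g 0 0)^-1 *: dlsubmx g) *m ((g 0 0)^-1 *: ursubmx g)) + schur g).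
Proof.
move=> a0; rewrite -[LHS]submxK; congr block_mx.
- apply/matrixP => i j; rewrite !ord1 !mxE eqxx mulr1n.
  by rewrite (_ : lshift d 0 = 0) //; apply/val_inj.
- by rewrite scalerA mulfV // scale1r.
- by rewrite scalerA mulfV // scale1r.
- by rewrite /schur -scalemxAl -scalemxAr !scalerA mulfV // mul1r addrC subrK.
Qed.

Lemma schurE d (g : 'M[K]_(1 + d)) i j :
  schur g i j = g (rshift 1 i) (rshift 1 j)
    + - ((g 0 0)^-1 * (g (rshift 1 i) 0 * g 0 (rshift 1 j))).
Proof.
rewrite !mxE big_ord1 !mxE (_ : lshift d 0 = 0) //; exact/val_inj.
Qed.

Lemma schur_Iw d (g : 'M[K]_(1 + d)) : Iw g -> Iw (schur g).
Proof.
move=> Hg; have a1 := @Iw_corner d g Hg; have a0 := pabs1_neq0 a1.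
have av : pabs (g 0 0)^-1 <= 1 by rewrite pabsV a1 invr1.
have [[g1 g2] g3] := Hg; split; [split|] => [i j||i j ij]; rewrite ?schurE.
- apply: pabsDC; first exact: g1.
  by rewrite pabsN; apply: pabsM_le1 => //; apply: pabsM_le1.
- suff dE : \det g = g 0 0 * \det (schur g) by move: g2; rewrite dE pabsM a1 mul1r.
  have -> : \det g = \det (block_mx 1%:M 0 ((g 0 0)^-1 *: dlsubmx g) 1%:M *m
     block_mx (g 0 0)%:M (g 0 0 *: ((g 0 0)^-1 *: ursubmx g)) 0 (schur g)).
    rewrite mulmx_block !(mul1mx, mul0mx, mulmx0, mulmx1, addr0, add0r).
    by rewrite {1}(schur_block a0) mul_mx_scalar scalemxAr.
  by rewrite det_mulmx det_lblock det_ublock !det1 det_scalar1 !mul1r.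
- apply: pabsDC; first by apply: g3; rewrite /= ltn_add2l.
  rewrite pabsN; apply: pabsM_le1 => //; apply: pabs_le1M; last exact: g1.
  by apply: g3; rewrite /= add1n.
Qed.

(** By successive Schur complements. *)
Lemma iwahori_family (J : finType) (dl : R) (dl0 : 0 <= dl) (dl1 : dl < 1) d
    (G : (J -> K) -> 'M[K]_d) :
  (forall i j, near_cst dl (fun z => G z i j)) ->
  (forall z, in_ball z -> Iw (G z)) ->
  exists nb s x, [/\ forall z, in_ball z -> [/\ lower_Zp 1 (nb z), torus_Zp (s z),
      upper_Zp (x z) & G z = nb z *m diag_mx (s z) *m x z],
    forall i, near_cst dl (fun z => (s z : 'rV[K]_d) 0 i) &
    forall i j, near_cst dl (fun z => (x z : 'M[K]_d) i j)].
Proof.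
elim: d G => [|d IH] G Gn GI.
  exists (fun=> 1%:M), (fun=> 0), (fun=> 1%:M); split=> [z Hz|[]|[]] //.
  split; try (by split=> -[]); first by move=> [].
  by rewrite [LHS]thinmx0 [RHS]thinmx0.
have Bul := @block_mxEul K 1 d 1 d; have Bur := @block_mxEur K 1 d 1 d.
have Bdl := @block_mxEdl K 1 d 1 d; have Bdr := @block_mxEdr K 1 d 1 d.
have Rl := @row_mxEl K 1 1 d; have Rr := @row_mxEr K 1 1 d.
pose z0 : J -> K := fun=> 0.
have Hz0 : in_ball z0 by move=> i; rewrite /z0 pabs0.
have a1 z : in_ball z -> pabs (G z 0 0) = 1 by move=> /GI /Iw_corner.
have an := near_cstV dl1 Hz0 (a1 _ Hz0) (Gn 0 0).
have [|z Hz|nb [s [x [H1 H2 H3]]]] := IH (fun z => schur (G z : 'M[K]_(1 + d))).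
- move=> i j; apply: (near_cst_eq (g := fun z => G z (rshift 1 i) (rshift 1 j)
    + - ((G z 0 0)^-1 * (G z (rshift 1 i) 0 * G z 0 (rshift 1 j))))).
    by move=> z _; rewrite schurE.
  apply: near_cstD => //; apply: near_cstN; apply: near_cstM => //.
  exact: near_cstM.
- exact/schur_Iw/GI.
pose c z := (G z 0 0)^-1 *: dlsubmx (G z : 'M[K]_(1 + d)).
pose b z := (G z 0 0)^-1 *: ursubmx (G z : 'M[K]_(1 + d)).
exists (fun z => block_mx 1%:M 0 (c z) (nb z) : 'M_(1 + d)).
exists (fun z => row_mx (G z 0 0)%:M (s z) : 'rV_(1 + d)).
exists (fun z => block_mx 1%:M (b z) 0 (x z) : 'M_(1 + d)).
have E0 : lshift d (0 : 'I_1) = 0 by exact/val_inj.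
have one_n : near_cst dl (fun _ : J -> K => (1 : K)) by apply: near_cst_cst; rewrite ?pabs1.
have zero_n : near_cst dl (fun _ : J -> K => (0 : K)) by apply: near_cst_cst; rewrite ?pabs0.
split.
- move=> z Hz; have [h1 h2 h3 h4] := H1 z Hz; have a0 := pabs1_neq0 (a1 z Hz).
  have av : pabs (G z 0 0)^-1 <= 1 by rewrite pabsV a1 // invr1.
  have [[g1 g2] g3] := GI z Hz; cbv beta; split.
  + have [l1 l2 l3] := h1; split.
    * move=> i; case: (@split_ordP 1 d i) => k ->; last by rewrite Bdr l1.
      by rewrite Bul mxE eqxx.
    * move=> i j; case: (@split_ordP 1 d i) => k ->; case: (@split_ordP 1 d j) => l ->.
      - by rewrite !ord1.
      - by rewrite Bur mxE.
      - by rewrite /= ord1.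
      - by rewrite Bdr /= ltn_add2l; exact: l2.
    * move=> i j; case: (@split_ordP 1 d i) => k ->; case: (@split_ordP 1 d j) => l ->.
      - by rewrite !ord1.
      - by rewrite /= ord1.
      - move=> _; rewrite Bdl !mxE ord1 E0; apply: pabsM_le1 => //.
        by rewrite expr1; apply: g3.
      - by rewrite Bdr /= ltn_add2l; exact: l3.
  + move=> i; case: (@split_ordP 1 d i) => k ->; last by rewrite Rr; exact: h2.
    by rewrite Rl !mxE ord1 eqxx mulr1n; exact: a1.
  + have [l1 l2 l3] := h3; split.
    * move=> i; case: (@split_ordP 1 d i) => k ->; last by rewrite Bdr l1.
      by rewrite Bul mxE eqxx.
    * move=> i j; case: (@split_ordP 1 d i) => k ->; case: (@split_ordP 1 d j) => l ->.
      - by rewrite !ord1.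
      - by rewrite /= ord1.
      - by rewrite Bdl mxE.
      - by rewrite Bdr /= ltn_add2l; exact: l2.
    * move=> i j; case: (@split_ordP 1 d i) => k ->; case: (@split_ordP 1 d j) => l ->.
      - by rewrite Bul mxE !ord1 eqxx pabs1.
      - by rewrite Bur !mxE ord1 E0; exact: pabsM_le1.
      - by rewrite Bdl mxE pabs0.
      - by rewrite Bdr.
  + rewrite (@diag_mx_row _ d 1 (G z 0 0)%:M (s z)).
    have -> : diag_mx (G z 0 0)%:M = (G z 0 0)%:M :> 'M[K]_1.
      by apply/matrixP => i j; rewrite !ord1 !mxE.
    by rewrite (@decomposition_block d) -h4 -(@schur_block d).
- move=> i; case: (@split_ordP 1 d i) => k ->.
    by apply: near_cst_eq (Gn 0 0) => z _; rewrite Rl !mxE ord1 eqxx mulr1n.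
  by apply: near_cst_eq (H2 k) => z _; rewrite Rr.
- move=> i j; case: (@split_ordP 1 d i) => k ->; case: (@split_ordP 1 d j) => l ->.
  + by apply: near_cst_eq one_n => z _; rewrite Bul mxE !ord1 eqxx.
  + apply: near_cst_eq (near_cstM dl1 an (Gn 0 (rshift 1 l))) => z _.
    by rewrite Bur !mxE ord1 E0.
  + by apply: near_cst_eq zero_n => z _; rewrite Bdl mxE.
  + by apply: near_cst_eq (H3 k l) => z _; rewrite Bdr.
Qed.

Lemma iwahori_decomposition d (g : 'M[K]_d) : Iw g ->
  exists nb s x, [/\ lower_Zp 1 nb, torus_Zp s, upper_Zp x & g = nb *m diag_mx s *m x].
Proof.
move=> Hg.
(* A single matrix is a family over the polydisc of dimension 0. *)
have [|z _|nb [s [x [H _ _]]]] := @iwahori_family void (rad 1) (rad_ge0 p_pr 1)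
  (rad1_lt1 p_pr) d (fun=> g).
- by move=> i j; apply: near_cst_cst; [exact: rad_ge0 | exact: Hg.1.1].
- exact: Hg.
- have Hz : in_ball (fun _ : void => 0 : K) by case.
  by exists (nb (fun=> 0)), (s (fun=> 0)), (x (fun=> 0)); exact: H.
Qed.

End Iwahori.

(** * The spaces of units and of unipotent matrices *)

Section Spaces.
Context {R : realType} {p : nat} {K : padicField R p}.
Hypothesis p_pr : prime p.
Local Notation "'rad' h" := ((p%:R : R) ^- h) (at level 10).
Implicit Types x y : K.

(** For integral x this is the unique n < p^h congruent to x; the ordinal type is one larger than
    needed because [inord] asks for a successor. *)
Definition residue_class (h : nat) x : 'I_(p ^ h).+1 :=
  inord (xget 0%N [set n | (n < p ^ h)%N /\ pabs (x - n%:R) <= rad h]).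

Lemma pabs_distC x y : pabs (x - y) = pabs (y - x).
Proof. by rewrite -pabsN opprB. Qed.

Lemma residue_classP h x y : pabs x <= 1 -> pabs y <= 1 ->
  residue_class h x = residue_class h y <-> pabs (y - x) <= rad h.
Proof.
have rc t : pabs t <= 1 -> (residue_class h t < p ^ h)%N /\
    pabs (t - (residue_class h t)%:R) <= rad h.
  move=> t1; rewrite /residue_class; case: xgetP => [n _ [n1 n2]|H].
    by rewrite inordK // ltnS ltnW.
  by have [n n1 n2] := residue p_pr h t1; case: (H n).
move=> /rc[x1 x2] /rc[y1 y2]; split=> [E|xy].
  rewrite (_ : y - x = (y - (residue_class h y)%:R) + - (x - (residue_class h y)%:R)); last by ring.
  by apply: pabsDC => //; rewrite pabsN -E.
set m := (residue_class h x : nat) in x1 x2; set n := (residue_class h y : nat) in y1 y2.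
have : pabs (m%:R - n%:R : K) <= rad h.
  rewrite (_ : _ - _ = ((y - n%:R) + - (y - x)) + - (x - m%:R)); last by ring.
  by apply: pabsDC; [apply: pabsDC |]; rewrite ?pabsN.
by move=> /(residue_unique p_pr x1 y1) ?; exact: val_inj.
Qed.

Lemma rad_eq0 l x : (forall h, (l <= h)%N -> pabs x <= rad h) -> x = 0.
Proof.
move=> H; apply: pabs_eq0; apply/eqP; rewrite eq_le pabs_ge0 andbT leNgt.
apply/negP => x0; have [N HN] := rad_null p_pr x0.
have := le_lt_trans (H _ (leq_maxl l N)) (HN _ (leq_maxr l N)); by rewrite ltxx.
Qed.

Lemma rad_limit l (u : nat -> K) :
  (forall h, (l <= h)%N -> pabs (u h.+1 - u h) <= rad h) ->
  exists a, forall h, (l <= h)%N -> pabs (a - u h) <= rad h.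
Proof.
move=> H; have key h k : (l <= h)%N -> pabs (u (h + k)%N - u h) <= rad h.
  move=> lh; elim: k => [|k IH]; first by rewrite addn0 subrr pabs0 rad_ge0.
  rewrite addnS (_ : _ - _ = (u (h + k).+1 - u (h + k)%N) + (u (h + k)%N - u h)); last by ring.
  apply: pabsDC => //; apply: le_trans (H _ (leq_trans lh (leq_addr _ _))) _.
  by apply: rad_le => //; exact: leq_addr.
have [e e0|a Ha] := @pabs_complete _ _ K u.
  have [N HN] := rad_null p_pr e0; exists (maxn l N) => i j.
  rewrite !geq_max => /andP[li Ni] /andP[lj Nj].
  have [ij|ji] := leqP i j.
    by rewrite pabs_distC -(subnKC ij); apply: le_lt_trans (key _ _ li) (HN _ Ni).
  by rewrite -(subnKC (ltnW ji)); apply: le_lt_trans (key _ _ lj) (HN _ Nj).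
exists a => h lh; apply: (@cvg_le _ _ _ banach_base (fun k => u (h + k)%N - u h)) => //.
- exact: rad_ge0.
- apply: (cvgD (A := banach_base)); last exact: cvg_cst.
  by move=> e e0; have [N HN] := Ha e e0; exists N => i Ni; apply: HN; exact: leq_trans (leq_addl _ _).
- by exists 0%N => k _; exact: key.
Qed.

(** Levels start at 1: a ball of radius 1 around a unit contains nonunits. *)
Definition units_space : chart_space K.
Proof.
apply: (@ChartSpace R p K K unit (@Zp_units R p K) 1 chart_Z
  (fun a h x _ => (x - a) / p%:R ^+ h) (fun=> true) _ residue_class).
- by move=> a h; rewrite /chart_Z mulr0 addr0.
- move=> a h z au h1 Hz; apply: (pabs_unit_near au).
  rewrite /chart_Z addrAC subrr add0r pabsM pabs_pX.
  by apply: le_lt_trans (rad_lt1 p_pr h1); rewrite ler_piMr ?rad_ge0.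
- by move=> a h k z w; rewrite /chart_Z exprD; ring.
- move=> a b h au bu h1.
  have le1 (t : K) : Zp_units t -> pabs t <= 1 by move=> ->.
  apply: (iff_trans (residue_classP h (le1 a au) (le1 b bu))); split=> [H|[z Hz ->]].
    exists (fun=> (b - a) / p%:R ^+ h).
      by move=> _; rewrite pabsM pabsV pabs_pX ler_pdivrMr ?rad_gt0 // mul1r.
    by rewrite /chart_Z mulrC divfK ?pX_neq0 // addrC subrK.
  by rewrite /chart_Z addrAC subrr add0r pabsM pabs_pX ler_piMr ?rad_ge0.
- move=> a h z i; rewrite /chart_Z addrAC subrr add0r mulrC mulKf ?pX_neq0 //.
  by case: i.
- by [].
- move=> u Hu; have le1 (t : K) : Zp_units t -> pabs t <= 1 by move=> ->.
  have [h h1|a Ha] := @rad_limit 1 u.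
    have [u1 E] := Hu h h1; have [u2 _] := Hu h.+1 isT.
    by apply/(residue_classP h (le1 _ u1) (le1 _ u2)).
  have au : Zp_units a.
    apply: (pabs_unit_near (Hu 1%N isT).1); apply: le_lt_trans (Ha 1%N isT) _.
    exact: rad1_lt1.
  exists a => // h h1; apply/(residue_classP h); first exact/le1/(Hu h h1).1.
    exact: le1.
  exact: Ha.
Defined.

Section Unipotent.
Variable m : nat.
Local Notation d := (m.+1 + m.+1)%N.

Local Notation NX := ('M[K]_d).
Let cN (h : nat) (x : NX) : 'M['I_(p ^ h).+1]_d := map_mx (residue_class h) x.

Let coN (a : NX) (h : nat) (x : NX) (ij : 'I_d * 'I_d) : K :=
  (x ij.1 ij.2 - a ij.1 ij.2) / p%:R ^+ h.

Lemma cNP h (a b : NX) : upper_Zp a -> upper_Zp b ->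
  cN h a = cN h b <-> forall i j, pabs (b i j - a i j) <= rad h.
Proof.
move=> [_ _ a3] [_ _ b3]; split=> [/matrixP E i j|H].
  by have := E i j; rewrite !mxE => /(residue_classP h (a3 i j) (b3 i j)).
apply/matrixP => i j; rewrite !mxE; exact/(residue_classP h).
Qed.

Lemma chart_NE (a : NX) h z i j :
  chart_N a h z i j = a i j + p%:R ^+ h * (if (i < j)%N then z (i, j) else 0).
Proof. by rewrite !mxE. Qed.

(** The polydisc has a coordinate for every matrix entry, as in [chart_N]; the mask singles out
    those above the diagonal. *)
Definition unipotent_space : chart_space K.
Proof.
apply: (@ChartSpace R p K NX ('I_d * 'I_d)%type (@upper_Zp R p K d) 0 (@chart_N R p K m)
  coN
  (fun ij => (ij.1 < ij.2)%N) (fun h => 'M['I_(p ^ h).+1]_d : finType) cN).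
- by move=> a h; apply/matrixP => i j; rewrite chart_NE if_same mulr0 addr0.
- move=> a h z [a1 a2 a3] _ Hz; split=> [i|i j ij|i j]; rewrite chart_NE.
  + by rewrite ltnn mulr0 addr0.
  + by rewrite a2 // ltnNge (ltnW ij) /= mulr0 addr0.
  + apply: pabsDC => //; apply: pabsM_le1; first by rewrite pabs_pX // rad_le1.
    by case: ifP => _; rewrite ?pabs0.
- move=> a h k z w; apply/matrixP => i j; rewrite !chart_NE.
  by case: ifP => _; rewrite ?exprD; ring.
- move=> a b h aS bS _; apply: (iff_trans (cNP h aS bS)).
  have [a1 a2 a3] := aS; have [b1 b2 b3] := bS; split=> [H|[z Hz ->] i j].
    exists (fun ij => (b ij.1 ij.2 - a ij.1 ij.2) / p%:R ^+ h).
      by move=> ij; rewrite pabsM pabsV pabs_pX // ler_pdivrMr ?rad_gt0 // mul1r.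
    apply/matrixP => i j; rewrite chart_NE /=; case: ltngtP => ij.
    * by rewrite mulrC divfK ?pX_neq0 // addrC subrK.
    * by rewrite mulr0 addr0 a2 // b2.
    * by rewrite mulr0 addr0 (val_inj ij) a1 b1.
  rewrite chart_NE addrAC subrr add0r; apply: pabs_le1M; first by rewrite pabs_pX.
  by case: ifP => _; rewrite ?pabs0.
- move=> a h z [i j]; rewrite /coN chart_NE /= addrAC subrr add0r mulrC mulKf ?pX_neq0 //.
- move=> a h z; apply/matrixP => i j; rewrite !chart_NE /=.
  by case: (i < j)%N.
- move=> u Hu.
  have /choice[a Ha] : forall ij : 'I_d * 'I_d, exists a, forall h, (0 <= h)%N ->
      pabs (a - u h ij.1 ij.2) <= rad h.
    move=> ij; apply: rad_limit => h _; have [u1 E] := Hu h isT.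
    by have [u2 _] := Hu h.+1 isT; have := (cNP h u1 u2).1 E ij.1 ij.2.
  have aS : upper_Zp (\matrix_(i, j) a (i, j) : NX).
    split=> [i|i j ij|i j]; rewrite mxE.
    * apply/eqP; rewrite -subr_eq0; apply/eqP/(@rad_eq0 0) => h h0.
      by have [[h1 _ _] _] := Hu h isT; have := Ha (i, i) h h0; rewrite /= h1.
    * apply: (@rad_eq0 0) => h h0.
      by have [[_ h1 _] _] := Hu h isT; have := Ha (i, j) h h0; rewrite /= h1 // subr0.
    * have [[_ _ h1] _] := Hu 0%N isT; rewrite -(subrK (u 0%N i j) (a (i, j))).
      by apply: pabsDC => //; have := Ha (i, j) 0%N isT; rewrite rad0.
  exists (\matrix_(i, j) a (i, j)) => // h _; apply/(cNP h (Hu h isT).1 aS) => i j.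
  by rewrite mxE; exact: (Ha (i, j) h isT).
Defined.

End Unipotent.
End Spaces.

(** * Extension from the unipotent group *)

Section Extension.
Context {R : realType} {p : nat} {K : padicField R p} {L : padicExt K} {m : nat}.
Hypothesis p_pr : prime p.
Local Notation "'rad' h" := ((p%:R : R) ^- h) (at level 10).
Local Notation d := (m.+1 + m.+1)%N.
Local Notation Mat := ('M[K]_d).
Local Notation NX := (unipotent_space (K := K) p_pr m).

Lemma analytic_prod_ex (B : banach K) (I : finType) (J : Type) (r : seq J)
    (F : J -> (I -> K) -> B) :
  (forall j, exists M, analytic (F j) M) ->
  exists M, analytic (fun z => \prod_(j <- r) F j z) M.
Proof.
move=> H; elim: r => [|j r [M HM]].
  exists (bnorm (1 : B)); apply: (@analytic_eq _ _ _ _ _ (fun=> 1)); last exact: analytic_cst.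
  by move=> z _; rewrite big_nil.
have [M' HM'] := H j; exists (M' * M); apply: analytic_eq (analyticM HM' HM) => z _.
by rewrite big_cons.
Qed.

Lemma near_cst_prod (I : finType) (dl : R) (J : Type) (r : seq J)
    (F : J -> (I -> K) -> K) : 0 <= dl -> dl < 1 ->
  (forall j, near_cst dl (F j)) -> near_cst dl (fun z => \prod_(j <- r) F j z).
Proof.
move=> d0 d1 H; elim: r => [|j r IH].
  apply: (@near_cst_eq _ _ _ _ _ (fun=> 1)); last by apply: near_cst_cst; rewrite ?pabs1.
  by move=> z _; rewrite big_nil.
by apply: near_cst_eq (near_cstM d1 (H j) IH) => z _; rewrite big_cons.
Qed.

Lemma near_cst_det (I : finType) (dl : R) d (G : (I -> K) -> 'M[K]_d) :
  0 <= dl -> dl < 1 -> (forall i j, near_cst dl (fun z => G z i j)) ->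
  near_cst dl (fun z => \det (G z)).
Proof.
move=> d0 d1 H; apply: near_cst_sum => // s _; apply: near_cstM => //.
  by apply: near_cst_cst; rewrite // pabsX pabsN1 expr1n.
exact: near_cst_prod.
Qed.

Lemma near_cst_osc (I : finType) (dl : R) (g : (I -> K) -> K) z w :
  near_cst dl g -> in_ball z -> in_ball w -> pabs (g z - g w) <= dl.
Proof.
move=> [a _ H] Hz Hw; rewrite (_ : g z - g w = (g z - a) + - (g w - a)); last by ring.
by apply: pabsDC; rewrite ?pabsN; exact: (analytic_bound H).
Qed.

Lemma in_ball0 (I : Type) : in_ball (fun _ : I => 0 : K).
Proof. by move=> i; rewrite pabs0. Qed.

Lemma near_cst_center (I : finType) (dl : R) (g : (I -> K) -> K) :
  near_cst dl g -> analyticK (fun z => g z - g (fun=> 0)) dl.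
Proof.
move=> [a _ H]; have b0 := analytic_bound H (@in_ball0 I).
have := analyticB H (analytic_base_cst I b0).
by apply: analytic_eq => z _ /=; ring.
Qed.

Lemma chart_Iw_near (a : Mat) k i j : Iw a ->
  near_cst (rad k) (fun z => chart_Iw a k z i j).
Proof.
move=> Ha; exists (a i j); first exact: Ha.1.1.
have pk : pabs (p%:R ^+ k : K) <= rad k by rewrite pabs_pX.
have := analyticM (analytic_base_cst _ pk) (analytic_coord (K := K) (i, j)).
rewrite mulr1; apply: analytic_eq => z _; rewrite !mxE; ring.
Qed.

Lemma chart_Iw_in (a : Mat) k z : (0 < k)%N -> Iw a -> in_ball z -> Iw (chart_Iw a k z).
Proof.
move=> k0 Ha Hz; have [[a1 a2] a3] := Ha; split; [split|].
- move=> i j; have := near_cst_analytic (rad_lt1 p_pr k0) (chart_Iw_near k i j Ha).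
  by move=> /analytic_in_ball; apply.
- have dn := near_cst_det (rad_ge0 p_pr k) (rad_lt1 p_pr k0)
    (fun i j => chart_Iw_near k i j Ha).
  have := near_cst_osc dn Hz (@in_ball0 _).
  have -> : chart_Iw a k (fun=> 0) = a.
    by apply/matrixP => i j; rewrite !mxE mulr0 addr0.
  by move=> /le_lt_trans/(_ (rad_lt1 p_pr k0)); exact: pabs_unit_near.
- move=> i j ij; rewrite !mxE; apply: pabsDC; first exact: a3.
  apply: pabs_le1M; last exact: Hz.
  by rewrite pabs_pX //; have := @rad_le R p p_pr _ _ k0; rewrite expr1.
Qed.

Lemma ext0E (T : Type) (V : nmodType) (S : set T) (f : T -> V) x : S x -> ext0 S f x = f x.
Proof. by move=> Sx; rewrite /ext0 patchT // inE. Qed.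

Lemma ext0N (T : Type) (V : nmodType) (S : set T) (f : T -> V) x : ~ S x -> ext0 S f x = 0.
Proof. by move=> Sx; rewrite /ext0 patchN // notin_setE. Qed.

Lemma ext0_supported (T : Type) (V : nmodType) (S : set T) (f : T -> V) :
  supported S (ext0 S f).
Proof. by move=> x; exact: ext0N. Qed.

Lemma N_beta_chart (a : Mat) h z : (0 < h)%N -> upper_Zp a -> in_ball z ->
  N_beta 1 (chart_N a h z) <-> N_beta 1 a.
Proof.
move=> h0 aS Hz.
have small i j : pabs (chart_N a h z i j - a i j) <= rad 1.
  rewrite chart_NE addrAC subrr add0r; apply: pabs_le1M.
    by rewrite pabs_pX // rad_le.
  by case: ifP => _; rewrite ?pabs0.
have cS : upper_Zp (chart_N a h z) by exact: (@ch_dom _ _ _ NX).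
split=> -[_ H]; split=> // i j.
  rewrite (_ : _ - _ = (chart_N a h z i j - @u_mx R p K m i j) + - (chart_N a h z i j - a i j)); last by ring.
  by apply: pabsDC; rewrite ?pabsN.
rewrite (_ : _ - _ = (chart_N a h z i j - a i j) + (a i j - @u_mx R p K m i j)); last by ring.
exact: pabsDC.
Qed.

(** From level 1 on, every ball lies inside [N_beta 1] or is disjoint from it. *)
Lemma loc_analytic_beta (B : banach K) (f : Mat -> B) :
  loc_analytic (X := NX) f -> loc_analytic (X := NX) (ext0 (N_beta 1) f).
Proof.
move=> [fs fl]; split=> [x xS|a aS].
  by rewrite ext0N // => -[].
have [h [M H]] := fl a aS.
have H' := chart_refine0 p_pr (leq_maxr 1 h) H.
have h0 : (0 < maxn 1 h)%N by exact: leq_maxl.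
exists (maxn 1 h), M; have [ha|ha] := pselect (N_beta 1 a).
  by apply: analytic_eq H' => z Hz; rewrite ext0E //; apply/N_beta_chart.
apply: analytic_eq (@analytic0 R p K B (crd NX) M (analytic_ge0 H)) => z Hz; rewrite ext0N //.
by move/N_beta_chart => h'; apply: ha; exact: h'.
Qed.

Section OneChar.
Context {A : normedAlg L} (HA : is_banach A).
Variable chi : char_tuple (K := K) m A.
Hypothesis chi_cont : forall i, continuous_char (A := banach_of HA) (chi i).

(** Extension by equivariance; [xget] picks the unique Iwahori decomposition. *)
Definition extend (f : Mat -> A) : Mat -> A := ext0 (@Iw R p K d) (fun g =>
  let sx := xget (0, 0) [set sx : 'rV[K]_d * Mat | exists nb,
     [/\ lower_Zp 1 nb, torus_Zp sx.1, upper_Zp sx.2 & g = nb *m diag_mx sx.1 *m sx.2]] in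
  \prod_i chi i (sx.1 0 i) * f sx.2).

Lemma lower0 b (nb : Mat) : lower_Zp b nb -> lower_Zp 0 nb.
Proof. by move=> [h1 h2 h3]; split=> // i j /h3 h; apply: le_trans h _; rewrite rad_le. Qed.

Lemma extendE f (nb x : Mat) s : lower_Zp 1 nb -> torus_Zp s -> upper_Zp x ->
  extend f (nb *m diag_mx s *m x) = \prod_i chi i (s 0 i) * f x.
Proof.
move=> h1 h2 h3; rewrite /extend ext0E; last exact: Iw_decomposed.
case: xgetP => [[s' x'] _ [nb' [/= k1 k2 k3 k4]]|H].
  by have [_ -> ->] := decomposition_unique (lower0 h1) (lower0 k1) h2 k2 h3 k3 k4.
by case: (H (s, x)); exists nb.
Qed.

Lemma lower1 : lower_Zp 1 (1%:M : Mat).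
Proof.
split=> [i|i j ij|i j ij]; rewrite mxE ?eqxx //.
  by rewrite -val_eqE ltn_eqF.
by rewrite -val_eqE gtn_eqF //= pabs0 rad_ge0.
Qed.

Lemma torus1 : torus_Zp (const_mx 1 : 'rV[K]_d).
Proof. by move=> i; rewrite mxE; exact: pabs1. Qed.

Lemma extend_upper f x : upper_Zp x -> extend f x = f x.
Proof.
move=> hx; have := extendE f lower1 torus1 hx.
rewrite diag_const_mx mul1mx mul1mx => ->; rewrite big1 ?mul1r // => i _.
by rewrite mxE; have [] := chi_cont i.
Qed.

Lemma extend_notin f g : ~ Iw g -> extend f g = 0.
Proof. exact: ext0N. Qed.

Lemma eq_extend (F G : Mat -> A) : supported (@Iw R p K d) F ->
  supported (@Iw R p K d) G ->
  (forall nb s x, lower_Zp 1 nb -> torus_Zp s -> upper_Zp x ->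
     F (nb *m diag_mx s *m x) = G (nb *m diag_mx s *m x)) -> F = G.
Proof.
move=> sF sG H; apply/funext => g; have [Hg|Hg] := pselect (Iw g).
  by have [nb [s [x [h1 h2 h3 ->]]]] := iwahori_decomposition p_pr Hg; exact: H.
by rewrite sF // sG.
Qed.

Lemma extend_equivariant f nb s g : lower_Zp 1 nb -> torus_Zp s -> Iw g ->
  extend f (nb *m diag_mx s *m g) = \prod_i chi i (s 0 i) * extend f g.
Proof.
move=> h1 h2 /(iwahori_decomposition p_pr)[nb' [s' [x [k1 k2 k3 ->]]]].
have [A' l3 E] := lower_conj k1 h2.
have -> : nb *m diag_mx s *m (nb' *m diag_mx s' *m x) =
    (nb *m A') *m diag_mx (\row_j (s 0 j * s' 0 j)) *m x.
  by rewrite -mulmx_diag !mulmxA -[nb *m diag_mx s *m nb']mulmxA E !mulmxA.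
have h3 : torus_Zp (\row_j (s 0 j * s' 0 j)).
  move=> i; rewrite mxE /Zp_units /= pabsM (h2 i : pabs _ = 1).
  by rewrite (k2 i : pabs _ = 1) mulr1.
rewrite !extendE //; last exact: lower_mul.
rewrite mulrA -big_split /=; congr (_ * _); apply: eq_bigr => i _.
by rewrite mxE; have [_ -> //] := chi_cont i.
Qed.

(** On the ball of level k around a, the torus part and the unipotent part vary by at most p^-k in
    Gauss norm. The level k is large enough for each torus entry to stay where its character has an
    expansion and for the unipotent part to stay in one ball where f is a power series. *)
Lemma extend_A f : loc_analytic (X := NX) (A := banach_of HA) f -> A_ chi (extend f).
Proof.
move=> [fs fl]; split; [exact: ext0_supported | | exact: extend_equivariant].
move=> a Ha; have [nb0 [s0 [x0 [n1 n2 n3 aE]]]] := iwahori_decomposition p_pr Ha.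
have [h1 [M1 H1]] := fl x0 n3.
have /choice[dc Hdc] : forall i : 'I_d, exists dl : R, 0 < dl < 1 /\
  forall (J : finType) (g : (J -> K) -> K) (a : K), Zp_units a ->
    analyticK (fun z => g z - a) dl ->
    analytic (A := banach_of HA) (fun z => chi i (g z)) (nrm (chi i a) * nrm (1 : A)).
  by move=> i; have [dl h H] := char_near_cst p_pr (chi_cont i); exists dl.
have [k [k0 kh1 kd]] : exists k, [/\ (0 < k)%N, (h1 <= k)%N & forall i, rad k <= dc i].
  have /choice[ki Hki] : forall i : 'I_d, exists h, rad h <= dc i.
    move=> i; have [/andP[dp _] _] := Hdc i; have [h] := rad_small p_pr 1 dp.
    by rewrite mul1r; exists h.
  exists (maxn 1 (maxn h1 (\max_i ki i))); split; first exact: leq_maxl.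
    by rewrite !leq_max leqnn !orbT.
  move=> i; apply: le_trans (Hki i); apply: rad_le => //.
  by rewrite !leq_max (leq_bigmax i) !orbT.
have r1 := @rad_lt1 R p p_pr k k0; have r0 := @rad_ge0 R p p_pr k.
have [nb [s [x [H2 Hs Hx]]]] := @iwahori_family _ _ _ p_pr
  ('I_d * 'I_d)%type (rad k) r0 r1 d (chart_Iw a k)
  (fun i j => chart_Iw_near k i j Ha) (fun z => @chart_Iw_in a k z k0 Ha).
have z0 := @in_ball0 (('I_d * 'I_d)%type).
have [k1 k2 k3 k4] := H2 _ z0.
have a0E : chart_Iw a k (fun=> 0) = a by apply/matrixP => i j; rewrite !mxE mulr0 addr0.
rewrite a0E aE in k4.
(* The family takes the value [x0] at the centre: the decomposition found there must be the one
   chosen for a. *)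
have [_ _ x0E] := decomposition_unique (lower0 n1) (lower0 k1) n2 k2 n3 k3 k4.
pose y (ij : 'I_d * 'I_d) z : K := (x z ij.1 ij.2 - x0 ij.1 ij.2) * (p%:R ^+ h1)^-1.
have Hy ij : analyticK (y ij) 1.
  have pv : pabs (p%:R ^+ h1 : K)^-1 <= (rad h1)^-1 by rewrite pabsV pabs_pX.
  have := analyticM (near_cst_center (Hx ij.1 ij.2)) (analytic_base_cst _ pv).
  rewrite -x0E; apply: analytic_le.
  by rewrite ler_pdivrMr ?rad_gt0 // mul1r rad_le.
have xE z : in_ball z -> x z = chart_N x0 h1 (fun ij => y ij z).
  move=> Hz; have [_ _ [u1 u2 _] _] := H2 z Hz; have [v1 v2 _] := n3.
  apply/matrixP => i j; rewrite chart_NE /y /=; case: ltngtP => ij.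
  - by rewrite mulrC divfK ?pX_neq0 // addrC subrK.
  - by rewrite mulr0 addr0 u2 // v2.
  - by rewrite mulr0 addr0 (val_inj ij) u1 v1.
have Hf := analytic_comp Hy H1.
have [M2 HM2] := @analytic_prod_ex (banach_of HA) _ _ (index_enum 'I_d) (fun i z => chi i (s z 0 i))
  (fun i => ex_intro _ _ ((Hdc i).2 _ _ _ (k2 i)
     (analytic_le (kd i) (near_cst_center (Hs i))))).
exists k, (M2 * M1).
rewrite (@analytic_chartE _ _ _ _ _ HA).
apply: analytic_eq (analyticM HM2 Hf) => z Hz; have [l1 l2 l3 l4] := H2 z Hz.
by rewrite [RHS]/= l4 extendE // xE.
Qed.

Lemma A_restrict F : A_ chi F ->
  loc_analytic (X := NX) (A := banach_of HA) (ext0 (@upper_Zp R p K d) F).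
Proof.
move=> [sF lF _]; split; first exact: ext0_supported.
move=> a aS; have [h [M]] := lF a (upper_Iw aS).
rewrite (@analytic_chartE _ _ _ _ _ HA) => H; exists h, M.
(* Putting 0 for the coordinates on and below the diagonal turns [chart_Iw] into [chart_N]. *)
have mk (ij : 'I_d * 'I_d) : analyticK (fun z : 'I_d * 'I_d -> K => if (ij.1 < ij.2)%N then z ij else 0) 1.
  case: (ij.1 < ij.2)%N; first exact: analytic_coord.
  by apply: analytic_base_cst; rewrite pabs0.
apply: analytic_eq (analytic_comp mk H) => z Hz.
rewrite ext0E; last exact: (@ch_dom _ _ _ NX).
by congr F; apply/matrixP => i j; rewrite !mxE.
Qed.

Lemma A_extend F : A_ chi F -> F = extend (ext0 (@upper_Zp R p K d) F).
Proof.
move=> [sF _ eF]; apply: eq_extend => //; first exact: ext0_supported.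
move=> nb s x h1 h2 h3; rewrite extendE // eF //; last exact: upper_Iw.
by rewrite ext0E.
Qed.

Lemma A_eq F G : A_ chi F -> A_ chi G ->
  (forall x, upper_Zp x -> F x = G x) -> F = G.
Proof.
move=> hF hG E; rewrite (A_extend hF) (A_extend hG); congr extend.
apply/funext => x; have [hx|hx] := pselect (upper_Zp x); first by rewrite !ext0E // E.
by rewrite !ext0N.
Qed.

Lemma extend_lin (a : A) f g :
  extend (fun x => a * f x + g x) = fun x => a * extend f x + extend g x.
Proof.
apply/funext => x; rewrite /extend; have [hx|hx] := pselect (Iw x).
  by rewrite !ext0E //; ring.
by rewrite !ext0N // mulr0 addr0.
Qed.

Lemma A_lin (a : A) F G : A_ chi F -> A_ chi G -> A_ chi (fun x => a * F x + G x).
Proof.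
move=> hF hG; rewrite (A_extend hF) (A_extend hG) -extend_lin.
by apply: extend_A; apply: (loc_analytic_lin p_pr); exact: A_restrict.
Qed.

Lemma Iw_beta_decomposed (nb x : Mat) s : lower_Zp 1 nb -> torus_Zp s -> upper_Zp x ->
  Iw_beta 1 (nb *m diag_mx s *m x) <-> N_beta 1 x.
Proof.
move=> h1 h2 h3; split=> [[nb' [s' [x' [k1 k2 k3 E]]]]|hx]; last by exists nb, s, x.
by have [_ _ ->] := decomposition_unique (lower0 h1) (lower0 k1) h2 k2 h3 k3.1 E.
Qed.

Lemma extend_beta f : ext0 (Iw_beta 1) (extend f) = extend (ext0 (N_beta 1) f).
Proof.
apply: eq_extend => [g hg| |nb s x h1 h2 h3].
- have [hb|hb] := pselect (Iw_beta 1 g); last by rewrite ext0N.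
  by rewrite ext0E // extend_notin.
- exact: ext0_supported.
- have [hb|hb] := pselect (N_beta 1 x).
    rewrite ext0E; last exact/(Iw_beta_decomposed h1 h2 h3).
    by rewrite !extendE // ext0E.
  rewrite ext0N; last by move/(Iw_beta_decomposed h1 h2 h3).
  by rewrite extendE // ext0N // mulr0.
Qed.

Lemma A_beta F : A_ chi F -> A_ chi (ext0 (Iw_beta 1) F).
Proof.
move=> hF; rewrite (A_extend hF) extend_beta; apply: extend_A.
exact: loc_analytic_beta (A_restrict hF).
Qed.

End OneChar.
End Extension.

(** * Specialisation of distributions *)

Section Specialise.
Context {R : realType} {p : nat} {K : padicField R p} {L : padicExt K} {m : nat}.
Hypothesis p_pr : prime p.
Context {O : normedAlg L} (HO : is_banach O).
Variable chi : char_tuple (K := K) m O.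
Hypothesis chi_cont : forall i, continuous_char (A := banach_of HO) (chi i).
Variable ev : {lrmorphism O -> base_alg L}.
Local Notation BO := (banach_of HO).
Local Notation BL := (banach_of (base_alg_banach L)).
Local Notation NX := (unipotent_space (K := K) p_pr m).
Local Notation ZX := (units_space (K := K) p_pr).
Local Notation chi' := (pull ev chi).
Local Notation d := (m.+1 + m.+1)%N.
Local Notation Mat := ('M[K]_d).

Lemma ev_bounded : bounded_map (A := BO) (B := BL) 1 ev.
Proof.
split=> [a b|x a|a]; first exact: rmorphB.
  rewrite -[bemb BO x]/((x%:A : L)%:A) -[bemb BL x]/((x%:A : L)%:A : base_alg L).
  by rewrite !mulr_algl linearZ.
by rewrite mul1r; exact: point_norm.
Qed.

Definition const_alg (l : base_alg L) : O := (l : L)%:A.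

Lemma const_alg_bounded : bounded_map (A := BL) (B := BO) (nrm (1 : O)) const_alg.
Proof.
split=> [a b|x a|a]; first by rewrite /const_alg scalerBl.
  rewrite -[bemb BO x]/((x%:A : L)%:A) -[bemb BL x]/((x%:A : L)%:A : base_alg L).
  by rewrite !mulr_algl /const_alg scalerA.
by rewrite /= /const_alg; have [[_ _ -> _ _] _] := HO; rewrite mulrC.
Qed.

Lemma ev_const : cancel const_alg ev.
Proof. by move=> l; rewrite /const_alg linearZ rmorph1; exact: mulr1. Qed.

Lemma pull_cont i : continuous_char (A := BL) (chi' i).
Proof.
have [h1 h2 h3] := chi_cont i; split.
- by rewrite /pull h1 rmorph1.
- by move=> s t hs ht; rewrite /pull h2 // rmorphM.
- move=> t e ht e0; have [dl dl0 H] := h3 t e ht e0; exists dl => // s hs st.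
  rewrite /pull; have [<- _ bd] := ev_bounded.
  by apply: le_lt_trans (bd _) _; rewrite mul1r; exact: H.
Qed.

Lemma ev_extend (f : Mat -> O) : ev \o extend chi f = extend chi' (ev \o f).
Proof.
apply/funext => g; rewrite /= /extend; have [hg|hg] := pselect (Iw g).
  by rewrite !ext0E // rmorphM rmorph_prod.
by rewrite !ext0N // rmorph0.
Qed.

(** Continuity in [D_] is measured in charts of N(Z_p); composed with [extend], a distribution
    becomes a functional to which [kernel_functional] applies. *)
Lemma D_la (mu : (Mat -> O) -> O) : D_ chi mu ->
  la_linear (X := NX) (A := BO) (fun f => mu (extend chi f)) /\
  la_bounded (X := NX) (A := BO) (fun f => mu (extend chi f)).
Proof.
move=> [_ lin bd]; split.
  move=> a f g hf hg; rewrite extend_lin.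
  by apply: lin; apply: (extend_A (p_pr := p_pr) chi_cont).
move=> h; have [C HC] := bd h; exists C => f M hf fU.
apply: HC; first exact: extend_A.
move=> a aS; rewrite (@analytic_chartE _ _ _ _ _ HO).
apply: analytic_eq (fU a aS) => z Hz; rewrite /= (extend_upper p_pr chi_cont) //.
exact: (@ch_dom _ _ _ NX).
Qed.

Lemma D_kernel (mu : (Mat -> O) -> O) F : D_ chi mu -> A_ chi F ->
  (forall x, ev (F x) = 0) -> ev (mu F) = 0.
Proof.
move=> /D_la[lin bd] hF F0; rewrite (A_extend p_pr hF).
apply: (kernel_functional p_pr ev_bounded const_alg_bounded (rmorphM ev) ev_const lin bd).
  exact: (A_restrict p_pr HO hF).
move=> x; have [hx|hx] := pselect (upper_Zp x); first by rewrite ext0E.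
by rewrite ext0N // rmorph0.
Qed.

Lemma D_Zp_kernel (mu : (K -> O) -> O) F : D_Zp (A := O) mu -> A_Zp F ->
  (forall x, ev (F x) = 0) -> ev (mu F) = 0.
Proof.
move=> [_ lin bd] hF F0.
exact: (kernel_functional (X := ZX) p_pr ev_bounded const_alg_bounded (rmorphM ev) ev_const
  lin bd hF F0).
Qed.

(** The lift picked by [xget] is immaterial: two lifts differ by a function with values in the
    kernel of [ev]. *)
Lemma specialiseE (X : Type) (S : set (X -> O)) (S' : set (X -> base_alg L)) mu F :
  (forall F G, S F -> S G -> S (fun x => (-1) * F x + G x)) ->
  linear_on S mu -> (forall F, S F -> (forall x, ev (F x) = 0) -> ev (mu F) = 0) ->
  S F -> S' (ev \o F) -> specialise ev S S' mu (ev \o F) = ev (mu F).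
Proof.
move=> SB lin ker SF SF'; rewrite /specialise ext0E //.
case: xgetP => [G _ [SG E]|H]; last by case: (H F).
apply/eqP; rewrite -subr_eq0 -rmorphB; apply/eqP.
have -> : mu G - mu F = mu (fun x => (-1) * F x + G x) by rewrite lin //; ring.
apply: ker => [|x]; first exact: SB.
rewrite rmorphD rmorphM rmorphN1 mulN1r.
by have := congr1 (fun f => f x) E; rewrite /= => ->; rewrite addrC subrr.
Qed.

Lemma A_linO (a : O) F G : A_ chi F -> A_ chi G -> A_ chi (fun x => a * F x + G x).
Proof. exact: (A_lin p_pr chi_cont). Qed.

Lemma la_const (f : Mat -> base_alg L) :
  loc_analytic (X := NX) (A := BL) f -> loc_analytic (X := NX) (A := BO) (const_alg \o f).
Proof.
move=> [fs fl]; split=> [x xS|a aS]; first by rewrite /= fs // /const_alg scale0r.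
have [h [M H]] := fl a aS; exists h, (nrm (1 : O) * M).
exact: analytic_map const_alg_bounded H.
Qed.

(** Composing f with the constants would keep the equivariance under the specialised character.
    Hence only the restriction to N(Z_p) is lifted by constants, and [chi] governs the extension. *)
Definition lift_A (f : Mat -> base_alg L) : Mat -> O :=
  extend chi (const_alg \o ext0 (@upper_Zp R p K d) f).

Lemma lift_A_in f : A_ chi' f -> A_ chi (lift_A f).
Proof.
move=> hf; apply: (extend_A (p_pr := p_pr) chi_cont); apply: la_const.
exact: (A_restrict p_pr (base_alg_banach L) hf).
Qed.

Lemma ev_lift_A f : A_ chi' f -> ev \o lift_A f = f.
Proof.
move=> hf; rewrite ev_extend [RHS](A_extend p_pr hf); congr extend.
by apply/funext => x; rewrite /= ev_const.
Qed.

Lemma spE (mu : (Mat -> O) -> O) F : D_ chi mu -> A_ chi F -> A_ chi' (ev \o F) ->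
  specialise ev (A_ chi) (A_ chi') mu (ev \o F) = ev (mu F).
Proof.
move=> hmu; apply: specialiseE; first by move=> *; exact: A_linO.
  by case: hmu.
by move=> G; exact: D_kernel.
Qed.

Lemma A_linL (a : base_alg L) F G : A_ chi' F -> A_ chi' G ->
  A_ chi' (fun x => a * F x + G x).
Proof. exact: (A_lin p_pr (HA := base_alg_banach L) pull_cont). Qed.

Lemma sp_D_beta (mu : (Mat -> O) -> O) : D_beta 1 chi mu ->
  D_beta 1 chi' (specialise ev (A_ chi) (A_ chi') mu).
Proof.
move=> [hmu beta]; have [_ lin bd] := hmu.
have spl f : A_ chi' f -> specialise ev (A_ chi) (A_ chi') mu f = ev (mu (lift_A f)).
  by move=> hf; rewrite -{1}(ev_lift_A hf) spE // ?ev_lift_A //; exact: lift_A_in.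
split; first split.
- exact: ext0_supported.
- move=> a f g hf hg; have hL := A_linL a hf hg.
  have hF := lift_A_in hf; have hG := lift_A_in hg.
  have E : ev \o (fun x => const_alg a * lift_A f x + lift_A g x) = fun x => a * f x + g x.
    apply/funext => x; rewrite -{2}(ev_lift_A hf) -{2}(ev_lift_A hg) /=.
    by rewrite rmorphD rmorphM /= ev_const.
  rewrite -E spE //; [|exact: A_linO | by rewrite E].
  by rewrite lin // rmorphD rmorphM /= ev_const -!spl.
(* Lifting by constants multiplies norms by that of 1, and evaluation does not increase them. *)
- move=> h; have [C HC] := bd h; exists (C * nrm (1 : O)) => f M hf fU.
  rewrite spl //; apply: le_trans (point_norm HO ev _) _; rewrite -mulrA.
  apply: HC; first exact: lift_A_in.
  move=> a aS; have := fU a aS; rewrite (@analytic_chartE _ _ _ _ _ HO).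
  rewrite (@analytic_chartE _ _ _ _ _ (base_alg_banach L)) => /(analytic_map const_alg_bounded).
  apply: analytic_eq => z Hz.
  have hc : upper_Zp (chart_N a h z) by exact: (@ch_dom _ _ _ NX).
  by rewrite /= /lift_A (extend_upper p_pr chi_cont) //= ext0E.
- move=> f hf; have hF := lift_A_in hf.
  have hb : A_ chi' (ext0 (Iw_beta 1) f).
    exact: (A_beta p_pr (HA := base_alg_banach L) pull_cont hf).
  (* The truncated lift of f is a lift of the truncated f, so the support condition on [mu] passes
     to its specialisation. *)
  have E : ev \o ext0 (Iw_beta 1) (lift_A f) = ext0 (Iw_beta 1) f.
    apply/funext => x /=; have [hx|hx] := pselect (Iw_beta 1 x).
      by rewrite !ext0E // -{2}(ev_lift_A hf).
    by rewrite !ext0N // rmorph0.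
  rewrite -E spE // ?E //; first by rewrite -beta // -spl.
  exact: (A_beta p_pr chi_cont).
Qed.

Lemma A_Zp_lin (B : normedAlg L) (HB : is_banach B) (a : B) (F G : K -> B) :
  A_Zp F -> A_Zp G -> A_Zp (fun x => a * F x + G x).
Proof. exact: (loc_analytic_lin (X := ZX) (A := banach_of HB) p_pr). Qed.

Lemma A_Zp_const (f : K -> base_alg L) : A_Zp f -> A_Zp (const_alg \o f).
Proof.
move=> [fs fl]; split=> [x xS|a aS]; first by rewrite /= fs // /const_alg scale0r.
have [h [M H]] := fl a aS; exists h, (nrm (1 : O) * M).
rewrite (@analytic_chartE _ _ _ _ _ HO); exact: (analytic_map const_alg_bounded H).
Qed.

Lemma ev_const_fun (T : Type) (f : T -> base_alg L) : ev \o (const_alg \o f) = f.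
Proof. by apply/funext => x /=; exact: ev_const. Qed.

Lemma sp_ZpE (mu : (K -> O) -> O) (f : K -> base_alg L) : D_Zp (A := O) mu -> A_Zp f ->
  specialise ev (A_Zp (A := O)) (A_Zp (A := base_alg L)) mu f = ev (mu (const_alg \o f)).
Proof.
move=> hmu hf; rewrite -{1}(ev_const_fun f); apply: specialiseE.
- by move=> F G; exact: A_Zp_lin.
- by case: hmu.
- by move=> G; exact: D_Zp_kernel.
- exact: A_Zp_const.
- by rewrite ev_const_fun.
Qed.

Lemma sp_Zp_D (mu : (K -> O) -> O) : D_Zp (A := O) mu ->
  D_Zp (A := base_alg L) (specialise ev (A_Zp (A := O)) (A_Zp (A := base_alg L)) mu).
Proof.
move=> hmu; have [_ lin bd] := hmu; split; first exact: ext0_supported.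
- move=> a f g hf hg; rewrite !sp_ZpE //; last exact: (A_Zp_lin (base_alg_banach L)).
  have -> : const_alg \o (fun x => a * f x + g x) =
      fun x => const_alg a * (const_alg \o f) x + (const_alg \o g) x.
    by apply/funext => x /=; rewrite /const_alg scalerDl mulr_algl scalerA.
  rewrite lin; [|exact: A_Zp_const|exact: A_Zp_const].
  by rewrite rmorphD rmorphM /= ev_const.
- move=> h; have [C HC] := bd h; exists (C * nrm (1 : O)) => f M hf fU.
  rewrite sp_ZpE //; apply: le_trans (point_norm HO ev _) _; rewrite -mulrA.
  apply: HC; first exact: A_Zp_const.
  move=> a aS; have := fU a aS; rewrite (@analytic_chartE _ _ _ _ _ HO).
  rewrite (@analytic_chartE _ _ _ _ _ (base_alg_banach L)).
  exact: (analytic_map const_alg_bounded).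
Qed.

End Specialise.

(** * Values of the branching vectors *)

Section BranchingVectors.
Context {R : realType} {p : nat} {K : padicField R p}.
Hypothesis p_pr : prime p.
Local Notation "'rad' h" := ((p%:R : R) ^- h) (at level 10).

(** Along the segment 1 + z (C - 1) the determinant varies by at most 1/p, starting from 1 at z =
    0. *)
Lemma near_one_det d (C : 'M[K]_d) :
  (forall i j, pabs (C i j - (1%:M : 'M[K]_d) i j) <= rad 1) -> pabs (\det C) = 1.
Proof.
move=> H; pose G (z : unit -> K) : 'M[K]_d := 1%:M + z tt *: (C - 1%:M).
have r0 := @rad_ge0 R p p_pr 1; have r1 := @rad_lt1 R p p_pr 1 isT.
have Gn i j : near_cst (rad 1) (fun z => G z i j).
  exists ((1%:M : 'M[K]_d) i j).
    by rewrite mxE; case: eqP => _; rewrite ?pabs1 ?pabs0.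
  have := analyticM (analytic_coord (K := K) tt) (analytic_base_cst unit (H i j)).
  by rewrite mul1r; apply: analytic_eq => z _; rewrite !mxE addrAC subrr add0r.
have i1 : in_ball (fun _ : unit => 1 : K) by move=> i; rewrite pabs1.
have := near_cst_osc (near_cst_det r0 r1 Gn) i1 (@in_ball0 _ _ _ unit).
rewrite /G scale1r (addrC 1%:M) subrK scale0r addr0 det1 => /le_lt_trans/(_ r1).
by apply: pabs_unit_near; rewrite pabs1.
Qed.

Lemma GL_inv d (A : 'M[K]_d) : GL_Zp A ->
  exists2 A', GL_Zp A' & A' *m A = 1%:M /\ A *m A' = 1%:M.
Proof.
move=> [A1 A2]; have dn := pabs1_neq0 A2.
have Au : A \in unitmx by rewrite unitmxE unitfE.
exists (invmx A); last by rewrite mulVmx // mulmxV.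
split; last by rewrite det_inv pabsV A2 invr1.
move=> i j; rewrite /invmx Au !mxE; apply: pabsM_le1; first by rewrite pabsV A2 invr1.
rewrite /cofactor; apply: pabsM_le1; first by rewrite pabsX pabsN1 expr1n.
by apply: integral_det => k l; rewrite !mxE.
Qed.

Lemma lower_block_mx d (c : 'cV[K]_d) (n : 'M[K]_d) :
  integral_mx c -> lower_Zp 0 n -> lower_Zp 0 (block_mx 1%:M 0 c n : 'M_(1 + d)).
Proof.
move=> Hc [l1 l2 l3]; split.
- move=> i; case: (@split_ordP 1 d i) => k ->; last by rewrite (@block_mxEdr _ 1 d 1 d) l1.
  by rewrite (@block_mxEul _ 1 d 1 d) mxE eqxx.
- move=> i j; case: (@split_ordP 1 d i) => k ->; case: (@split_ordP 1 d j) => l ->.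
  + by rewrite !ord1.
  + by rewrite (@block_mxEur _ 1 d 1 d) mxE.
  + by rewrite /= ord1.
  + by rewrite (@block_mxEdr _ 1 d 1 d) /= ltn_add2l; exact: l2.
- move=> i j; case: (@split_ordP 1 d i) => k ->; case: (@split_ordP 1 d j) => l ->.
  + by rewrite !ord1.
  + by rewrite /= ord1.
  + by move=> _; rewrite (@block_mxEdl _ 1 d 1 d) rad0.
  + by rewrite (@block_mxEdr _ 1 d 1 d) /= ltn_add2l; exact: l3.
Qed.

Lemma lower_inv d (A : 'M[K]_d) : lower_Zp 0 A -> exists2 A', lower_Zp 0 A' & A' *m A = 1%:M.
Proof.
elim: d A => [|d IH] A HA.
  by exists A => //; rewrite [LHS]thinmx0 [RHS]thinmx0.
have iA := lower_integral p_pr HA.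
have [AE /IH[n' n'l n'E]] := @lower_block _ _ _ d 0 A HA.
exists (block_mx 1%:M 0 (- (n' *m @dlsubmx _ 1 d 1 d A)) n' : 'M_(1 + d)).
  apply: lower_block_mx => // i j; rewrite mxE pabsN.
  by apply: integral_mulmx i j => // [|i j]; [exact: lower_integral n'l | rewrite !mxE].
rewrite {2}AE (@mulmx_block _ 1 d 1 d 1 d) !(mul1mx, mul0mx, mulmx0, mulmx1, addr0, add0r).
by rewrite addNr n'E -(@scalar_mx_block _ 1 d).
Qed.

Lemma block_diag_mul n1 (a b a' b' : 'M[K]_n1) :
  block_mx a 0 0 b *m block_mx a' 0 0 b' = block_mx (a *m a') 0 0 (b *m b').
Proof. by rewrite mulmx_block !(mul0mx, mulmx0, addr0, add0r). Qed.

Section Size.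
Variable m : nat.
Local Notation n := m.+1.
Local Notation d := (n + n)%N.
Local Notation Mat := ('M[K]_d).
Local Notation NX := (unipotent_space (K := K) p_pr m).

Let W : 'M[K]_n := \matrix_(i, j) (j == rev_ord i)%:R.

Lemma mul_W (M : 'M[K]_n) : W *m M = \matrix_(i, j) M (rev_ord i) j.
Proof.
apply/matrixP => i j; rewrite !mxE (bigD1 (rev_ord i)) //= !mxE eqxx mul1r.
by rewrite big1 ?addr0 // => k /negbTE kn; rewrite !mxE kn mul0r.
Qed.

Lemma W_mul (M : 'M[K]_n) : M *m W = \matrix_(i, j) M i (rev_ord j).
Proof.
apply/matrixP => i j; rewrite !mxE (bigD1 (rev_ord j)) //= !mxE rev_ordK eqxx mulr1.
rewrite big1 ?addr0 // => k kn; rewrite !mxE; case: eqP => [jk|]; last by rewrite mulr0.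
by move: kn; rewrite jk rev_ordK eqxx.
Qed.

Lemma W_W : W *m W = 1%:M.
Proof.
by rewrite mul_W; apply/matrixP => i j; rewrite !mxE rev_ordK eq_sym.
Qed.

Lemma W_integral : integral_mx W.
Proof. by move=> i j; rewrite mxE; case: eqP => _; rewrite ?pabs1 ?pabs0. Qed.

Lemma block_upper_GL (a b c : 'M[K]_n) : GL_Zp a -> integral_mx b -> GL_Zp c ->
  GL_Zp (block_mx a b 0 c : Mat).
Proof.
move=> [a1 a2] b1 [c1 c2]; split; last by rewrite det_ublock pabsM a2 c2 mulr1.
move=> i j; case: (split_ordP i) => k ->; case: (split_ordP j) => l ->.
- by rewrite block_mxEul.
- by rewrite block_mxEur.
- by rewrite block_mxEdl mxE pabs0.
- by rewrite block_mxEdr.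
Qed.

Lemma block_lower (a b : 'M[K]_n) : lower_Zp 0 a -> lower_Zp 0 b ->
  lower_Zp 0 (block_mx a 0 0 b : Mat).
Proof.
move=> [a1 a2 a3] [b1 b2 b3]; split.
- by move=> i; case: (split_ordP i) => k ->; rewrite ?block_mxEul ?block_mxEdr.
- move=> i j; case: (split_ordP i) => k ->; case: (split_ordP j) => l ->.
  + by rewrite block_mxEul; exact: a2.
  + by rewrite block_mxEur mxE.
  + by rewrite block_mxEdl mxE.
  + by rewrite block_mxEdr /= ltn_add2l; exact: b2.
- move=> i j; case: (split_ordP i) => k ->; case: (split_ordP j) => l ->.
  + by rewrite block_mxEul; exact: a3.
  + by rewrite block_mxEur mxE pabs0 rad_ge0.
  + by rewrite block_mxEdl mxE pabs0 rad_ge0.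
  + by rewrite block_mxEdr /= ltn_add2l; exact: b3.
Qed.

Lemma GL1 : GL_Zp (1%:M : 'M[K]_n).
Proof.
split; last by rewrite det1 pabs1.
by move=> i j; rewrite mxE; case: eqP => _; rewrite ?pabs1 ?pabs0.
Qed.

Lemma torus_GL (t : 'rV[K]_n) : torus_Zp t -> GL_Zp (diag_mx t).
Proof. by move=> /(torus_Iw)[]. Qed.

(** An element of [N^1] lies in the orbit of [u] under the lower Borel subgroup
    and [H(Z_p)]: reduce to block unipotent form and apply the Iwahori
    decomposition to the upper right block times [w_n]. *)
Lemma N_beta_orbit (x : Mat) : N_beta 1 x -> exists nb s e1 e2 f1 f2,
  [/\ lower_Zp 0 nb, torus_Zp s, GL_Zp e1 /\ GL_Zp e2, GL_Zp f1 /\ GL_Zp f2 &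
   exists2 g, GL_Zp g & x = g *m block_mx f1 0 0 f2 /\
     nb *m diag_mx s *m g = u_mx m *m block_mx e1 0 0 e2].
Proof.
move=> [xu xn]; have [x1 x2 x3] := xu.
pose A := ulsubmx x; pose B := ursubmx x; pose D := drsubmx x.
have xE : x = block_mx A B 0 D.
  rewrite -[LHS]submxK; congr block_mx; apply/matrixP => i j; rewrite !mxE.
  by rewrite x2 //= (leq_trans (ltn_ord j)) // leq_addr.
have uE : u_mx m = block_mx 1%:M W 0 1%:M :> Mat by [].
have An i j : pabs (A i j - (1%:M : 'M[K]_n) i j) <= rad 1.
  by have := xn (lshift n i) (lshift n j); rewrite uE block_mxEul !mxE.
have Bn i j : pabs (B i j - W i j) <= rad 1.
  by have := xn (lshift n i) (rshift n j); rewrite uE block_mxEur !mxE.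
have Dn i j : pabs (D i j - (1%:M : 'M[K]_n) i j) <= rad 1.
  by have := xn (rshift n i) (rshift n j); rewrite uE block_mxEdr !mxE.
have AG : GL_Zp A by split; [move=> i j; rewrite !mxE; exact: x3 | exact: near_one_det].
have DG : GL_Zp D by split; [move=> i j; rewrite !mxE; exact: x3 | exact: near_one_det].
have Bi : integral_mx B by move=> i j; rewrite !mxE; exact: x3.
have [D' D'G [D'1 D'2]] := GL_inv DG.
(* The right factor diag(A, D) in H(Z_p) is split off x, which leaves the block unipotent matrix
   with corner B D^-1; times w_n, this corner is congruent to 1. *)
pose B' := B *m D'; pose C := B' *m W.
have B'i : integral_mx B' by apply: integral_mulmx => //; exact: D'G.1.
have Ci : integral_mx C by apply: integral_mulmx => //; exact: W_integral.
have small a b c (M : 'M[K]_(a, b)) (N : 'M[K]_(b, c)) e : 0 <= e ->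
    (forall i j, pabs (M i j) <= e) -> integral_mx N ->
    forall i j, pabs ((M *m N) i j) <= e.
  by move=> e0 HM HN i j; rewrite mxE; apply: pabs_sum => // k _; exact: pabs_le1M.
have r0 := @rad_ge0 R p p_pr 1.
have Cn i j : pabs (C i j - (1%:M : 'M[K]_n) i j) <= rad 1.
  (* The first factor is B - W D, divisible by p since B = W and D = 1 modulo p. *)
  have E0 : C - 1%:M = (B - W + W *m (1%:M - D)) *m (D' *m W).
    have -> : B - W + W *m (1%:M - D) = B - W *m D.
      by rewrite mulmxBr mulmx1 addrA subrK.
    by rewrite mulmxBl !mulmxA -[W *m D *m D']mulmxA D'2 mulmx1 W_W.
  have -> : C i j - (1%:M : 'M[K]_n) i j = (C - 1%:M) i j.
    by rewrite [RHS]mxE [X in _ = _ + X]mxE.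
  rewrite E0.
  apply: small => // [k l|]; last by apply: integral_mulmx; [exact: D'G.1 | exact: W_integral].
  rewrite [X in pabs X]mxE; apply: pabsDC; first by have := Bn k l; rewrite !mxE.
  rewrite mul_W mxE; have := Dn (rev_ord k) l; rewrite -pabsN opprB.
  by rewrite !mxE.
have CI : Iw C.
  split; first by split=> //; exact: near_one_det.
  move=> i j ij; have := Cn i j; rewrite [(1%:M : 'M_n) i j]mxE.
  by rewrite -val_eqE /= gtn_eqF // subr0 expr1.
have [nb [s [x0 [n1 n2 [u1 u2 u3] CE]]]] := iwahori_decomposition p_pr CI.
have n0 : lower_Zp 0 nb.
  by have [h1 h2 h3] := n1; split=> // i j /h3 h; apply: le_trans h _; rewrite rad_le.
have [e1 e1l e1E] := lower_inv n0.
(* Conjugation by w_n exchanges upper and lower unipotent matrices. *)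
pose l := W *m x0 *m W.
have lE i j : l i j = x0 (rev_ord i) (rev_ord j) by rewrite /l W_mul mul_W !mxE.
have ll : lower_Zp 0 l.
  split=> [i|i j ij|i j ij]; rewrite lE ?u1 //.
    by rewrite u2 //= !subSS ltn_sub2l // (leq_trans ij) // -ltnS.
  by rewrite rad0.
pose t : 'rV[K]_n := \row_i s 0 (rev_ord i).
have tT : torus_Zp t by move=> i; rewrite mxE; exact: n2.
have WsW : W *m diag_mx s *m W = diag_mx t.
  rewrite W_mul mul_W; apply/matrixP => i j; rewrite !mxE.
  by rewrite (inj_eq rev_ord_inj).
have [l' l'l l'E] := lower_conj ll tT.
pose e2 := diag_mx t *m l.
have e1G := lower_GL p_pr e1l.
have e2G : GL_Zp e2 by apply: GL_Zp_mul; [exact: torus_GL | exact: lower_GL ll].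
(* With C = nb s x0 and e1 the inverse of nb: e1 B' = s x0 W = W (W s W) (W x0 W) = W t l. *)
have Be : e1 *m B' = W *m e2.
  have -> : B' = C *m W by rewrite /C -mulmxA W_W mulmx1.
  rewrite CE !mulmxA e1E mul1mx /e2 -WsW /l !mulmxA.
  have -> : W *m W *m diag_mx s *m W *m W *m x0 *m W = (W *m W) *m diag_mx s *m (W *m W) *m x0 *m W.
    by rewrite !mulmxA.
  by rewrite W_W mul1mx mulmx1.
(* The lower right block l' t equals t l = e2, so both sides are the block upper triangular matrix
   with diagonal e1, e2 and corner W e2. *)
exists (block_mx e1 0 0 l'), (row_mx (const_mx 1) t), e1, e2, A, D; split=> //.
- exact: block_lower.
- move=> i; case: (split_ordP i) => k ->; rewrite ?row_mxEl ?row_mxEr //.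
  by rewrite mxE; exact: pabs1.
- exists (block_mx 1%:M B' 0 1%:M); first exact: block_upper_GL GL1 B'i GL1.
  split.
    rewrite xE mulmx_block !(mul1mx, mul0mx, mulmx0, addr0, add0r).
    by rewrite /B' -mulmxA D'1 mulmx1.
  rewrite diag_mx_row diag_const_mx block_diag_mul mulmx1 -l'E -/e2 uE.
  by rewrite !mulmx_block !(mul1mx, mul0mx, mulmx0, mulmx1, addr0, add0r) Be.
Qed.

Lemma pabs_expz (x : K) (k : int) : pabs x = 1 -> pabs (x ^ k) = 1.
Proof.
move=> x1; case: k => k; rewrite ?NegzE -?exprnP ?pabsX ?x1 ?expr1n //.
by rewrite -invr_expz pabsV -exprnP pabsX x1 expr1n invr1.
Qed.

Lemma u_GL : GL_Zp (u_mx m : Mat).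
Proof. exact: block_upper_GL GL1 W_integral GL1. Qed.

Lemma branching_unit (al : weight m) psi (v : Mat -> K) x :
  branching_vector al psi v ->
  (forall h1 h2 : 'M[K]_n, GL_Zp h1 -> GL_Zp h2 -> pabs (psi h1 h2) = 1) ->
  N_beta 1 x -> pabs (v x) = 1.
Proof.
move=> [[vs va veq] vH v1] psi1 /N_beta_orbit.
move=> [nb [s [e1 [e2 [f1 [f2 [h1 h2 [h3 h3'] [h4 h4'] [g gG [-> E]]]]]]]]].
rewrite vH // pabsM psi1 // mul1r.
have := congr1 pabs (veq nb s g h1 h2 gG).
rewrite E vH //; last exact: u_GL.
rewrite v1 mulr1 psi1 // pabsM pabs_prod big1 ?mul1r // => i _.
by apply: pabs_expz; exact: h2.
Qed.

Lemma meval_analytic (B : banach K) (k : nat) (P : mpoly.mpoly k B) : exists M,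
  forall (I : finType) (x : 'I_k -> (I -> K) -> K), (forall i, analyticK (x i) 1) ->
  analytic (fun z => mpoly.meval (fun i => bemb B (x i z)) P) M.
Proof.
pose F mm := bnorm (mpoly.mcoeff mm P).
exists (\sum_(mm <- mpoly.msupp P) F mm) => I x Hx.
pose T (z : I -> K) mm := mpoly.mcoeff mm P *
  \prod_i bemb B (x i z) ^+ mpoly.fun_of_multinom mm i.
apply: (@analytic_eq _ _ _ B I (fun z => \sum_(mm <- mpoly.msupp P) T z mm)).
  by move=> z _; rewrite mpoly.mevalE.
elim: (mpoly.msupp P) => [|mm s IH].
  apply: (@analytic_eq _ _ _ B I (fun=> 0)); first by move=> z _; rewrite big_nil.
  by apply: analytic0; rewrite big_nil.
apply: (@analytic_eq _ _ _ B I (fun z => T z mm + \sum_(mm <- s) T z mm)).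
  by move=> z _; rewrite big_cons.
rewrite big_cons; apply: analyticD; last first.
  by apply: analytic_le IH; rewrite lerDr bnorm_ge0.
have Hm : analyticK (fun z => \prod_i x i z ^+ mpoly.fun_of_multinom mm i) 1.
  by apply: analytic_prod => i _; exact: analyticX_le1.
have := analytic_map (bounded_embM (mpoly.mcoeff mm P)) Hm; rewrite mulr1.
move=> /(analytic_le (M' := F mm + \sum_(mm <- s) F mm)) H.
apply: analytic_eq (H _) => [z _|]; last first.
  by rewrite lerDl; apply: sumr_ge0 => ? _; exact: bnorm_ge0.
rewrite /T mulrC rmorph_prod; congr (_ * _); apply: eq_bigr => i _.
by rewrite rmorphXn.
Qed.

Lemma polynomial_on_N (B : banach K) (P : mpoly.mpoly (d * d) B) (f : Mat -> B) :
  (forall x, upper_Zp x -> f x = mpoly.meval (fun i => bemb B (mxvec x 0 i)) P) ->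
  exists M, unif_analytic (X := NX) f 0 M.
Proof.
move=> fE; have [M HM] := meval_analytic P; exists M => a aS.
pose x (i : 'I_(d * d)) (z : 'I_d * 'I_d -> K) := mxvec (chart_N a 0 z) 0 i.
have Hx i : analyticK (x i) 1.
  rewrite /x; case: (mxvec_indexP i) => i' j'.
  have [_ _ a3] := aS.
  apply: (@analytic_eq _ _ _ banach_base _ (fun z => a i' j' + (if (i' < j')%N then z (i', j') else 0))).
    by move=> z _; rewrite mxvecE chart_NE expr0 mul1r.
  apply: analyticD; first exact: analytic_base_cst.
  case: (i' < j')%N; first exact: analytic_coord.
  by apply: analytic_base_cst; rewrite pabs0.
apply: analytic_eq (HM _ x Hx) => z Hz; rewrite fE //.
exact: (@ch_dom _ _ _ NX).
Qed.

Lemma algebraic_unif (v : Mat -> K) : algebraic_fun idfun v ->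
  exists M, unif_analytic (X := NX) (A := banach_base) v 0 M.
Proof.
move=> [P [k vE]]; apply: (@polynomial_on_N banach_base P) => x xu.
rewrite vE; last exact: (upper_Iw xu).1.
by rewrite (upper_det xu) expr1n divr1.
Qed.

(** On balls of radius p^-h the nonconstant part has Gauss norm at most M p^-h; as M serves every
    centre, so does h0. *)
Lemma unif_near (v : Mat -> K) (M dl : R) : unif_analytic (X := NX) (A := banach_base) v 0 M ->
  0 < dl -> exists h0, forall h a, (h0 <= h)%N -> upper_Zp a ->
    analyticK (fun z => v (chart_N a h z) - v a) dl.
Proof.
move=> H d0; have [h0 Hh0] := rad_small p_pr M d0.
exists h0 => h a hh aS; have M0 := analytic_ge0 (H a aS).
have ph : pabs (p%:R ^+ h : K) <= 1 by rewrite pabs_pX // rad_le1.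
have [c _ Hc] := analytic_shrink ph (H a aS).
have E z : chart_N a h z = chart_N a 0 (fun i => p%:R ^+ h * z i).
  apply/matrixP => i j; rewrite !chart_NE expr0 mul1r.
  by case: ifP => _; rewrite ?mulr0.
have z0 := @in_ball0 R p K ('I_d * 'I_d)%type.
(* [analytic_shrink] compares with the constant coefficient; subtracting the value at z = 0 replaces
   it by v a. *)
have := analyticB Hc (analytic_base_cst (crd NX) (analytic_bound Hc z0)).
have le : pabs (p%:R ^+ h : K) * M <= dl.
  by rewrite pabs_pX // mulrC; apply: le_trans Hh0; rewrite ler_wpM2l ?rad_le.
move=> /(analytic_le le); apply: analytic_eq => z Hz /=.
have -> : v a = v (chart_N a 0 (fun i : 'I_d * 'I_d => p%:R ^+ h * 0)).
  by congr v; apply/matrixP => i j; rewrite chart_NE mulr0 if_same mulr0 addr0.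
by rewrite E; ring.
Qed.

End Size.
End BranchingVectors.

(** * The map kappa *)

Section Kappa.
Context {R : realType} {p : nat} {K : padicField R p} {L : padicExt K} {m : nat}.
Hypothesis p_pr : prime p.
Variable bv : branching_vectors (K := K) m.
Local Notation "'rad' h" := ((p%:R : R) ^- h) (at level 10).
Local Notation n := m.+1.
Local Notation d := (n + n)%N.
Local Notation Mat := ('M[K]_d).
Local Notation NX := (unipotent_space (K := K) p_pr m).
Local Notation ZX := (units_space (K := K) p_pr).

(** The level h0 is uniform in the centre a. Closure under products and inverses brings in the
    quotient of the two determinantal branching vectors. *)
Definition near_unit (g : Mat -> K) :=
  (forall x, N_beta 1 x -> pabs (g x) = 1) /\
  forall dl, 0 < dl < 1 -> exists h0, forall h a, (h0 <= h)%N -> N_beta 1 a ->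
    analyticK (fun z => g (chart_N a h z) - g a) dl.

Lemma chart_N0 (a : Mat) h : chart_N a h (fun=> 0) = a.
Proof. exact: (@ch0 _ _ _ NX). Qed.

Lemma near_unit_near_cst g dl h a : near_unit g -> N_beta 1 a ->
  analyticK (fun z => g (chart_N a h z) - g a) dl ->
  near_cst dl (fun z => g (chart_N a h z)).
Proof. by move=> [gu _] ha H; exists (g a) => //; rewrite gu. Qed.

Lemma near_unitM g g' : near_unit g -> near_unit g' -> near_unit (fun x => g x * g' x).
Proof.
move=> hg hg'; have [gu gn] := hg; have [gu' gn'] := hg'; split.
  by move=> x hx; rewrite pabsM gu // gu' // mulr1.
move=> dl hd; have [h0 H0] := gn dl hd; have [h1 H1] := gn' dl hd.
exists (maxn h0 h1) => h a; rewrite geq_max => /andP[hh0 hh1] ha.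
have /andP[_ d1] := hd.
have := near_cst_center (near_cstM d1 (near_unit_near_cst hg ha (H0 h a hh0 ha))
  (near_unit_near_cst hg' ha (H1 h a hh1 ha))).
by apply: analytic_eq => z Hz; rewrite chart_N0.
Qed.

Lemma near_unitV g : near_unit g -> near_unit (fun x => (g x)^-1).
Proof.
move=> hg; have [gu gn] := hg; split.
  by move=> x hx; rewrite pabsV gu // invr1.
move=> dl hd; have [h0 H0] := gn dl hd.
exists h0 => h a hh0 ha; have /andP[_ d1] := hd.
have gz : pabs (g (chart_N a h (fun=> 0))) = 1 by rewrite chart_N0 gu.
have := near_cst_center (near_cstV d1 (@in_ball0 R p K ('I_d * 'I_d)%type) gz
  (near_unit_near_cst hg ha (H0 h a hh0 ha))).
by apply: analytic_eq => z Hz; rewrite chart_N0.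
Qed.

Lemma branching_near_unit (al : weight m) psi (v : Mat -> K) :
  branching_vector al psi v ->
  (forall h1 h2 : 'M[K]_n, GL_Zp h1 -> GL_Zp h2 -> pabs (psi h1 h2) = 1) ->
  near_unit v.
Proof.
move=> hv psi1; split; first by move=> x; exact: (branching_unit p_pr hv psi1).
move=> dl /andP[d0 _]; have [[_ va _] _ _] := hv.
have [M HM] := algebraic_unif p_pr va; have [h0 H0] := unif_near HM d0.
by exists h0 => h a hh [aS _]; exact: H0.
Qed.

Lemma v_near k : near_unit (v_ bv k).
Proof. by apply: branching_near_unit (v_P bv k) _ => *; rewrite pabs1. Qed.
Lemma vn1_near : near_unit (vn1 bv).
Proof. by apply: branching_near_unit (vn1P bv) _ => h1 h2 []. Qed.
Lemma vn2_near : near_unit (vn2 bv).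
Proof. by apply: branching_near_unit (vn2P bv) _ => h1 h2 _ []. Qed.

Definition quot (x : Mat) : K := vn2 bv x / vn1 bv x.

Lemma quot_near : near_unit quot.
Proof. exact: near_unitM vn2_near (near_unitV vn1_near). Qed.

Lemma quot_unit x : N_beta 1 x -> Zp_units (quot x).
Proof. by have [h _] := quot_near => /h. Qed.

Lemma upper1 x : N_beta (K := K) (m := m) 1 x -> upper_Zp x.
Proof. by case. Qed.

(** * The function [v_chi] and the continuity of [kappa] for one weight *)

Section OneWeight.
Context {A : normedAlg L} (HA : is_banach A).
Local Notation BA := (banach_of HA).
Variable chi : char_tuple (K := K) m A.
Hypothesis chi_cont : forall i, continuous_char (A := BA) (chi i).

(** For h' >= h0 the quotient maps balls of level h' into balls of level h. The level h0 depends on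
    h alone, as the continuity of [kappa] demands. *)
Lemma quot_comp h : (0 < h)%N -> exists h0, forall h' a f M, (h0 <= h')%N -> N_beta 1 a ->
  analytic (A := BA) (fun z => f (chart_Z (quot a) h z)) M ->
  analytic (A := BA) (fun z => f (quot (chart_N a h' z))) M.
Proof.
move=> hp; have [_ qn] := quot_near.
have [|h0 H0] := qn (rad h); first by rewrite rad_gt0 ?rad_lt1.
exists h0 => h' a f M hh ha Hf.
have pv : pabs (p%:R ^+ h : K)^-1 <= (rad h)^-1 by rewrite pabsV pabs_pX.
have := analyticM (H0 h' a hh ha) (analytic_base_cst _ pv).
rewrite mulfV ?gt_eqF ?rad_gt0 // => Hy.
have := analytic_comp (fun _ : unit => Hy) Hf.
apply: analytic_eq => z Hz; congr f; rewrite /chart_Z mulrC divfK ?pX_neq0 //.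
by rewrite addrC subrK.
Qed.

(** All levels beyond h0 share one bound, so that factors analytic at different levels can be
    multiplied. *)
Definition germ_analytic (F : nat -> ('I_d * 'I_d -> K) -> BA) :=
  exists h0 M, forall h, (h0 <= h)%N -> analytic (F h) M.

Lemma germ_mul F G : germ_analytic F -> germ_analytic G ->
  germ_analytic (fun h z => F h z * G h z).
Proof.
move=> [h0 [M0 H0]] [h1 [M1 H1]]; exists (maxn h0 h1), (M0 * M1) => h.
by rewrite geq_max => /andP[? ?]; apply: analyticM; auto.
Qed.

Lemma germ_eq F G : (forall h z, in_ball z -> F h z = G h z) ->
  germ_analytic F -> germ_analytic G.
Proof.
move=> E [h0 [M0 H0]]; exists h0, M0 => h hh; apply: analytic_eq (H0 h hh) => z; exact: E.
Qed.

Lemma germ_one : germ_analytic (fun _ _ => 1).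
Proof. by exists 0%N, (bnorm (1 : BA)) => h _; exact: analytic_cst. Qed.

Lemma germ_prod (J : Type) (r : seq J) (F : J -> nat -> ('I_d * 'I_d -> K) -> BA) :
  (forall j, germ_analytic (F j)) -> germ_analytic (fun h z => \prod_(j <- r) F j h z).
Proof.
move=> H; elim: r => [|j r IH].
  by apply: germ_eq germ_one => h z _; rewrite big_nil.
by apply: germ_eq (germ_mul (H j) IH) => h z _; rewrite big_cons.
Qed.

Lemma germ_char i g a : near_unit g -> N_beta 1 a ->
  germ_analytic (fun h z => chi i (g (chart_N a h z))).
Proof.
move=> [gu gn] ha; have [dl hd H] := char_near_cst p_pr (chi_cont i).
have [h0 H0] := gn dl hd; exists h0, (bnorm (chi i (g a) : BA) * bnorm (1 : BA)) => h hh.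
by apply: H; [exact: gu | exact: H0].
Qed.

Lemma char_inv i t : Zp_units t -> (chi i t)^-1 = chi i t^-1.
Proof.
move=> ht; have [c1 cM _] := chi_cont i; apply: mulr1_eq.
rewrite -cM //; first by rewrite mulfV ?c1 //; exact: pabs1_neq0.
by rewrite /Zp_units /= pabsV ht invr1.
Qed.

Lemma char_unit i t : Zp_units t -> chi i t \is a GRing.unit.
Proof.
move=> ht; have [c1 cM _] := chi_cont i; apply/unitrP; exists (chi i t^-1).
have tv : Zp_units t^-1 by rewrite /Zp_units /= pabsV ht invr1.
by rewrite -!cM // mulfV ?mulVf ?c1 //; exact: pabs1_neq0.
Qed.

Lemma w_germ a : N_beta 1 a -> germ_analytic (fun h z =>
  ext0 (N_beta 1) (w_ bv chi) (chart_N a h z)).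
Proof.
move=> ha; have [h0 [M H]] : germ_analytic (fun h z =>
    (1 * \prod_(k < m) (chi (idx k) (v_ bv k (chart_N a h z)) *
       chi (idx_next k) (v_ bv k (chart_N a h z))^-1)) *
    chi (idx_n1 m) (vn1 bv (chart_N a h z))^-1 * chi (idx_n m) (vn2 bv (chart_N a h z))).
  apply: germ_mul; last by apply: germ_char vn2_near ha.
  apply: germ_mul; last by apply: germ_char (near_unitV vn1_near) ha.
  apply: germ_mul; first exact: germ_one.
  apply: germ_prod => k; apply: germ_mul; first exact: germ_char (v_near k) ha.
  exact: germ_char (near_unitV (v_near k)) ha.
exists (maxn 1 h0), M => h; rewrite geq_max => /andP[h1 hh].
apply: analytic_eq (H h hh) => z Hz.
have hx : N_beta 1 (chart_N a h z) by apply/(N_beta_chart p_pr) => //; exact: upper1.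
rewrite ext0E // /w_ (upper_det (upper1 hx)).
have [-> _ _] := chi_cont (idx_n1 m).
rewrite (char_inv (idx_n1 m) (vn1_near.1 _ hx)); congr (_ * _ * _ * _).
by apply: eq_bigr => k _; rewrite char_inv //; exact: (v_near k).1.
Qed.

Lemma loc_analytic_N (F : Mat -> A) : supported (N_beta 1) F ->
  (forall a, N_beta 1 a -> germ_analytic (fun h z => F (chart_N a h z))) ->
  loc_analytic (X := NX) (A := BA) F.
Proof.
move=> FS FN; split=> [x xS|a aS]; first by apply: FS => -[].
have [ha|ha] := pselect (N_beta 1 a).
  by have [h0 [M H]] := FN a ha; exists h0, M; exact: H.
exists 1%N, 0; apply: analytic_eq (@analytic0 _ _ _ BA _ 0 (lexx _)) => z Hz.
by rewrite FS // => /(N_beta_chart p_pr (isT : 0 < 1)%N aS Hz).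
Qed.

Lemma w_loc : loc_analytic (X := NX) (A := BA) (ext0 (N_beta 1) (w_ bv chi)).
Proof. apply: loc_analytic_N; [exact: ext0_supported | exact: w_germ]. Qed.

Definition w_mul (f : K -> A) : Mat -> A :=
  ext0 (N_beta 1) (fun x => w_ bv chi x * f (quot x)).

Lemma w_mul_loc f : A_Zp f -> loc_analytic (X := NX) (A := BA) (w_mul f).
Proof.
move=> [_ fl]; apply: loc_analytic_N => [|a ha]; first exact: ext0_supported.
have [h [M Hf]] := fl _ (quot_unit ha).
have Hf' := chart_refine0 (X := ZX) p_pr (leq_maxr 1 h) (Hf : analytic (A := BA) _ M).
have [h0 H0] := quot_comp (leq_maxl 1 h : 0 < maxn 1 h)%N.
have Hq : germ_analytic (fun h' z => f (quot (chart_N a h' z))).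
  by exists h0, M => h' hh; exact: H0 Hf'.
have [h1 [M1 H1]] := germ_mul (w_germ ha) Hq.
exists (maxn 1 h1), M1 => h'; rewrite geq_max => /andP[hp hh].
apply: analytic_eq (H1 h' hh) => z Hz.
have hx : N_beta 1 (chart_N a h' z) by apply/(N_beta_chart p_pr) => //; exact: upper1.
by rewrite /w_mul !ext0E.
Qed.

(** The extension meets the conditions in [v_chi], and [A_eq] shows that whatever [xget] picks
    agrees with it. *)
Lemma v_chi_extend f : A_Zp f -> v_chi bv chi f = extend chi (w_mul f).
Proof.
move=> hf; have hE := extend_A chi_cont (w_mul_loc hf).
have E1 g : N_beta 1 g -> extend chi (w_mul f) g = w_ bv chi g * f (vn2 bv g / vn1 bv g).
  by move=> hg; have gu := upper1 hg; rewrite (extend_upper p_pr chi_cont) // /w_mul ext0E.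
have E2 g : upper_Zp g -> ~ N_beta 1 g -> extend chi (w_mul f) g = 0.
  by move=> hg hn; rewrite (extend_upper p_pr chi_cont) // /w_mul ext0N.
rewrite /v_chi; case: xgetP => [F _ [FA F1 F2]|H]; last first.
  by case: (H (extend chi (w_mul f))).
apply: (A_eq p_pr FA hE) => x hx; have [hb|hb] := pselect (N_beta 1 x).
  by rewrite F1 // E1.
by rewrite F2 // E2.
Qed.

Lemma v_chi_A f : A_Zp f -> A_ chi (v_chi bv chi f).
Proof. by move=> hf; rewrite v_chi_extend //; exact/(extend_A chi_cont)/w_mul_loc. Qed.

Lemma kappa_D (mu : (Mat -> A) -> A) : D_ chi mu -> D_Zp (A := A) (kappa bv chi mu).
Proof.
move=> hmu; have [_ lin bd] := hmu; split; first exact: ext0_supported.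
- move=> a f g hf hg; have hL := A_Zp_lin p_pr HA a hf hg.
  rewrite /kappa !ext0E // -lin; [|exact: v_chi_A | exact: v_chi_A].
  congr mu; rewrite !v_chi_extend // -extend_lin; congr extend.
  apply/funext => x; have [hx|hx] := pselect (N_beta 1 x).
    by rewrite /w_mul !ext0E //; ring.
  by rewrite /w_mul !ext0N // mulr0 addr0.
- move=> h; have [hw [Mw [_ Hw]]] := loc_analytic_unif p_pr w_loc.
  have [h0 H0] := quot_comp (leq_maxl 1 h : 0 < maxn 1 h)%N.
  (* A common level for the weight factor and the quotient; being at least 1, it leaves each ball
     inside [N_beta 1] or disjoint from it. *)
  pose h' := maxn 1 (maxn hw h0).
  have [C HC] := bd h'; exists (C * Mw) => f M hf fU.
  rewrite /kappa ext0E // -mulrA; apply: HC; first exact: v_chi_A.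
  move=> a aS; rewrite (@analytic_chartE _ _ _ _ _ HA) v_chi_extend //.
  (* Off [N_beta 1] the function is 0, and the bound [Mw * M] must be nonnegative there. *)
  have Mf : 0 <= M.
    have u1 : Zp_units (1 : K) by exact: pabs1.
    exact: (analytic_ge0 (fU 1 u1 : analytic (A := BA) _ M)).
  have Mw0 : 0 <= Mw := analytic_ge0 (Hw a aS).
  apply: (@analytic_eq _ _ _ BA _ (fun z => w_mul f (chart_N a h' z))).
    by move=> z Hz; rewrite /= (extend_upper p_pr chi_cont) //; exact: (@ch_dom _ _ _ NX).
  have h'1 : (0 < h')%N by exact: leq_maxl.
  have [ha|ha] := pselect (N_beta 1 a); last first.
    apply: analytic_eq (@analytic0 _ _ _ BA _ (Mw * M) (mulr_ge0 Mw0 Mf)) => z Hz.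
    by rewrite /w_mul ext0N // => /(N_beta_chart p_pr h'1 aS Hz).
  have hh0 : (h0 <= h')%N by rewrite /h' !leq_max leqnn !orbT.
  have hhw : (hw <= h')%N by rewrite /h' !leq_max leqnn !orbT.
  have Hf := chart_refine0 (X := ZX) p_pr (leq_maxr 1 h)
    (fU _ (quot_unit ha) : analytic (A := BA) _ M).
  have Hq := H0 h' a f M hh0 ha Hf.
  apply: analytic_eq (analyticM (chart_refine0 p_pr hhw (Hw a aS)) Hq) => z Hz.
  have hx : N_beta 1 (chart_N a h' z) by apply/(N_beta_chart p_pr).
  by rewrite /w_mul !ext0E.
Qed.

End OneWeight.

(** * The first square *)

Section Square.
Context {O : normedAlg L} (HO : is_banach O).
Variable chi : char_tuple (K := K) m O.
Hypothesis chi_cont : forall i, continuous_char (A := banach_of HO) (chi i).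
Variable ev : {lrmorphism O -> base_alg L}.
Local Notation chi' := (pull ev chi).
Let chi_cont' := pull_cont chi_cont ev.

Lemma A_Zp_ev (f : K -> O) : A_Zp f -> A_Zp (ev \o f).
Proof.
move=> [fs fl]; split=> [x xS|a aS]; first by rewrite /= fs // rmorph0.
have [h [M H]] := fl a aS; exists h, (1 * M).
rewrite (@analytic_chartE _ _ _ _ _ (base_alg_banach L)).
exact: (analytic_map (ev_bounded HO ev)).
Qed.

Lemma ev_v_chi (f : K -> O) : A_Zp f ->
  ev \o v_chi bv chi f = v_chi bv chi' (ev \o f).
Proof.
move=> hf; rewrite (v_chi_extend chi_cont) // ev_extend.
rewrite (v_chi_extend (HA := base_alg_banach L) chi_cont' (A_Zp_ev hf)).
congr extend; apply/funext => x /=; rewrite /w_mul.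
have [hx|hx] := pselect (N_beta 1 x); last by rewrite !ext0N // rmorph0.
rewrite !ext0E // rmorphM /w_ /pull !rmorphM; congr (_ * _).
(* [ev] commutes with inversion at units; character values at units of Z_p are such. *)
rewrite rmorphV /=; last by apply: (char_unit chi_cont); exact: vn1_near.1.
congr (_ * _ * _ * _); rewrite rmorph_prod; apply: eq_bigr => k _.
rewrite rmorphM rmorphV //=; apply: (char_unit chi_cont); exact: (v_near k).1.
Qed.

Lemma kappa_specialise (mu : (Mat -> O) -> O) : D_ chi mu ->
  kappa bv chi' (specialise ev (A_ chi) (A_ chi') mu) =
  specialise ev (A_Zp (A := O)) (A_Zp (A := base_alg L)) (kappa bv chi mu).
Proof.
move=> hmu; apply/funext => f; have [hf|hf] := pselect (A_Zp f); last first.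
  by rewrite /kappa ext0N // /specialise ext0N.
rewrite (sp_ZpE p_pr HO ev (kappa_D chi_cont hmu) hf) /kappa ext0E //.
have hc : A_Zp (const_alg (O := O) \o f) by exact: A_Zp_const.
rewrite [in RHS]ext0E // -{1}(ev_const_fun ev f) -ev_v_chi //.
rewrite (spE p_pr chi_cont hmu) ?ev_v_chi //; first exact: v_chi_A.
by apply: (v_chi_A (HA := base_alg_banach L) chi_cont'); exact: A_Zp_ev.
Qed.

End Square.
End Kappa.

(** * Classical weights *)

Lemma prod_expz (F : fieldType) (I : Type) (r : seq I) (f : I -> F) (a : I -> int) (z : int) :
  (\prod_(i <- r) f i ^ a i) ^ z = \prod_(i <- r) f i ^ (a i * z).
Proof.
elim: r => [|i r IH]; first by rewrite !big_nil exp1rz.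
by rewrite !big_cons expfzMl IH exprz_exp.
Qed.

Lemma telescope_if (l : nat -> int) r k : (r <= k)%N ->
  \sum_(i < k) (if (r <= i)%N then l i - l i.+1 else 0) = l r - l k.
Proof.
elim: k => [|k IH]; first by rewrite leqn0 => /eqP->; rewrite big_ord0 subrr.
rewrite leq_eqVlt => /orP[/eqP->|].
  rewrite big1 ?subrr // => i _; by rewrite leqNgt ltn_ord.
rewrite ltnS => rk; rewrite big_ord_recr /= IH // rk; ring.
Qed.

Section AlgebraicFunctions.
Context {R : realType} {p : nat} {K : padicField R p} (m : nat).
Local Notation n := m.+1.
Local Notation d := (n + n)%N.
Local Notation Mat := ('M[K]_d).

Lemma GL_det_neq0 (g : Mat) : GL_Zp g -> \det g != 0.
Proof. by move=> [_ /pabs1_neq0]. Qed.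

Section Field.
Context {F : fieldType} (iota : {rmorphism K -> F}).
Implicit Types f : Mat -> F.

Lemma det_poly : exists P : mpoly.mpoly (d * d) F, forall g : Mat,
  mpoly.meval (fun i => iota (mxvec g 0 i)) P = iota (\det g).
Proof.
exists (\det (\matrix_(i < d, j < d) mpoly.mpolyX F (mpoly.mnm1 (mxvec_index i j)))) => g.
rewrite -[LHS]det_map_mx -det_map_mx; congr (\det _).
by apply/matrixP => i j; rewrite !mxE /= mpoly.mevalXU mxvecE.
Qed.

Lemma iota_det_neq0 (g : Mat) k : GL_Zp g -> iota (\det g) ^+ k != 0.
Proof. by move=> /GL_det_neq0 g0; rewrite expf_neq0 // fmorph_eq0. Qed.

Lemma algebraic_eq (f f' : Mat -> F) : (forall g, GL_Zp g -> f g = f' g) ->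
  algebraic_fun iota f -> algebraic_fun iota f'.
Proof. by move=> E [P [k H]]; exists P, k => g hg; rewrite -E // H. Qed.

Lemma algebraic_lin (a : F) f f' : algebraic_fun iota f -> algebraic_fun iota f' ->
  algebraic_fun iota (fun g => a * f g + f' g).
Proof.
move=> [P [k H]] [P' [k' H']]; have [D HD] := det_poly.
exists (a *: (P * D ^+ k') + P' * D ^+ k), (k + k')%N => g hg.
rewrite mpoly.mevalD mpoly.mevalZ !mpoly.mevalM !rmorphXn /= HD H // H' // exprD.
by field; rewrite !iota_det_neq0.
Qed.

Lemma algebraicM f f' : algebraic_fun iota f -> algebraic_fun iota f' ->
  algebraic_fun iota (fun g => f g * f' g).
Proof.
move=> [P [k H]] [P' [k' H']]; exists (P * P'), (k + k')%N => g hg.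
by rewrite mpoly.mevalM H // H' // exprD; field; rewrite !iota_det_neq0.
Qed.

Lemma algebraic1 : algebraic_fun iota (fun _ : Mat => (1 : F)).
Proof. by exists 1, 0%N => g _; rewrite mpoly.meval1 expr0 divr1. Qed.

Lemma algebraic_expz f (z : int) : 0 <= z -> algebraic_fun iota f ->
  algebraic_fun iota (fun g => f g ^ z).
Proof.
case: z => // z _ Hf; elim: z => [|z IH].
  by apply: algebraic_eq algebraic1 => g _; rewrite expr0z.
by apply: algebraic_eq (algebraicM Hf IH) => g _; rewrite -!exprnP exprS.
Qed.

Lemma algebraic_prod (J : Type) (r : seq J) (f : J -> Mat -> F) :
  (forall j, algebraic_fun iota (f j)) ->
  algebraic_fun iota (fun g => \prod_(j <- r) f j g).
Proof.
move=> H; elim: r => [|j r IH].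
  by apply: algebraic_eq algebraic1 => g _; rewrite big_nil.
by apply: algebraic_eq (algebraicM (H j) IH) => g _; rewrite big_cons.
Qed.

Lemma algebraic_det (z : int) : algebraic_fun iota (fun g : Mat => iota (\det g) ^ z).
Proof.
case: z => z; last first.
  by exists 1, z.+1 => g _; rewrite mpoly.meval1 div1r NegzE -exprnN.
have [D HD] := det_poly; exists (D ^+ z), 0%N => g _.
by rewrite rmorphXn /= HD expr0 divr1.
Qed.

Lemma algebraic_base_change (f : Mat -> K) : algebraic_fun idfun f ->
  algebraic_fun iota (fun g => iota (f g)).
Proof.
move=> [P [k H]].
exists (\sum_(mm <- mpoly.msupp P) iota (mpoly.mcoeff mm P) *: mpoly.mpolyX F mm), k.
move=> g hg; rewrite H // fmorph_div rmorphXn mpoly.mevalE; congr (_ / _).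
rewrite !rmorph_sum; apply: eq_bigr => mm _ /=.
rewrite mpoly.mevalZ mpoly.mevalX rmorphM rmorph_prod; congr (_ * _).
by apply: eq_bigr => i _; rewrite rmorphXn.
Qed.

End Field.
End AlgebraicFunctions.

(** * The second square *)

Section Classical.
Context {R : realType} {p : nat} {K : padicField R p} {L : padicExt K} {m : nat}.
Hypothesis p_pr : prime p.
Variable bv : branching_vectors (K := K) m.
Local Notation n := m.+1.
Local Notation d := (n + n)%N.
Local Notation Mat := ('M[K]_d).
Local Notation NX := (unipotent_space (K := K) p_pr m).
Local Notation BL := (banach_of (base_alg_banach L)).
Variable lam : weight m.
Local Notation chil := (algebraic_char (base_alg L) lam).
Hypothesis chi_cont : forall i, continuous_char (A := BL) (chil i).

Lemma chil_prod (s : 'rV[K]_d) : torus_Zp s ->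
  \prod_i chil i (s 0 i) = in_alg L (\prod_i s 0 i ^ lam i) :> L.
Proof.
move=> hs; rewrite rmorph_prod; apply: eq_bigr => i _.
rewrite /algebraic_char ext0E; last exact: hs.
by rewrite /emb; exact: mulr1.
Qed.

Definition restrict_V (f : Mat -> L) : Mat -> base_alg L :=
  ext0 (Iw_beta 1) (ext0 (@Iw R p K d) f).

Lemma restrict_V_extend f : V_ (in_alg L) lam f ->
  restrict_V f = extend chil (ext0 (N_beta 1) f).
Proof.
move=> [fs fa fe]; have Iwb g : Iw_beta (K := K) (m := m) 1 g -> Iw g.
  by move=> [nb [s [x [h1 h2 [h3 _] ->]]]]; exact: Iw_decomposed.
apply: (eq_extend p_pr) => [g hg| |nb s x h1 h2 h3].
- by rewrite /restrict_V ext0N // => /Iwb.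
- exact: ext0_supported.
- rewrite (extendE p_pr) //; have [hb|hb] := pselect (N_beta 1 x).
    have hb' : Iw_beta 1 (nb *m diag_mx s *m x) by exact/(Iw_beta_decomposed p_pr h1 h2 h3).
    rewrite /restrict_V !ext0E //; last exact: Iwb.
    by rewrite chil_prod // fe //; [exact: lower0 h1 | exact: (upper_Iw h3).1].
  rewrite /restrict_V ext0N; last by move/(Iw_beta_decomposed p_pr h1 h2 h3).
  by rewrite [X in _ * X]ext0N // mulr0.
Qed.

Lemma restrict_V_A f : V_ (in_alg L) lam f -> A_ chil (restrict_V f).
Proof.
move=> hf; rewrite restrict_V_extend //; apply: (extend_A (p_pr := p_pr) chi_cont).
have [fs [P [k fE]] _] := hf.
have [x xu|M HM] := @polynomial_on_N R p K p_pr m BL P f.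
  rewrite fE; last exact: (upper_Iw xu).1.
  rewrite (upper_det xu) rmorph1 expr1n divr1; congr (mpoly.meval _ P).
  by apply/funext => i; apply/esym; exact: mulr1.
have hl : loc_analytic (X := NX) (A := BL) (ext0 (@upper_Zp R p K d) f).
  split=> [|a aS]; first exact: ext0_supported.
  exists 0%N, M; apply: analytic_eq (HM a aS) => z Hz.
  by rewrite ext0E //; exact: (@ch_dom _ _ _ NX).
have := loc_analytic_beta hl; congr loc_analytic.
apply/funext => x; have [hx|hx] := pselect (N_beta 1 x); last by rewrite !ext0N.
by rewrite !ext0E //; exact: upper1.
Qed.

Lemma V_lin (a : L) (f g : Mat -> L) : V_ (in_alg L) lam f -> V_ (in_alg L) lam g ->
  V_ (in_alg L) lam (fun x => a * f x + g x).
Proof.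
move=> [fs fa fe] [gs ga ge]; split=> [x hx||nb s x h1 h2 h3].
- by rewrite fs // gs // mulr0 addr0.
- exact: (algebraic_lin (iota := in_alg L)).
- by rewrite fe // ge //; ring.
Qed.

Lemma r_V_dual (mu : (Mat -> base_alg L) -> base_alg L) : D_ chil mu ->
  V_dual lam (r_ lam mu).
Proof.
move=> [_ lin _]; split; first exact: ext0_supported.
move=> a f g hf hg; have hL := V_lin a hf hg.
rewrite /r_ !ext0E // -[in RHS]lin; [|exact: restrict_V_A|exact: restrict_V_A].
congr mu; apply/funext => x; have [hx|hx] := pselect (Iw_beta 1 x); last first.
  by rewrite !ext0N // mulr0 addr0.
rewrite !(ext0E _ hx); have [hi|hi] := pselect (Iw x); first by rewrite !ext0E.
by rewrite !ext0N // mulr0 addr0.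
Qed.

Hypothesis lam_dom : pure_dominant lam.

(** This identity gives [v_lam] the weight [lam]: the exponents of [vn1] and [vn2] add up to
    lambda_n - lambda_(n+1). For i <= n the sum telescopes; for i > n it telescopes to values at the
    mirror indices, which purity converts back. *)
Lemma weight_sum (i : 'I_d) :
  \sum_(k < m) alpha k.+1 i * (lam (idx k) - lam (idx_next k))
  + alpha_n i * (lam (idx_n m) - lam (idx_n1 m)) + lam (idx_n1 m) = lam i.
Proof.
have [_ [w pure]] := lam_dom.
pose l k := lam (lshift n (inord k : 'I_n)).
have idxE (k : 'I_m) : lam (idx k) = l k.
  congr (lam (lshift _ _)); apply/val_inj; rewrite /= inordK // ltnS ltnW //.
have nextE (k : 'I_m) : lam (idx_next k) = l k.+1.
  by congr (lam (lshift _ _)); apply/val_inj; rewrite /= inordK // ltnS.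
have nE : lam (idx_n m) = l m.
  by congr (lam (lshift _ _)); apply/val_inj; rewrite /= inordK.
case: (split_ordP i) => r ->.
  have -> : \sum_(k < m) alpha k.+1 (lshift n r) * (lam (idx k) - lam (idx_next k)) =
      \sum_(k < m) (if (r <= k)%N then l k - l k.+1 else 0).
    apply: eq_bigr => k _; rewrite idxE nextE /alpha /= ltnS.
    case: ifP => rk; first by rewrite mul1r.
    rewrite leqNgt (leq_trans (ltn_ord r)) ?mul0r // -addnBA; last by rewrite ltnW // ltnS.
    exact: leq_addr.
  rewrite telescope_if; last by rewrite -ltnS.
  rewrite /alpha_n /= ltn_ord mul1r nE.
  have -> : lam (lshift n r) = l r by congr (lam (lshift _ _)); rewrite inord_val.
  ring.
have -> : \sum_(k < m) alpha k.+1 (rshift n r) * (lam (idx k) - lam (idx_next k)) =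
    - \sum_(k < m) (if (rev_ord r <= k)%N then l k - l k.+1 else 0).
  rewrite -sumrN; apply: eq_bigr => k _; rewrite idxE nextE /alpha /=.
  have -> : (n + r < k.+1)%N = false.
    by apply/negbTE; rewrite -leqNgt (leq_trans _ (leq_addr _ _)) // ltnS ltnW.
  have -> : (n + n - k.+1 <= n + r)%N = (n - r.+1 <= k)%N.
    by apply/idP/idP; lia.
  by case: ifP => _; rewrite ?mulN1r ?mul0r ?oppr0.
rewrite telescope_if; last by rewrite -ltnS.
rewrite /alpha_n /= ltnNge leq_addr /= mul0r addr0.
have p1 := pure (rshift n r); have p2 := pure (idx_n m).
have e1 : rev_ord (rshift n r) = lshift n (rev_ord r).
  by apply/val_inj; rewrite /= -addnS subnDl.
have e2 : rev_ord (idx_n m) = idx_n1 m.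
  by apply/val_inj; rewrite /= -addnBA // subnn.
have -> : l (rev_ord r) = lam (lshift n (rev_ord r)) by congr (lam (lshift _ _)); rewrite inord_val.
rewrite e1 in p1; rewrite e2 nE in p2.
have -> : lam (rshift n r) = w - lam (lshift n (rev_ord r)) by rewrite -p1; ring.
by rewrite -p2; ring.
Qed.

Variable j : int.
Hypothesis jcrit : Crit lam j.

Lemma V_equivariant (al : weight m) psi v nb s g : branching_vector (K := K) al psi v ->
  lower_Zp 0 nb -> torus_Zp s -> GL_Zp g ->
  v (nb *m diag_mx s *m g) = (\prod_i s 0 i ^ al i) * v g.
Proof. by move=> [[_ _ ve] _ _]; exact: ve. Qed.

Lemma v_lam_V : V_ (in_alg L) lam (fun g => in_alg L (v_lam bv lam j g)).
Proof.
have [dom _] := lam_dom; have /andP[j1 j2] := jcrit.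
split=> [g hg||nb s g h1 h2 h3].
- by rewrite /v_lam ext0N // rmorph0.
- apply: algebraic_base_change.
  apply: (algebraic_eq (iota := idfun) (f := fun g =>
    (\prod_(k < m) v_ bv k g ^ (lam (idx k) - lam (idx_next k)))
    * vn1 bv g ^ (- lam (idx_n1 m) - j) * vn2 bv g ^ (lam (idx_n m) + j)
    * \det g ^ lam (idx_n1 m))).
    by move=> g hg; rewrite /v_lam ext0E.
  apply: (algebraicM (iota := idfun)); last exact: (algebraic_det m idfun).
  have [[_ a1 _] _ _] := vn1P bv; have [[_ a2 _] _ _] := vn2P bv.
  (* The two inequalities defining [Crit] make the exponent of [vn2], and then that of [vn1],
     nonnegative; dominance does the same for the other vectors. *)
  apply: (algebraicM (iota := idfun)); last first.
    by apply: (algebraic_expz (iota := idfun)) => //; rewrite -lerBlDl sub0r.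
  apply: (algebraicM (iota := idfun)); last first.
    by apply: (algebraic_expz (iota := idfun)) => //; rewrite subr_ge0.
  apply: (algebraic_prod (iota := idfun)) => k; have [[_ ak _] _ _] := v_P bv k.
  apply: (algebraic_expz (iota := idfun)) => //; rewrite subr_ge0; apply: dom.
  exact: leqnSn.
- have hg : GL_Zp (nb *m diag_mx s *m g).
    by apply: GL_Zp_mul => //; apply: GL_Zp_mul; [exact: lower_GL h1 | exact: (torus_Iw h2).1].
  rewrite -rmorphM /v_lam !ext0E //; congr (in_alg L _).
  have sn0 i : s 0 i != 0 by apply/pabs1_neq0/h2.
  rewrite (V_equivariant (vn1P bv)) // (V_equivariant (vn2P bv)) //.
  have -> : \prod_(k < m) v_ bv k (nb *m diag_mx s *m g) ^ (lam (idx k) - lam (idx_next k)) =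
     (\prod_(k < m) \prod_i s 0 i ^ (alpha k.+1 i * (lam (idx k) - lam (idx_next k)))) *
     \prod_(k < m) v_ bv k g ^ (lam (idx k) - lam (idx_next k)).
    rewrite -big_split; apply: eq_bigr => k _ /=.
    by rewrite (V_equivariant (v_P bv k)) // expfzMl prod_expz.
  rewrite !det_mulmx (lower_det h1) mul1r det_diag !expfzMl !prod_expz.
  have -> : \prod_i s 0 i ^ lam i =
     (\prod_(k < m) \prod_i s 0 i ^ (alpha k.+1 i * (lam (idx k) - lam (idx_next k)))) *
     (\prod_i s 0 i ^ (alpha_n i * (- lam (idx_n1 m) - j))) *
     (\prod_i s 0 i ^ (alpha_n i * (lam (idx_n m) + j))) *
     (\prod_i s 0 i) ^ lam (idx_n1 m).
    have -> : (\prod_i s 0 i) ^ lam (idx_n1 m) = \prod_i s 0 i ^ lam (idx_n1 m).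
      have := prod_expz (index_enum 'I_d) (fun i => s 0 i) (fun=> 1) (lam (idx_n1 m)).
      under eq_bigr do rewrite expr1z.
      by under [in RHS]eq_bigr do rewrite mul1r.
    rewrite exchange_big /= -!big_split /=; apply: eq_bigr => i _.
    have -> : \prod_(k < m) s 0 i ^ (alpha k.+1 i * (lam (idx k) - lam (idx_next k))) =
       s 0 i ^ (\sum_(k < m) alpha k.+1 i * (lam (idx k) - lam (idx_next k))).
      by elim/big_rec2: _ => [|k x y _ ->]; rewrite ?expr0z // expfzDr.
    rewrite -!expfzDr // -{1}(weight_sum i); congr (_ ^ _); ring.
  ring.
Qed.

Lemma z_pow_A : A_Zp (z_pow (L := L) j).
Proof.
split=> [|a au]; first exact: ext0_supported.
exists 1%N, (bnorm (1 : BL) * 1); rewrite (@analytic_chartE _ _ _ _ _ (base_alg_banach L)).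
have r1 := @rad_lt1 R p p_pr 1 isT; have r0 := @rad_ge0 R p p_pr 1.
have zu : in_ball (fun _ : unit => 0 : K) := @in_ball0 R p K unit.
have cn : near_cst (p%:R ^- 1) (fun z : unit -> K => chart_Z a 1 z).
  exists a; first by rewrite (au : pabs a = 1).
  have pk : pabs (p%:R ^+ 1 : K) <= p%:R ^- 1 by rewrite pabs_pX.
  have := analyticM (analytic_base_cst _ pk) (analytic_coord (K := K) tt).
  by rewrite mulr1; apply: analytic_eq => z _; rewrite /chart_Z addrAC subrr add0r.
have cX k : near_cst (p%:R ^- 1) (fun z : unit -> K => chart_Z a 1 z ^+ k).
  elim: k => [|k IH].
    by apply: near_cst_eq (near_cst_cst unit r0 (_ : pabs (1 : K) <= 1)); rewrite ?pabs1.
  by apply: near_cst_eq (near_cstM r1 cn IH) => z _; rewrite exprS.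
have cZ : near_cst (p%:R ^- 1) (fun z : unit -> K => chart_Z a 1 z ^ j).
  case: j => k; first exact: cX.
  rewrite NegzE; apply: near_cst_eq (near_cstV r1 zu _ (cX k.+1)) => [z _|].
    by rewrite -exprnN.
  by rewrite pabsX /chart_Z mulr0 addr0 (au : pabs a = 1) expr1n.
apply: analytic_eq (analytic_emb BL (near_cst_analytic r1 cZ)) => z Hz.
rewrite /z_pow /= ext0E //.
exact: (@ch_dom _ _ _ (units_space (K := K) p_pr) a 1).
Qed.

(** Both sides lie in [A_ chil], so N(Z_p) decides. There the determinant is 1, and on [N_beta 1]
    the factor (vn2 / vn1)^j of the left side combines with those of [w_] into the exponents
    -lambda_(n+1) - j and lambda_n + j of [v_lam]. *)
Lemma branch_value : v_chi bv chil (z_pow (L := L) j) =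
  restrict_V (fun g => in_alg L (v_lam bv lam j g)).
Proof.
apply: (A_eq p_pr (v_chi_A p_pr bv chi_cont z_pow_A) (restrict_V_A v_lam_V)) => x hx.
rewrite (v_chi_extend p_pr bv chi_cont z_pow_A) (restrict_V_extend v_lam_V).
rewrite !(extend_upper p_pr chi_cont) //.
have [hb|hb] := pselect (N_beta 1 x); last by rewrite /w_mul !ext0N.
rewrite /w_mul !ext0E //; have hG := (upper_Iw hx).1.
have embE (t : K) : emb (base_alg L) t = in_alg L t by exact: mulr1.
have chE i t : Zp_units t -> chil i t = in_alg L (t ^ lam i).
  by move=> ht; rewrite /algebraic_char ext0E // embE.
have u1 := (vn1_near p_pr bv).1 _ hb; have u2 := (vn2_near p_pr bv).1 _ hb.
have uk k := (v_near p_pr bv k).1 _ hb.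
rewrite /z_pow ext0E ?embE; last exact: (quot_unit p_pr).
rewrite /w_ (upper_det hx) !chE //; last exact: pabs1.
have -> : \prod_(k < m) (chil (idx k) (v_ bv k x) / chil (idx_next k) (v_ bv k x)) =
   in_alg L (\prod_(k < m) v_ bv k x ^ (lam (idx k) - lam (idx_next k))).
  rewrite rmorph_prod; apply: eq_bigr => k _; rewrite !chE; try exact: uk.
  rewrite expfzDr; last exact: pabs1_neq0.
  by rewrite rmorphM -invr_expz fmorphV.
rewrite /v_lam ext0E // (upper_det hx) !exp1rz mulr1 rmorph1 mul1r.
have merge (a b c e : K) : in_alg L a / in_alg L b * in_alg L c * in_alg L e =
    in_alg L (a * b^-1 * c * e) by rewrite !rmorphM fmorphV.
apply: etrans (merge _ _ _ _) _; congr (in_alg L _).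
have n1 := pabs1_neq0 u1; have n2 := pabs1_neq0 u2.
rewrite /quot expfzMl !expfzDr // exprz_inv -!invr_expz; ring.
Qed.

Lemma kappa_classical (mu : (Mat -> base_alg L) -> base_alg L) :
  kappa_lam bv lam j (r_ lam mu) = kappa bv chil mu (z_pow j).
Proof.
rewrite /kappa ext0E; last exact: z_pow_A.
rewrite branch_value /kappa_lam /r_ ext0E //; exact: v_lam_V.
Qed.

End Classical.

Unset Implicit Arguments.
Set Strict Implicit.
Set Printing Implicit Defensive.

Theorem proposition11p13 (R : realType) (p : nat) (K : padicField R p)
    (L : padicExt K) (m : nat) (bv : branching_vectors (K := K) m)
    (O : normedAlg L) (chi : char_tuple (K := K) m O)
    (lam : weight m) (ev : {lrmorphism O -> base_alg L}) (j : int) :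
  prime p ->
  affinoid_in_pure_weights chi ->
  pure_dominant lam ->
  pull ev chi = algebraic_char (base_alg L) lam ->
  Crit lam j ->
  let chi_lam := algebraic_char (base_alg L) lam in
  let sp := specialise ev (A_ chi) (A_ chi_lam) in
  let sp_Zp := specialise ev (A_Zp (A := O)) (A_Zp (A := base_alg L)) in
  [/\ set_fun (D_beta 1 chi) (D_beta 1 chi_lam) sp,
      set_fun (D_beta 1 chi_lam) (V_dual lam) (r_ lam),
      set_fun (D_beta 1 chi) (D_Zp (A := O)) (kappa bv chi),
      set_fun (D_beta 1 chi_lam) (D_Zp (A := base_alg L)) (kappa bv chi_lam) &
      set_fun (D_Zp (A := O)) (D_Zp (A := base_alg L)) sp_Zp] /\
  [/\ forall mu, D_beta 1 chi mu ->
        kappa bv chi_lam (sp mu) = sp_Zp (kappa bv chi mu) &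
      forall mu, D_beta 1 chi_lam mu ->
        kappa_lam bv lam j (r_ lam mu) = kappa bv chi_lam mu (z_pow j)].
Proof.
move=> p_pr [[HO _] _ [chiP _] _ _] lam_dom chiE jcrit chi_lam sp sp_Zp.
have chi_cont i : continuous_char (A := banach_of HO) (chi i) by have [] := chiP i.
have lam_cont i : continuous_char (A := banach_of (base_alg_banach L)) (chi_lam i).
  by rewrite /chi_lam -chiE; exact: pull_cont.
split; split.
- by move=> mu hmu; rewrite /sp /chi_lam -chiE; exact: (sp_D_beta p_pr chi_cont).
- by move=> mu [hmu _]; exact: (r_V_dual p_pr lam_cont hmu).
- by move=> mu [hmu _]; exact: (kappa_D p_pr bv chi_cont hmu).
- by move=> mu [hmu _]; exact: (kappa_D p_pr bv lam_cont hmu).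
- by move=> mu; exact: (sp_Zp_D p_pr HO).
- by move=> mu [hmu _]; rewrite /sp /sp_Zp /chi_lam -chiE; exact: kappa_specialise.
- by move=> mu _; exact: (kappa_classical p_pr bv lam_cont lam_dom jcrit).
Qed.
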